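(* Assume $p=p_n\to\infty$ as $n\to\infty$. (a) As $n\to\infty$, $$\frac{1}{\alpha_n}\big(\Theta_{\max}+\Theta_{\min}-\pi\big)\ \text{ converges in distribution to }\ Z_2-Z_1,$$ where $Z_1$ and $Z_2$ are independent random variables, each with cumulative distribution function $D(x)=1-\exp\left\{-\frac{1}{2\sqrt{2\pi}}e^{x/2}\right\}$, $x\in\mathbb{R}$. (b) As $n\to\infty$, both $\Theta_{\min}-\arcsin(t_n)$ and $\pi-\Theta_{\max}-\arcsin(t_n)$ converge in probability to zero.
   Context: For each $n\ge 2$ let $p=p_n\ge 2$ be an integer and let $X_1,\ldots,X_n$ be i.i.d. random vectors uniformly distributed on the unit sphere $\mathbb S^{p-1}=\{x\in\mathbb R^p:\|x\|=1\}$ (Euclidean norm). Define $\Theta_{ij}=\arccos(X_i^TX_j)\in[0,\pi]$ for $1\le i<j\le n$, and $\Theta_{\min}=\min_{1\le i<j\le n}\Theta_{ij}$, $\Theta_{\max}=\max_{1\le i<j\le n}\Theta_{ij}$. Set $$t_n=\exp\left\{-\frac{2\ln n}{p_n-1}\right\}\in(0,1),\qquad \alpha_n=\frac{t_n}{2(p_n-1)\sqrt{1-t_n^2}}.$$ *)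

(* Defs.v *)
From HB Require Import structures.
From mathcomp Require Import all_boot all_order all_algebra.
From mathcomp Require Import all_classical all_reals.
From mathcomp Require Import ereal topology normedtype sequences exp trigo measure.
From mathcomp Require Import measurable_realfun lebesgue_measure random_variable.
Set Implicit Arguments.
Unset Strict Implicit.
Unset Printing Implicit Defensive.
Import Order.TTheory GRing.Theory Num.Theory.
Import numFieldNormedType.Exports.
Local Open Scope classical_set_scope.
Local Open Scope ring_scope.

(* R^p is p.-tuple R, on which the library puts the product (Borel)
   sigma-algebra; row vectors have no measurable structure, and their library
   norm is the sup norm, hence the explicit Euclidean norm. *)
Definition dotp (R : realType) (p : nat) (x y : p.-tuple R) : R :=
  \sum_(k < p) tnth x k * tnth y k.

Definition enorm (R : realType) (p : nat) (x : p.-tuple R) : R :=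
  Num.sqrt (dotp x x).

Definition mxact (R : realType) (p : nat) (A : 'M[R]_p) (x : p.-tuple R) :
    p.-tuple R :=
  [tuple \sum_(k < p) A i k * tnth x k | i < p].

(* The uniform distribution on the sphere (normalized surface measure) is the
   probability measure carried by the sphere and invariant under the orthogonal
   group; these two conditions determine it. *)
Definition uniform_on_sphere (R : realType) (p : nat)
    (mu : probability (p.-tuple R) R) : Prop :=
  mu [set x | enorm x = 1] = 1%E /\
  forall A : 'M[R]_p, A *m A^T = 1%:M ->
  forall B : set (p.-tuple R), measurable B -> mu (mxact A @^-1` B) = mu B.

Definition mutually_independent (R : realType) (d d' : measure_display)
    (T : measurableType d) (T' : measurableType d') (P : probability T R)
    (I : finType) (X : I -> {RV P >-> T'}) : Prop :=
  forall (J : {set I}) (B : I -> set T'), (forall i, measurable (B i)) ->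
  P (\bigcap_(i in [set` J]) X i @^-1` B i) =
  (\prod_(i in J) P (X i @^-1` B i))%E.

Definition independent2 (R : realType) (d d1 d2 : measure_display)
    (T : measurableType d) (T1 : measurableType d1) (T2 : measurableType d2)
    (P : probability T R) (X : {RV P >-> T1}) (Y : {RV P >-> T2}) : Prop :=
  forall (A : set T1) (B : set T2), measurable A -> measurable B ->
  P (X @^-1` A `&` Y @^-1` B) = (P (X @^-1` A) * P (Y @^-1` B))%E.

(* The Y n may live on different probability spaces; the measurability clause
   says that they are random variables. *)
Definition cvg_in_distribution (R : realType) (d : nat -> measure_display)
    (T : forall n, measurableType (d n)) (P : forall n, probability (T n) R)
    (Y : forall n, T n -> R)
    (d' : measure_display) (T' : measurableType d') (Q : probability T' R)
    (Z : {RV Q >-> R}) : Prop :=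
  (forall n, measurable_fun setT (Y n)) /\
  forall x : R, {for x, continuous (cdf Z)} ->
    P n [set w | Y n w <= x] @[n --> \oo] --> cdf Z x.

Definition cvg_in_probability (R : realType) (d : nat -> measure_display)
    (T : forall n, measurableType (d n)) (P : forall n, probability (T n) R)
    (Y : forall n, T n -> R) (c : R) : Prop :=
  (forall n, measurable_fun setT (Y n)) /\
  forall e : R, 0 < e ->
    P n [set w | e < `|Y n w - c|] @[n --> \oo] --> 0%E.

Definition angle (R : realType) (p : nat) (x y : p.-tuple R) : R :=
  acos (dotp x y).

(* Angles lie in [0, pi], so the neutral elements pi and 0 do not affect the
   minimum and the maximum as soon as there is a pair i < j, i.e. 2 <= n. *)
Definition angle_min (R : realType) (n p : nat) (x : 'I_n -> p.-tuple R) : R :=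
  \big[Num.min/pi]_(ij : 'I_n * 'I_n | (ij.1 < ij.2)%N)
    angle (x ij.1) (x ij.2).

Definition angle_max (R : realType) (n p : nat) (x : 'I_n -> p.-tuple R) : R :=
  \big[Num.max/0]_(ij : 'I_n * 'I_n | (ij.1 < ij.2)%N)
    angle (x ij.1) (x ij.2).

Definition tn (R : realType) (p : nat -> nat) (n : nat) : R :=
  expR (- (2 * ln n%:R / ((p n)%:R - 1))).

Definition alphan (R : realType) (p : nat -> nat) (n : nat) : R :=
  tn R p n / (2 * ((p n)%:R - 1) * Num.sqrt (1 - tn R p n ^+ 2)).

Definition limit_cdf (R : realType) (x : R) : R :=
  1 - expR (- ((2 * Num.sqrt (2 * pi))^-1 * expR (x / 2))).

(* Main.v *)
(** The coordinate [U] of a uniform point of the sphere satisfies, by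
    invariance under reflections in a plane, the Stein identity
    [(p - 1) E[U phi(U)] = E[(1 - U^2) phi'(U)]].  Taking [phi(u) = (u - c)_+^2]
    and differentiating twice in [c] yields a linear differential equation for
    [H(c) = E[U; U >= c]], whence [H(c) = H(0) (1 - c^2)^((p-1)/2)] and
    [P(U >= c) ~ H(c) / c] when [p c^2] is large; moments give
    [H(0) ~ 1 / sqrt p] up to constants.

    The events [X_i . X_j \in A] are pairwise independent and those indexed by
    disjoint pairs are independent of each other, so adding the pairs one at a
    time shows that the probability that none of them occurs is
    [(1 - q)^(n (n - 1) / 2)] up to [O(n^3 q^2)].  With
    [A = [c, 1] \cup [-1, -c']] this gives the joint limit law of the rescaled
    minimal and maximal angles, with independent coordinates.

    The centering [asin t_n + 2 alpha_n ln kappa_n] of the minimal angle and of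
    [pi] minus the maximal one is the same and cancels in the sum. *)
Require Import Defs.
From HB Require Import structures.
From mathcomp Require Import all_boot all_order all_algebra.
From mathcomp Require Import all_classical all_reals.
From mathcomp Require Import ereal topology normedtype sequences exp trigo measure.
From mathcomp Require Import measurable_realfun lebesgue_measure random_variable.
From mathcomp Require Import numfun realfun derive lebesgue_integral.
From mathcomp Require Import ring lra zify.
Import Order.TTheory GRing.Theory Num.Theory.
Import numFieldNormedType.Exports.
Local Open Scope classical_set_scope.
Local Open Scope ring_scope.

Set Implicit Arguments.
Unset Strict Implicit.
Unset Printing Implicit Defensive.

(** Uniformity is known only through invariance, so the law of a coordinate comes without a density,
    and derivatives appear as finite differences with explicit remainders. This dictates the test
    function: a squared positive part has a Lipschitz derivative. No rate ties [p] to [ln n], so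
    [t_n] may tend to 0, to 1, or oscillate in between. All regimes are treated at once through
    [r_n = (p - 1) (1 - t_n ^ 2)], which always tends to infinity and controls the error terms.
    Rough bounds on [H(0)] suffice because [kappa_n] contains the factor [1 / H(0)]: they make
    [kappa_n] of order [sqrt r_n], and the errors only see [ln kappa_n = o(sqrt r_n)]. The constant
    [1 / (2 sqrt (2 pi))] is then a normalization: a common shift of [Z_1] and [Z_2] leaves
    [Z_2 - Z_1] unchanged, so [kappa_n] may carry whatever factor makes each limit law equal to [D].
    The expected number of exceptional pairs stays bounded, so [q] is of order [n ^ -2] and the
    dependence error of order [1 / n]. *)

Definition sph (R : realType) (p : nat) : set (p.-tuple R) :=
  [set x | enorm x = 1].
Arguments sph {R p}.

(** * Dot products, orthogonal maps and reflections on the sphere *)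

Section sphere.
Context {R : realType} {p : nat}.
Implicit Types x y v : p.-tuple R.

Lemma dotpC x y : dotp x y = dotp y x.
Proof. by apply: eq_bigr => i _; rewrite mulrC. Qed.

Lemma dotp_ge0 x : 0 <= dotp x x.
Proof. by apply: sumr_ge0 => i _; rewrite -expr2 sqr_ge0. Qed.

Lemma sphP x : sph x <-> dotp x x = 1.
Proof.
rewrite /sph /= /enorm; split=> [h|->]; last by rewrite sqrtr1.
by rewrite -[dotp x x]sqr_sqrtr ?dotp_ge0// h expr1n.
Qed.

Lemma sph_coord_le1 x i : sph x -> `|tnth x i| <= 1.
Proof.
move=> /sphP h; rewrite -(@expr_le1 _ 2)// -h /dotp (bigD1 i)//=.
rewrite real_normK ?num_real// expr2 lerDl sumr_ge0// => j _.
by rewrite -expr2 sqr_ge0.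
Qed.

Lemma dotp_sph_le1 x y : sph x -> sph y -> -1 <= dotp x y <= 1.
Proof.
move=> /sphP hx /sphP hy.
have hp : 0 <= \sum_(k < p) (tnth x k + tnth y k) ^+ 2.
  by apply: sumr_ge0 => k _; apply: sqr_ge0.
have hm : 0 <= \sum_(k < p) (tnth x k - tnth y k) ^+ 2.
  by apply: sumr_ge0 => k _; apply: sqr_ge0.
have ep : \sum_(k < p) (tnth x k + tnth y k) ^+ 2 =
    dotp x x + 2 * dotp x y + dotp y y.
  rewrite /dotp mulr_sumr -!big_split/=; apply: eq_bigr => k _; ring.
have em : \sum_(k < p) (tnth x k - tnth y k) ^+ 2 =
    dotp x x - 2 * dotp x y + dotp y y.
  rewrite /dotp mulr_sumr -sumrN -!big_split/=; apply: eq_bigr => k _; ring.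
by apply/andP; split; lra.
Qed.

Lemma measurable_coord (i : 'I_p) :
  measurable_fun setT (fun x => tnth x i).
Proof. exact: measurable_tnth. Qed.

Lemma measurable_dotp d (T : measurableType d) (f g : T -> p.-tuple R) :
  measurable_fun setT f -> measurable_fun setT g ->
  measurable_fun setT (fun t => dotp (f t) (g t)).
Proof.
move=> mf mg; apply: measurable_sum => i.
by apply: measurable_funM; exact: (measurableT_comp (measurable_coord i)).
Qed.

Lemma measurable_sph : measurable (@sph R p).
Proof.
have -> : @sph R p = (fun x => dotp x x) @^-1` [set 1].
  by apply/seteqP; split => x /= /sphP.
rewrite -[X in measurable X]setTI; apply: measurable_dotp => //.
Qed.

Lemma mxact_dotp (A : 'M[R]_p) x y : A *m A^T = 1%:M ->
  dotp (mxact A x) (mxact A y) = dotp x y.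
Proof.
move=> /mulmx1C AA.
pose c (z : p.-tuple R) := \col_(k < p) tnth z k.
have cd (a b : p.-tuple R) : dotp a b = ((c a)^T *m c b) 0 0.
  by rewrite mxE; apply: eq_bigr => k _; rewrite !mxE.
have cA (z : p.-tuple R) : c (mxact A z) = A *m c z.
  apply/colP => i; rewrite !mxE tnth_mktuple.
  by apply: eq_bigr => k _; rewrite mxE.
by rewrite !cd !cA trmx_mul mulmxA -(mulmxA _ _ A) AA mulmx1.
Qed.

Lemma mxact_sph (A : 'M[R]_p) : A *m A^T = 1%:M ->
  mxact A @^-1` (@sph R p) = sph.
Proof.
by move=> AA; apply/seteqP; split => x /= /sphP; rewrite ?mxact_dotp// => h;
  apply/sphP; rewrite ?mxact_dotp.
Qed.

Lemma measurable_mxact (A : 'M[R]_p) :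
  measurable_fun setT (mxact A).
Proof.
apply/measurable_fun_tnthP => i; rewrite /comp /mxact.
under eq_fun do rewrite tnth_mktuple.
by apply: measurable_sum => k; apply: measurable_funM => //; exact: measurable_coord.
Qed.

(* Householder reflection: [x |-> x - 2 (v.x / v.v) v]. *)
Definition householder v : 'M[R]_p :=
  \matrix_(i, j) ((i == j)%:R - 2 * (tnth v i * tnth v j) / dotp v v).

Lemma mxact_householder v x i :
  tnth (mxact (householder v) x) i =
  tnth x i - 2 * (dotp v x / dotp v v) * tnth v i.
Proof.
rewrite tnth_mktuple.
under eq_bigr do rewrite mxE mulrBl.
rewrite sumrB; congr (_ - _).
  rewrite (bigD1 i)//= eqxx mul1r big1 ?addr0// => k ki.
  by rewrite eq_sym (negbTE ki) mul0r.
rewrite {2}/dotp !(mulr_suml, mulr_sumr); apply: eq_bigr => k _; ring.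
Qed.

Lemma householder_orth v : dotp v v != 0 ->
  householder v *m (householder v)^T = 1%:M.
Proof.
move=> v0; apply/matrixP => i j; rewrite !mxE.
pose a := 2 / dotp v v.
under eq_bigr => k _ do rewrite !mxE.
transitivity (\sum_(k < p) ((i == k)%:R * (j == k)%:R
  - a * tnth v i * (tnth v k * (j == k)%:R) - a * tnth v j * (tnth v k * (i == k)%:R)
  + a ^+ 2 * (tnth v i * tnth v j) * (tnth v k * tnth v k))).
  by apply: eq_bigr => k _; rewrite /a; ring.
have S (f : 'I_p -> R) l : \sum_(k < p) f k * (l == k)%:R = f l.
  rewrite (bigD1 l)//= eqxx mulr1 big1 ?addr0// => k kl.
  by rewrite eq_sym (negbTE kl) mulr0.
rewrite !big_split/= !sumrN -!mulr_sumr !S -/(dotp v v) eq_sym /a.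
by field.
Qed.

End sphere.

(** * Averages over the sphere and their invariance *)

Section expectation.
Context {R : realType} {p : nat} (mu : probability (p.-tuple R) R).
Hypothesis mu_unif : uniform_on_sphere mu.
Implicit Types (x y v : p.-tuple R) (f g : p.-tuple R -> R).

(** Integrating over [sph] instead of the whole space makes functions that are bounded only on the
    sphere integrable; no mass is lost, as [mu] is carried by the sphere. *)
Definition savg f : R := \int[mu]_(y in sph) f y.

(** A class closed under the operations that build the test functions below, so that their
    integrability becomes a syntactic check. *)
Definition good f := measurable_fun setT f /\
  exists M, forall y, sph y -> `|f y| <= M.

Lemma goodW f : good f -> mu.-integrable sph (EFin \o f).
Proof.
move=> [mf [M fM]]; apply: measurable_bounded_integrable.
- exact: measurable_sph.
- by rewrite (le_lt_trans (probability_le1 _ _)) ?ltry//; exact: measurable_sph.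
- exact: measurable_funS mf.
- exists M; split; first exact: num_real.
  by move=> N MN y /= /fM /le_trans; apply; exact: ltW.
Qed.

Lemma good_cst r : good (fun=> r).
Proof. by split=> //; exists `|r|. Qed.

Lemma good_coord i : good (fun y => tnth y i).
Proof.
by split; [exact: measurable_coord|exists 1 => y; exact: sph_coord_le1].
Qed.

Lemma goodD f g : good f -> good g -> good (fun y => f y + g y).
Proof.
move=> [mf [M fM]] [mg [N gN]]; split; first exact: measurable_funD.
exists (M + N) => y Sy; apply: le_trans (ler_normD _ _) _.
by apply: lerD; [exact: fM|exact: gN].
Qed.

Lemma goodM f g : good f -> good g -> good (fun y => f y * g y).
Proof.
move=> [mf [M fM]] [mg [N gN]]; split; first exact: measurable_funM.
exists (M * N) => y Sy; rewrite normrM.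
by apply: ler_pM => //; [exact: fM|exact: gN].
Qed.

Lemma goodN f : good f -> good (fun y => - f y).
Proof.
move=> [mf [M fM]]; split; first exact: measurable_funN.
by exists M => y Sy; rewrite normrN; exact: fM.
Qed.

Lemma goodB f g : good f -> good g -> good (fun y => f y - g y).
Proof. by move=> gf gg; apply: goodD => //; exact: goodN. Qed.

Lemma goodX f n : good f -> good (fun y => f y ^+ n).
Proof.
move=> [mf [M fM]]; split; first exact: measurable_funX.
by exists (M ^+ n) => y Sy; rewrite normrX; apply: lerXn2r => //;
  rewrite ?nnegrE ?fM//; apply: le_trans (fM _ Sy).
Qed.

Lemma good_max f g : good f -> good g -> good (fun y => Num.max (f y) (g y)).
Proof.
move=> [mf [M fM]] [mg [N gN]]; split; first exact: measurable_maxr.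
exists (M + N) => y Sy; have fMy := fM _ Sy; have gNy := gN _ Sy.
have M0 : 0 <= M by exact: le_trans fMy.
have N0 : 0 <= N by exact: le_trans gNy.
by rewrite maxEle; case: ifP => _; [apply: le_trans gNy _|apply: le_trans fMy _]; lra.
Qed.

Lemma good_norm f : good f -> good (fun y => `|f y|).
Proof.
move=> [mf [M fM]]; split; first exact: measurableT_comp.
by exists M => y Sy; rewrite normr_id; exact: fM.
Qed.

Lemma good_ge c i : good (fun y => (c <= tnth y i)%R%:R).
Proof.
split; last by exists 1 => y _; case: (c <= _); rewrite ?normr1 ?normr0.
rewrite (_ : (fun _ => _) = \1_((fun y : p.-tuple R => tnth y i) @^-1` `[c, +oo[)).
  apply/measurable_indicP; rewrite -[X in measurable X]setTI.
  by apply: measurable_coord => //; exact: measurable_itv.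
apply/funext => y; rewrite indicE; congr ((nat_of_bool _)%:R).
by apply/idP/idP; rewrite in_setE /= in_itv /= andbT.
Qed.

Hint Resolve good_cst good_coord goodD goodM goodN goodB goodX good_max good_ge
  good_norm : core.

Lemma eq_savg f g : (forall y, sph y -> f y = g y) -> savg f = savg g.
Proof. by move=> fg; apply: eq_Rintegral => y /set_mem; exact: fg. Qed.

Lemma savgD f g : good f -> good g -> savg (fun y => f y + g y) = savg f + savg g.
Proof. by move=> gf gg; apply: RintegralD; [exact: measurable_sph|exact: goodW..]. Qed.

Lemma savgB f g : good f -> good g -> savg (fun y => f y - g y) = savg f - savg g.
Proof. by move=> gf gg; apply: RintegralB; [exact: measurable_sph|exact: goodW..]. Qed.

Lemma savgZ r f : good f -> savg (fun y => r * f y) = r * savg f.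
Proof. by move=> gf; apply: RintegralZl; [exact: measurable_sph|exact: goodW]. Qed.

Lemma savg_cst r : savg (fun=> r) = r.
Proof.
rewrite /savg Rintegral_cst; last exact: measurable_sph.
by have [h _] := mu_unif; rewrite [X in _ * X](congr1 fine h) mulr1.
Qed.

Lemma savg_le f g : good f -> good g -> (forall y, sph y -> f y <= g y) ->
  savg f <= savg g.
Proof. by move=> gf gg; apply: le_Rintegral; [exact: measurable_sph|exact: goodW..]. Qed.

Lemma savg_ge0 f : good f -> (forall y, sph y -> 0 <= f y) -> 0 <= savg f.
Proof. by move=> gf f0; apply: Rintegral_ge0. Qed.

Lemma good_sum (I : Type) (r : seq I) (P : pred I) (F : I -> p.-tuple R -> R) :
  (forall i, good (F i)) -> good (fun y => \sum_(i <- r | P i) F i y).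
Proof.
move=> gF; elim: r => [|i r ih].
  by under eq_fun do rewrite big_nil.
under eq_fun do rewrite big_cons.
by case: (P i) => //; exact: goodD.
Qed.

Lemma savg_sum (I : Type) (r : seq I) (P : pred I) (F : I -> p.-tuple R -> R) :
  (forall i, good (F i)) ->
  savg (fun y => \sum_(i <- r | P i) F i y) = \sum_(i <- r | P i) savg (F i).
Proof.
move=> gF; elim: r => [|i r ih].
  by under eq_fun do rewrite big_nil; rewrite savg_cst big_nil.
under eq_fun do rewrite big_cons; rewrite big_cons.
by case: (P i) => //; rewrite savgD ?ih//; exact: good_sum.
Qed.

Lemma good_mxact (A : 'M[R]_p) f : A *m A^T = 1%:M -> good f ->
  good (fun y => f (mxact A y)).
Proof.
move=> AA [mf [M fM]]; split.
  by apply: measurableT_comp => //; exact: measurable_mxact.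
by exists M => y Sy; apply: fM; move: Sy; rewrite -[in X in X -> _](mxact_sph AA).
Qed.

Lemma savg_mxact (A : 'M[R]_p) f : A *m A^T = 1%:M -> good f ->
  savg (fun y => f (mxact A y)) = savg f.
Proof.
move=> AA gf; rewrite /savg /Rintegral; congr fine.
have mA : measurable_fun setT (mxact A) := measurable_mxact A.
rewrite -[in LHS](mxact_sph AA).
rewrite -(@integral_pushforward _ _ _ _ _ (mxact A) mA mu sph (EFin \o f)).
- by apply: eq_measure_integral => B mB _; have [_ /(_ A AA B mB)] := mu_unif.
- by apply/measurable_EFinP; apply: measurable_funS (gf.1) => //; exact: measurable_sph.
- rewrite mxact_sph//; exact: (goodW (good_mxact AA gf)).
- exact: measurable_sph.
Qed.

Definition etup (i : 'I_p) (a b : R) (j : 'I_p) : p.-tuple R :=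
  [tuple (if k == i then a else if k == j then b else 0) | k < p].

Lemma dotp_etup i j a b y : i != j ->
  dotp (etup i a b j) y = a * tnth y i + b * tnth y j.
Proof.
move=> ij; rewrite /dotp (bigD1 i)//= (bigD1 j) 1?eq_sym//= big1 ?addr0.
  by rewrite !tnth_mktuple eqxx eq_sym (negbTE ij) eqxx.
by move=> k /andP[/negbTE ki /negbTE kj]; rewrite tnth_mktuple ki kj mul0r.
Qed.

(** The map [(u, v) |-> (a u + b v, b u - a v)] is a reflection, so one Householder matrix realizes
    it; up to the sign of the second coordinate it is a rotation. *)
Lemma savg_plane (i j : 'I_p) (g : R -> R -> R) a b : i != j ->
  a ^+ 2 + b ^+ 2 = 1 -> good (fun y => g (tnth y i) (tnth y j)) ->
  savg (fun y => g (a * tnth y i + b * tnth y j) (b * tnth y i - a * tnth y j)) =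
  savg (fun y => g (tnth y i) (tnth y j)).
Proof.
move=> ij ab gg.
have ji : (j == i) = false by rewrite eq_sym; exact: negbTE.
(* The reflection vector is [e_i - (a e_i + b e_j)]. It vanishes when [a = 1]; then [b = 0], the map
   only flips coordinate [j], and [e_j] serves instead. *)
pose v := if a == 1 then etup i 0 1 j else etup i (1 - a) (- b) j.
have vv : dotp v v = if a == 1 then 1 else 2 * (1 - a).
  rewrite /v; case: ifP => [|_]; rewrite dotp_etup// !tnth_mktuple !eqxx ji.
    by move=> _; ring.
  by transitivity (1 - 2 * a + (a ^+ 2 + b ^+ 2)); [ring|rewrite ab; ring].
have vv0 : dotp v v != 0.
  rewrite vv; case: ifPn => [_|a1]; first exact: oner_neq0.
  by rewrite mulf_neq0// subr_eq0 eq_sym.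
rewrite -(savg_mxact (householder_orth vv0) gg); apply: eq_savg => y _.
rewrite !mxact_householder vv /v; case: ifPn => [/eqP a1|a1].
  have b0 : b = 0.
    by apply/eqP; rewrite -sqrf_eq0; apply/eqP; move: ab; rewrite a1; lra.
  rewrite dotp_etup// !tnth_mktuple !eqxx ji a1 b0.
  by congr (g _ _); field.
rewrite dotp_etup// !tnth_mktuple !eqxx ji.
have a1' : 1 - a != 0 by rewrite subr_eq0 eq_sym.
congr (g _ _); first by field.
transitivity (b * tnth y i + tnth y j - b ^+ 2 * tnth y j / (1 - a)); last by field.
have -> : b ^+ 2 = (1 - a) * (1 + a) by have -> : b ^+ 2 = 1 - a ^+ 2 by [lra]; ring.
by field.
Qed.

(** The reflection along [x - e_i] exchanges [x] and the basis vector [e_i], so the law of [x . y]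
    is that of [e_i . y]. If [x - e_i] vanishes, the two functions of [y] coincide. *)
Lemma unif_dotp (i : 'I_p) x (B : set R) : sph x -> measurable B ->
  mu [set y | B (dotp x y)] = mu [set y | B (tnth y i)].
Proof.
move=> /sphP xx mB; pose e := [tuple (k == i)%:R | k < p] : p.-tuple R.
pose v : p.-tuple R := [tuple tnth x k - tnth e k | k < p].
have de z : dotp e z = tnth z i.
  rewrite /dotp (bigD1 i)//= tnth_mktuple eqxx mul1r big1 ?addr0// => k /negbTE ki.
  by rewrite tnth_mktuple ki mul0r.
have dv z : dotp v z = dotp x z - tnth z i.
  by rewrite -de -sumrB; apply: eq_bigr => k _; rewrite tnth_mktuple mulrBl.
have ei : tnth e i = 1 by rewrite tnth_mktuple eqxx.
have dvv : dotp v v = 2 * (1 - tnth x i).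
  by rewrite dv tnth_mktuple ei dotpC dv xx; ring.
have [vv0|vv0] := eqVneq (dotp v v) 0; last first.
  have [_ /(_ _ (householder_orth vv0) [set y | B (tnth y i)])] := mu_unif.
  have mBi : measurable [set y : p.-tuple R | B (tnth y i)].
    by rewrite -[X in measurable X]setTI; exact: measurable_coord.
  move=> /(_ mBi) <-; congr (mu _); apply/seteqP.
  have E y : tnth (mxact (householder v) y) i = dotp x y.
    rewrite mxact_householder [tnth v i]tnth_mktuple ei dv dvv.
    have : 1 - tnth x i != 0 by apply: contra_neq vv0; rewrite dvv => ->; rewrite mulr0.
    by move=> ?; field.
  by split => y /=; rewrite E.
have v0 k : tnth v k = 0.
  apply/eqP; rewrite -sqrf_eq0 expr2.
  move: vv0 => /eqP; rewrite psumr_eq0 => [/allP/(_ k)|l _]; first by apply; rewrite mem_index_enum.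
  by rewrite -expr2 sqr_ge0.
congr (mu _); apply/seteqP.
have E y : tnth y i = dotp x y.
  apply/eqP; rewrite eq_sym -subr_eq0 -dv; apply/eqP/big1 => k _.
  by rewrite v0 mul0r.
by split => y /=; rewrite E.
Qed.

End expectation.

(** * Estimates for the positive part *)

Section positive_part.
Context {R : realType}.
Implicit Types x t c : R.

Definition pos x := Num.max x 0.

Lemma pos_le0 x : x <= 0 -> pos x = 0. Proof. exact: max_r. Qed.

Lemma pos_id x : 0 <= x -> pos x = x. Proof. exact: max_l. Qed.

(** The derivative [2 * pos] of [pos ^+ 2] is 2-Lipschitz, so the remainder is quadratic even across
    the kink. *)
Lemma pos_sqr_taylor x t :
  `|pos (x + t) ^+ 2 - pos x ^+ 2 - 2 * t * pos x| <= t ^+ 2.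
Proof.
by rewrite ler_norml /pos; case: (leP (x + t) 0) => ?; case: (leP x 0) => ?;
  apply/andP; split; nra.
Qed.

Lemma pos_lipschitz x t : `|pos x - pos t| <= `|x - t|.
Proof.
by rewrite /pos; case: (leP x 0) => ?; case: (leP t 0) => ?;
  rewrite ler_norml; case: (ler0P (x - t)) => ?; apply/andP; split; lra.
Qed.

Lemma pos_diff u c t : 0 <= t ->
  t * (c + t <= u)%R%:R <= pos (u - c) - pos (u - (c + t)) <= t * (c <= u)%R%:R.
Proof.
move=> t0; rewrite /pos; case: (leP (c + t) u) => ?; case: (leP c u) => ? /=;
  case: (leP (u - c) 0) => ?; case: (leP (u - (c + t)) 0) => ?;
  apply/andP; split; rewrite /= ?mulr1n ?mulr0n; lra.
Qed.

(** The passage to the limit [t -> 0] in the form used for identities between expectations: an error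
    linear in [t] forces equality. *)
Lemma lin_bound_eq (x y k : R) :
  (forall t, 0 < t <= 1 -> `|x - y| <= k * t) -> x = y.
Proof.
move=> h; apply/eqP; rewrite -subr_eq0 -normr_le0; apply/ler_addgt0Pl => e e0.
rewrite addr0.
pose K := `|k| + 1; have K0 : 0 < K by rewrite ltr_wpDl.
pose t := Num.min 1 (e / K).
have t0 : 0 < t <= 1 by rewrite /t lt_min ltr01 divr_gt0//= ge_min lexx.
apply: le_trans (h _ t0) _; apply: (@le_trans _ _ (K * t)).
  by rewrite ler_wpM2r//; [case/andP: t0 => /ltW|rewrite /K; have := ler_norm k; lra].
by rewrite -ler_pdivlMl// mulrC /t ge_min lexx orbT.
Qed.

End positive_part.

Ltac solve_good := solve [repeat first
  [ assumption | exact: good_cst | exact: good_coord | exact: good_ge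
  | apply: goodX | apply: goodN | apply: goodB | apply: goodD | apply: goodM
  | apply: good_max | apply: good_norm ]].

(** * Stein identity and truncated moments of a coordinate *)

Section tail.
Context {R : realType} {p : nat} (mu : probability (p.-tuple R) R).
Hypothesis mu_unif : uniform_on_sphere mu.
Hypothesis p_ge2 : (2 <= p)%N.
Variable i : 'I_p.
Implicit Types (y : p.-tuple R) (f g : p.-tuple R -> R).
Local Notation E := (savg mu).

Definition tailE (c : R) := E (fun y => tnth y i * (c <= tnth y i)%R%:R).

Lemma savg_odd j (phi : R -> R) : i != j -> good (fun y => phi (tnth y i)) ->
  E (fun y => tnth y j * phi (tnth y i)) = 0.
Proof.
move=> ij gphi.
have ab : 1 ^+ 2 + 0 ^+ 2 = 1 :> R by ring.
have gg : good (fun y => tnth y j * phi (tnth y i)) by solve_good.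
have := savg_plane mu_unif (g := fun u v => v * phi u) ij ab gg.
rewrite (_ : savg mu _ = E (fun y => -1 * (tnth y j * phi (tnth y i)))).
  by rewrite savgZ//; lra.
by apply: eq_savg => y _; rewrite !mul0r !mul1r addr0; ring.
Qed.

(** Under the reflection of [savg_plane] the argument of [phi] becomes [y_i] and the factor [y_j]
    becomes [b y_i - a y_j], whose second term averages to zero by oddness. *)
Lemma savg_rot j (phi : R -> R) a b : i != j -> a ^+ 2 + b ^+ 2 = 1 ->
  good (fun y => phi (tnth y i)) ->
  E (fun y => tnth y j * phi (a * tnth y i + b * tnth y j)) =
  b * E (fun y => tnth y i * phi (tnth y i)).
Proof.
move=> ij ab gphi.
have gg : good (fun y => (b * tnth y i - a * tnth y j) * phi (tnth y i)) by solve_good.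
have := savg_plane mu_unif (g := fun u v => (b * u - a * v) * phi u) ij ab gg.
rewrite /= (_ : savg mu _ = E (fun y => tnth y j * phi (a * tnth y i + b * tnth y j))).
  move=> ->.
  have g1 : good (fun y => tnth y i * phi (tnth y i)) by solve_good.
  have g2 : good (fun y => tnth y j * phi (tnth y i)) by solve_good.
  transitivity (E (fun y => b * (tnth y i * phi (tnth y i))
      - a * (tnth y j * phi (tnth y i)))); first by apply: eq_savg => y _; ring.
  by rewrite savgB ?savgZ ?(savg_odd ij gphi)//; [ring|solve_good..].
apply: eq_savg => y _; congr (_ * _).
by transitivity ((a ^+ 2 + b ^+ 2) * tnth y j); [ring|rewrite ab mul1r].
Qed.

(** This is [savg_rot] differentiated at [b = 0] along [a = sqrt (1 - b ^ 2)]. As [y_j s(a y_i)] has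
    mean zero, it can be subtracted, and the quotient by [b] tends to the mean of [y_j ^ 2 s'(y_i)],
    with [s' = 2 pos]. *)
Lemma stein_coord j c : i != j ->
  E (fun y => tnth y i * pos (tnth y i - c) ^+ 2) =
  2 * E (fun y => tnth y j ^+ 2 * pos (tnth y i - c)).
Proof.
move=> ij; apply: (@lin_bound_eq _ _ _ 3) => b /andP[b0 b1].
pose a := Num.sqrt (1 - b ^+ 2).
have b21 : b ^+ 2 <= 1 by nra.
have a0 : 0 <= a by exact: sqrtr_ge0.
have a2 : a ^+ 2 = 1 - b ^+ 2 by rewrite sqr_sqrtr//; lra.
have ab : a ^+ 2 + b ^+ 2 = 1 by lra.
have a1 : 1 - b <= a <= 1 by apply/andP; split; nra.
pose s u := pos (u - c) ^+ 2.
have gs : good (fun y => s (tnth y i)) by solve_good.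
have gsa : good (fun y => s (a * tnth y i)) by solve_good.
have gsab : good (fun y => s (a * tnth y i + b * tnth y j)) by solve_good.
have h1 := savg_rot ij ab gs.
have h2 := @savg_odd j (fun u => s (a * u)) ij gsa.
have h3 : E (fun y => tnth y j * s (a * tnth y i + b * tnth y j)
     - tnth y j * s (a * tnth y i) - 2 * b * (tnth y j ^+ 2 * pos (tnth y i - c)))
   = b * (E (fun y => tnth y i * s (tnth y i))
     - 2 * E (fun y => tnth y j ^+ 2 * pos (tnth y i - c))).
  rewrite !savgB ?h1 ?h2 ?savgZ; [ring|try (solve_good)..].
rewrite -(ler_pM2l b0) -{1}(gtr0_norm b0) -normrM -h3.
have G : good (fun y : p.-tuple R => tnth y j * s (a * tnth y i + b * tnth y j)
     - tnth y j * s (a * tnth y i) - 2 * b * (tnth y j ^+ 2 * pos (tnth y i - c))).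
  solve_good.
(* Origin of the constant 3: the Taylor remainder contributes [b ^+ 2], and replacing [a * y_i] by
   [y_i] inside [pos] contributes [2 * b ^+ 2], because [1 - a <= b]. *)
have K y : sph y -> `|tnth y j * s (a * tnth y i + b * tnth y j)
     - tnth y j * s (a * tnth y i) - 2 * b * (tnth y j ^+ 2 * pos (tnth y i - c))|
    <= b * (3 * b).
  move=> Sy; have yj := sph_coord_le1 j Sy; have yi := sph_coord_le1 i Sy.
  set yi' := tnth y i in yi *; set yj' := tnth y j in yj *.
  have T := pos_sqr_taylor (a * yi' - c) (b * yj').
  have L := pos_lipschitz (a * yi' - c) (yi' - c).
  have L' : `|pos (a * yi' - c) - pos (yi' - c)| <= b.
    apply: le_trans L _; have -> : a * yi' - c - (yi' - c) = - ((1 - a) * yi') by ring.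
    rewrite normrN normrM ger0_norm; last by lra.
    by have := normr_ge0 yi'; nra.
  have -> : yj' * s (a * yi' + b * yj') - yj' * s (a * yi') -
      2 * b * (yj' ^+ 2 * pos (yi' - c)) =
    yj' * (pos (a * yi' - c + b * yj') ^+ 2 - pos (a * yi' - c) ^+ 2 -
      2 * (b * yj') * pos (a * yi' - c)) +
    2 * b * yj' ^+ 2 * (pos (a * yi' - c) - pos (yi' - c)).
    by rewrite /s (addrAC (a * yi') (b * yj')); ring.
  have y2 : yj' ^+ 2 <= 1 by rewrite -real_normK ?num_real// expr_le1.
  have y20 : 0 <= yj' ^+ 2 by exact: sqr_ge0.
  apply: le_trans (ler_normD _ _) _.
  have -> : b * (3 * b) = b ^+ 2 + 2 * b ^+ 2 by ring.
  apply: lerD.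
    rewrite normrM -[leRHS]mul1r; apply: ler_pM => //.
    by apply: le_trans T _; rewrite exprMn ler_piMr ?sqr_ge0.
  have b20 : 0 <= 2 * b by lra.
  have -> : 2 * b ^+ 2 = 2 * b * b by ring.
  rewrite normrM (ger0_norm (mulr_ge0 b20 y20)).
  by apply: ler_pM => //; [exact: mulr_ge0|rewrite ler_piMr].
rewrite ler_norml; apply/andP; split.
  rewrite -[leLHS](savg_cst mu_unif); apply: savg_le => [||y /K]; [solve_good|solve_good|].
  by rewrite ler_norml => /andP[].
rewrite -[leRHS](savg_cst mu_unif); apply: savg_le => [||y /K]; [solve_good|solve_good|].
by rewrite ler_norml => /andP[].
Qed.

Let sumsq y : sph y -> \sum_(j < p | j != i) tnth y j ^+ 2 = 1 - tnth y i ^+ 2.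
Proof.
move=> /sphP; rewrite /dotp (bigD1 i)//= -expr2 => h.
by under eq_bigr do rewrite expr2; lra.
Qed.

Lemma card_neq : \sum_(j < p | j != i) (1 : R) = p%:R - 1.
Proof.
have := @sumr_const R _ (pred_of_simpl (@predT 'I_p)) 1.
rewrite (bigD1 i)//= => h; apply: (addrI 1); rewrite h; rewrite cardT size_enum_ord; ring.
Qed.

(** Summing over the [p - 1] coordinates other than [i] brings in the dimension; the sphere equation
    turns the sum of their squares into [1 - y_i ^ 2]. *)
Lemma savg_others (phi : R -> R) (k : R) : good (fun y => phi (tnth y i)) ->
  (forall j, i != j -> E (fun y => tnth y j ^+ 2 * phi (tnth y i)) = k) ->
  E (fun y => (1 - tnth y i ^+ 2) * phi (tnth y i)) = (p%:R - 1) * k.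
Proof.
move=> gphi h.
rewrite (@eq_savg _ _ _ _ (fun y => \sum_(j < p | j != i) tnth y j ^+ 2 * phi (tnth y i))).
  rewrite savg_sum//; last by move=> ?; solve_good.
  rewrite -card_neq mulr_suml; apply: eq_bigr => j ji; rewrite mul1r h//.
  by rewrite eq_sym.
by move=> y Sy; rewrite -mulr_suml sumsq.
Qed.

(* The stationary (Stein) identity of the law of a coordinate, for the
   test function [pos (u - c) ^+ 2]. *)
Lemma stein c :
  (p%:R - 1) * E (fun y => tnth y i * pos (tnth y i - c) ^+ 2) =
  2 * E (fun y => (1 - tnth y i ^+ 2) * pos (tnth y i - c)).
Proof.
rewrite (@savg_others (fun u => pos (u - c))
  (E (fun y => tnth y i * pos (tnth y i - c) ^+ 2) / 2)); first by field.
  solve_good.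
by move=> j ij; rewrite (stein_coord c ij); field.
Qed.

(** As functions of [c], formally [D' = - J], [B' = - 2 W] and [W' = - tailE]. Thus [stein], which
    reads [(p - 1) B = 2 D], differentiates to [J = (p - 1) W], and once more to an equation for
    [tailE]. *)
Local Notation J c := (E (fun y => (1 - tnth y i ^+ 2) * (c <= tnth y i)%R%:R)).
Local Notation W c := (E (fun y => tnth y i * pos (tnth y i - c))).
Local Notation D c := (E (fun y => (1 - tnth y i ^+ 2) * pos (tnth y i - c))).
Local Notation B c := (E (fun y => tnth y i * pos (tnth y i - c) ^+ 2)).

Let sqr_le1 y : sph y -> 0 <= tnth y i ^+ 2 <= 1.
Proof.
by move=> /(sph_coord_le1 i) h; rewrite sqr_ge0 -real_normK ?num_real// expr_le1.
Qed.

Let p1_gt0 : 0 < p%:R - 1 :> R.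
Proof. by rewrite subr_gt0 ltr1n. Qed.

Let D_diff c t : 0 <= t -> t * J (c + t) <= D c - D (c + t) <= t * J c.
Proof.
move=> t0; have gJ k : good (fun y => (1 - tnth y i ^+ 2) * (k <= tnth y i)%R%:R) by solve_good.
rewrite -!savgZ// -savgB; [|solve_good..].
by apply/andP; split; apply: savg_le; [solve_good|solve_good| |solve_good|solve_good|];
  move=> y Sy; rewrite -mulrBr mulrCA;
  have /andP[? ?] := pos_diff (tnth y i) c t0; apply: ler_wpM2l => //;
  have := sqr_le1 Sy; lra.
Qed.

Let B_diff c t : `|B c - B (c + t) - 2 * t * W c| <= t ^+ 2.
Proof.
have gW : good (fun y => tnth y i * pos (tnth y i - c)) by solve_good.
rewrite -savgZ// -!savgB; [|solve_good..].
suff K y : sph y -> `|tnth y i * pos (tnth y i - c) ^+ 2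
    - tnth y i * pos (tnth y i - (c + t)) ^+ 2
    - 2 * t * (tnth y i * pos (tnth y i - c))| <= t ^+ 2.
  rewrite ler_norml; apply/andP; split.
    rewrite -[leLHS](savg_cst mu_unif); apply: savg_le => [||y /K]; [solve_good|solve_good|].
    by rewrite ler_norml => /andP[].
  rewrite -[leRHS](savg_cst mu_unif); apply: savg_le => [||y /K]; [solve_good|solve_good|].
  by rewrite ler_norml => /andP[].
move=> Sy; have yi := sph_coord_le1 i Sy.
have T := pos_sqr_taylor (tnth y i - c) (- t).
have -> : tnth y i * pos (tnth y i - c) ^+ 2
    - tnth y i * pos (tnth y i - (c + t)) ^+ 2
    - 2 * t * (tnth y i * pos (tnth y i - c)) =
  - tnth y i * (pos (tnth y i - c - t) ^+ 2 - pos (tnth y i - c) ^+ 2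
     - 2 * (- t) * pos (tnth y i - c)).
  by rewrite opprD addrA; ring.
rewrite normrM normrN -[leRHS]mul1r; apply: ler_pM => //.
by apply: le_trans T _; rewrite sqrrN.
Qed.

Let W_lip c t : `|W c - W (c + t)| <= `|t|.
Proof.
rewrite -savgB; [|solve_good..].
suff K y : sph y -> `|tnth y i * pos (tnth y i - c)
    - tnth y i * pos (tnth y i - (c + t))| <= `|t|.
  rewrite ler_norml; apply/andP; split.
    rewrite -[leLHS](savg_cst mu_unif); apply: savg_le => [||y /K]; [solve_good|solve_good|].
    by rewrite ler_norml => /andP[].
  rewrite -[leRHS](savg_cst mu_unif); apply: savg_le => [||y /K]; [solve_good|solve_good|].
  by rewrite ler_norml => /andP[].
move=> Sy; have yi := sph_coord_le1 i Sy.
rewrite -mulrBr normrM -[leRHS]mul1r; apply: ler_pM => //.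
apply: le_trans (pos_lipschitz _ _) _.
by rewrite (_ : _ - _ - _ = t)//; ring.
Qed.

(* [stein] differentiated in [c]. *)
Lemma stein_tail c : J c = (p%:R - 1) * W c.
Proof.
apply: (@lin_bound_eq _ _ _ (3 * (p%:R - 1))) => t /andP[t0 t1].
(* Since [J] is nonincreasing, [t * J c] lies between the decrements of [D] over [[c, c + t]] and
   over [[c - t, c]]; [stein] converts both into decrements of [B]. *)
have /andP[_ h1] := D_diff c (ltW t0).
have /andP[h2 _] := D_diff (c - t) (ltW t0).
have := B_diff c t; have := B_diff (c - t) t; have := W_lip (c - t) t.
have := stein c; have := stein (c + t); have := stein (c - t).
move: h1 h2; rewrite subrK.
set D0 := D (c - t); set D1 := D c; set D2 := D (c + t).
set B0 := B (c - t); set B1 := B c; set B2 := B (c + t).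
set W0 := W (c - t); set W1 := W c; set J1 := J c; set q := p%:R - 1.
move=> h1 h2 s0 s2 s1; rewrite (gtr0_norm t0) !ler_norml.
move=> /andP[w1 w2] /andP[b1 b2] /andP[b3 b4].
have q0 : 0 < q := p1_gt0.
have e1 : t * J1 <= q * (t * W1 + t ^+ 2 + t ^+ 2 / 2).
  have -> : t * J1 = (t * J1 - (D0 - D1)) + (q * B0 - q * B1) / 2 by rewrite s0 s1; field.
  have : q * (B0 - B1) <= q * (2 * t * W0 + t ^+ 2) by rewrite ler_pM2l//; lra.
  have : q * (t * W0) <= q * (t * W1 + t ^+ 2).
    by rewrite ler_pM2l// expr2 -mulrDr ler_pM2l//; lra.
  lra.
have e2 : q * (t * W1 - t ^+ 2 / 2) <= t * J1.
  have -> : t * J1 = (t * J1 - (D1 - D2)) + (q * B1 - q * B2) / 2 by rewrite s1 s2; field.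
  have : q * (2 * t * W1 - t ^+ 2) <= q * (B1 - B2) by rewrite ler_pM2l//; lra.
  lra.
apply/andP; split; rewrite -(ler_pM2l t0).
  have := mulr_ge0 (ltW q0) (sqr_ge0 t).
  lra.
have := mulr_ge0 (ltW q0) (sqr_ge0 t).
lra.
Qed.

Local Notation H := tailE.

Let good_tail c : good (fun y => tnth y i * (c <= tnth y i)%R%:R).
Proof. solve_good. Qed.

Lemma tailE_ge0 c : 0 <= c -> 0 <= H c.
Proof.
move=> c0; apply: savg_ge0 => // y Sy.
by case: (leP c (tnth y i)) => h; rewrite ?mulr1 ?mulr0//; lra.
Qed.

Lemma tailE_le1 c : H c <= 1.
Proof.
rewrite -[leRHS](savg_cst mu_unif); apply: savg_le; [solve_good|solve_good|].
move=> y /(sph_coord_le1 i); rewrite ler_norml => /andP[_ h].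
by case: (leP c (tnth y i)) => _ /=; lra.
Qed.

(** The first bracket is [W' = - H]. The other two hold pointwise: for [c <= u < c'] the ratio
    [u / (1 - u ^ 2)] lies between its values at [c] and [c']. *)
Let tail_diff c c' : 0 <= c -> c < c' -> c' < 1 ->
  [/\ (c' - c) * H c' <= W c - W c' <= (c' - c) * H c,
      (1 - c' ^+ 2) * (H c - H c') <= c' * (J c - J c') &
      c * (J c - J c') <= (1 - c ^+ 2) * (H c - H c')].
Proof.
move=> c0 cc' c'1.
have gJ k : good (fun y => (1 - tnth y i ^+ 2) * (k <= tnth y i)%R%:R) by solve_good.
split.
- have t0 : 0 <= c' - c by lra.
  rewrite -!savgZ// -savgB; [|solve_good..].
  apply/andP; split; (apply: savg_le; [solve_good|solve_good|]) => y Sy; rewrite -mulrBr mulrCA;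
  have := pos_diff (tnth y i) c t0; rewrite subrKC => /andP[p1 p2].
  + case: (leP c' (tnth y i)) p1 => h p1; first by apply: ler_wpM2l => //; lra.
    rewrite /= mulr0n !mulr0 in p1 *; case: (leP 0 (tnth y i)) => ?; first exact: mulr_ge0.
    by rewrite (pos_le0 (_ : tnth y i - c <= 0)) ?pos_le0; lra.
  + case: (leP c (tnth y i)) p2 => h p2; first by apply: ler_wpM2l => //; lra.
    by rewrite (pos_le0 (_ : tnth y i - c <= 0)) ?pos_le0/=; lra.
- rewrite -!savgB// -!savgZ; [|solve_good..].
  apply: savg_le; [solve_good|solve_good|] => y _.
  case: (leP c (tnth y i)) => h1; case: (leP c' (tnth y i)) => h2 /=; try lra.
  have u0 : 0 <= 1 + tnth y i * c' by rewrite addr_ge0// mulr_ge0//; lra.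
  have v0 : 0 <= c' - tnth y i by lra.
  by have := mulr_ge0 v0 u0; lra.
- rewrite -!savgB// -!savgZ; [|solve_good..].
  apply: savg_le; [solve_good|solve_good|] => y _.
  case: (leP c (tnth y i)) => h1; case: (leP c' (tnth y i)) => h2 /=; try lra.
  have u0 : 0 <= 1 + tnth y i * c by rewrite addr_ge0// mulr_ge0//; lra.
  have v0 : 0 <= tnth y i - c by lra.
  by have := mulr_ge0 v0 u0; lra.
Qed.

(** Replacing the increments of [J] by those of [W] gives the equation
    [H' = - (p - 1) c / (1 - c ^ 2) H] as a bracket, from which continuity and differentiability of
    [H] will follow. *)
Lemma tailE_diff c c' : 0 <= c -> c < c' -> c' < 1 ->
  (p%:R - 1) * (c / (1 - c ^+ 2)) * H c' * (c' - c) <= H c - H c' <=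
  (p%:R - 1) * (c' / (1 - c' ^+ 2)) * H c * (c' - c).
Proof.
move=> c0 cc' c'1; have [/andP[w1 w2] j1 j2] := tail_diff c0 cc' c'1.
rewrite !stein_tail -mulrBr in j1 j2.
have q0 := p1_gt0; set q := p%:R - 1 in q0 j1 j2 *.
have d1 : 0 < 1 - c ^+ 2 by nra.
have d2 : 0 < 1 - c' ^+ 2 by nra.
apply/andP; split.
  rewrite -(ler_pM2l d1); apply: le_trans j2.
  rewrite [leLHS](_ : _ = c * (q * ((c' - c) * H c'))); last by field; exact: lt0r_neq0.
  by apply: ler_wpM2l => //; rewrite ler_pM2l.
rewrite -(ler_pM2l d2); apply: le_trans j1 _.
rewrite [leRHS](_ : _ = c' * (q * ((c' - c) * H c))); last by field; exact: lt0r_neq0.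
by apply: ler_wpM2l; [lra|rewrite ler_pM2l].
Qed.

(* [2 c u <= c ^+ 2 + u ^+ 2] and [stein_tail]. *)
Lemma tail_prob_bounds c : 0 < c ->
  c * E (fun y => (c <= tnth y i)%R%:R) <= H c /\
  c * H c * (p%:R + 1) <= (p%:R * c ^+ 2 + 1) * E (fun y => (c <= tnth y i)%R%:R).
Proof.
move=> c0; set q := E (fun y => (c <= tnth y i)%R%:R).
pose A2 := E (fun y => tnth y i ^+ 2 * (c <= tnth y i)%R%:R).
have gq : good (fun y => (c <= tnth y i)%R%:R) by solve_good.
have gA : good (fun y => tnth y i ^+ 2 * (c <= tnth y i)%R%:R) by solve_good.
have eJ : J c = q - A2.
  rewrite /q /A2 -savgB//; apply: eq_savg => y _; ring.
have eW : W c = A2 - c * H c.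
  rewrite /A2 /H -savgZ// -savgB//; last by solve_good.
  apply: eq_savg => y _; case: (leP c (tnth y i)) => h /=.
    by rewrite pos_id ?mulr1n; [ring|lra].
  by rewrite pos_le0 ?mulr0n; [ring|lra].
have := stein_tail c; rewrite eJ eW => hA.
have h2 : 2 * c * H c <= c ^+ 2 * q + A2.
  rewrite /q /A2 -!savgZ// -savgD//; last by solve_good.
  apply: savg_le; [solve_good|solve_good|move=> y _].
  by case: (leP c (tnth y i)) => h /=; rewrite ?mulr1n ?mulr0n; nra.
split.
  rewrite -savgZ//; apply: savg_le; [solve_good|solve_good|move=> y _].
  by case: (leP c (tnth y i)) => h /=; rewrite ?mulr1n ?mulr0n; lra.
have p0 : 0 <= p%:R :> R by [].
have : p%:R * (2 * c * H c) <= p%:R * (c ^+ 2 * q + A2) by exact: ler_wpM2l.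
lra.
Qed.

End tail.

(** * Solving the differential equation in bracket form *)

Section exponential_decay.
Context {R : realType}.
Implicit Types (c x y h : R) (f lam : R -> R).

Lemma lipschitz_continuous_at f K c :
  (\forall x \near c, `|f c - f x| <= K * `|c - x|) -> {for c, continuous f}.
Proof.
move=> fK; apply/cvgrPdist_le => e e0.
pose K' := `|K| + 1; have K0 : 0 < K' by rewrite ltr_wpDl.
near=> x; have h : `|f c - f x| <= K * `|c - x| by near: x; exact: fK.
apply: (le_trans h); apply: (@le_trans _ _ (K' * `|c - x|)).
  by rewrite ler_wpM2r// /K'; have := ler_norm K; lra.
rewrite -ler_pdivlMl// mulrC; near: x.
by apply: cvgr_dist_le; [exact: cvg_id|exact: divr_gt0].
Unshelve. all: by end_near. Qed.

(** For [h > 0] the bracket with left end [c] squeezes the difference quotient, for [h < 0] the one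
    with right end [c]; continuity of [f] and [lam] makes the bounds meet. *)
Lemma is_derive_decay f lam c : {for c, continuous f} -> {for c, continuous lam} ->
  (exists2 e, 0 < e & forall x y, c - e < x -> x < y -> y < c + e ->
    lam x * f y * (y - x) <= f x - f y <= lam y * f x * (y - x)) ->
  is_derive c 1 f (- (lam c * f c)).
Proof.
move=> cf clam [e e0 hf].
suff K : h^-1 *: ((f \o shift c) (h *: 1) - f c) @[h --> 0^'] --> - (lam c * f c).
  by apply: DeriveDef; [apply/cvg_ex; exists (- (lam c * f c))|exact: cvg_lim K].
have c1 : lam (h + c) * f c @[h --> 0^'] --> lam c * f c.
  apply: cvgM; last exact: cvg_cst.
  apply: (@cvg_within_filter _ _ (lam \o (fun h => h + c))).
  apply: (@cvg_comp _ _ _ (+%R^~ c) lam _ (nbhs c)) => //.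
  by rewrite -{2}(add0r c); apply: cvgD; [exact: cvg_id|exact: cvg_cst].
have c2 : lam c * f (h + c) @[h --> 0^'] --> lam c * f c.
  apply: cvgM; first exact: cvg_cst.
  apply: (@cvg_within_filter _ _ (f \o (fun h => h + c))).
  apply: (@cvg_comp _ _ _ (+%R^~ c) f _ (nbhs c)) => //.
  by rewrite -{2}(add0r c); apply: cvgD; [exact: cvg_id|exact: cvg_cst].
apply/cvgrPdist_le => k k0; have k20 : 0 < k / 2 by lra.
near=> h.
have h0 : h != 0 by near: h; exact: nbhs_dnbhs_neq.
have he : `|h| < e by near: h; apply: dnbhs0_lt.
have k1 : `|lam c * f c - lam (h + c) * f c| <= k / 2.
  by near: h; move/cvgrPdist_le : c1; apply.
have k2 : `|lam c * f c - lam c * f (h + c)| <= k / 2.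
  by near: h; move/cvgrPdist_le : c2; apply.
rewrite /= /shift /= [h *: 1]mulr1 /GRing.scale/=.
move: k1 k2 he; rewrite !ler_norml ltr_norml => /andP[k1 k1'] /andP[k2 k2'] /andP[he he'].
have [hp|hn] := ltP 0 h.
  have := hf c (h + c); case/(_ _ _ _)/andP; [lra|lra|lra|].
  rewrite addrK => u1 u2.
  have v1 : lam c * f (h + c) <= h^-1 * (f c - f (h + c)) by rewrite ler_pdivlMl// mulrC.
  have v2 : h^-1 * (f c - f (h + c)) <= lam (h + c) * f c.
    by rewrite ler_pdivrMl// mulrC.
  by apply/andP; split; lra.
have {}hn : h < 0 by rewrite lt_neqAle h0.
have := hf (h + c) c; case/(_ _ _ _)/andP; [lra|lra|lra|].
have -> : c - (h + c) = - h by ring.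
move=> u1 u2.
have mh : 0 < - h by lra.
have E : h^-1 * (f (h + c) - f c) = - ((- h)^-1 * (f (h + c) - f c)).
  by rewrite invrN; ring.
have v1 : lam (h + c) * f c <= (- h)^-1 * (f (h + c) - f c).
  by rewrite ler_pdivlMl// mulrC.
have v2 : (- h)^-1 * (f (h + c) - f c) <= lam c * f (h + c).
  by rewrite ler_pdivrMl// mulrC.
by rewrite E; apply/andP; split; lra.
Unshelve. all: by end_near. Qed.

(** The bracket says [f' = - q c / (1 - c ^ 2) f], along which [f ^ 2 / (1 - c ^ 2) ^ q] is
    constant. Squaring keeps the square root out of the differentiation. *)
Lemma decay_solution (f : R -> R) (q : nat) :
  (forall c, 0 <= c -> 0 <= f c <= 1) ->
  (forall c c', 0 <= c -> c < c' -> c' < 1 ->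
    q%:R * (c / (1 - c ^+ 2)) * f c' * (c' - c) <= f c - f c' <=
    q%:R * (c' / (1 - c' ^+ 2)) * f c * (c' - c)) ->
  forall c, 0 <= c < 1 -> f c = f 0 * Num.sqrt (1 - c ^+ 2) ^+ q.
Proof.
move=> f01 fd b /andP[b0 b1].
have [->|bn0] := eqVneq b 0; first by rewrite expr0n subr0 sqrtr1 expr1n mulr1.
have {bn0}b0 : 0 < b by rewrite lt_neqAle eq_sym bn0.
(* The brackets concern nonnegative arguments while continuity at 0 is two-sided, hence the constant
   extension to the left; [d] leaves room to the right of [b] and stays below 1, where the Lipschitz
   constant is finite. *)
pose g c := f (Num.max c 0).
pose d := (b + 1) / 2; have bd : b < d by rewrite /d; lra.
have d1 : d < 1 by rewrite /d; lra.
have d21 : 0 < 1 - d ^+ 2 by nra.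
have lip1 x y : 0 <= x -> x <= y -> y <= d -> `|f x - f y| <= q%:R * (1 - d ^+ 2)^-1 * `|x - y|.
  move=> x0; rewrite le_eqVlt => /predU1P[-> _|xy yd]; first by rewrite !subrr normr0 mulr0.
  have /andP[l u] := fd x y x0 xy (le_lt_trans yd d1).
  have fx := f01 x x0; have fy := f01 y (le_trans x0 (ltW xy)).
  have y21 : 1 - d ^+ 2 <= 1 - y ^+ 2 by nra.
  rewrite (distrC x) (gtr0_norm (_ : 0 < y - x)) ?subr_gt0// ger0_norm; last first.
    apply: le_trans l; rewrite !mulr_ge0//; [|by case/andP: fy|lra].
    by rewrite invr_ge0; nra.
  apply: le_trans u _; rewrite ler_wpM2r//; first lra.
  rewrite -mulrA ler_wpM2l//.
  have /andP[fx0 fx1] := fx.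
  apply: (@le_trans _ _ (y / (1 - y ^+ 2))).
    rewrite ler_piMr// divr_ge0//; lra.
  apply: (@le_trans _ _ (1 - y ^+ 2)^-1).
    by rewrite ler_piMl ?invr_ge0//; lra.
  by rewrite lef_pV2// posrE; lra.
have lip x y : x <= d -> y <= d -> `|g x - g y| <= q%:R * (1 - d ^+ 2)^-1 * `|x - y|.
  wlog xy : x y / x <= y.
    move=> wl xd yd; have [|/ltW] := leP x y; first by move=> ?; exact: wl.
    by move=> yx; rewrite distrC (distrC x); exact: wl.
  move=> xd yd; rewrite /g.
  apply: le_trans (lip1 _ _ _ _ _) _.
  - by rewrite le_max lexx orbT.
  - by rewrite ge_max !le_max xy lexx !orbT.
  - by rewrite ge_max yd/=; lra.
  - rewrite ler_wpM2l// ?mulr_ge0 ?invr_ge0//; first lra.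
    exact: (pos_lipschitz x y).
have cg c : c < d -> {for c, continuous g}.
  move=> cd; apply: (@lipschitz_continuous_at _ (q%:R * (1 - d ^+ 2)^-1)).
  near=> x; apply: lip; first exact: ltW.
  by apply: ltW; near: x; exact: lt_nbhsl.
pose F c := g c ^+ 2 * ((1 - c ^+ 2) ^+ q)^-1.
pose lam c := q%:R * (c / (1 - c ^+ 2)).
have dg c : 0 < c < d -> is_derive c 1 g (- (lam c * g c)).
  move=> /andP[c0 cd]; apply: is_derive_decay; first exact: cg.
    apply: cvgM; first exact: cvg_cst.
    apply: cvgM; first exact: cvg_id.
    apply: cvgV; first by apply: lt0r_neq0; nra.
    apply: cvgB; first exact: cvg_cst.
    by apply: exprn_continuous.
  exists (Num.min c (d - c)); first by rewrite lt_min c0 subr_gt0.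
  move=> x y hx xy hy.
  have x0 : 0 < x.
    have : Num.min c (d - c) <= c by rewrite ge_min lexx.
    lra.
  have yd : y < d.
    have : Num.min c (d - c) <= d - c by rewrite ge_min lexx orbT.
    lra.
  have := fd x y (ltW x0) xy (lt_trans yd d1).
  by rewrite /g !max_l//; lra.
have sq c : c < d -> 0 < c -> 0 < 1 - c ^+ 2 by move=> *; nra.
have Fc : F b = F 0.
  have [||x _] := @MVT _ F (fun=> 0) 0 b b0; last by rewrite mul0r => /eqP; rewrite subr_eq0 => /eqP.
    move=> x; rewrite in_itv/= => /andP[x0 xb].
    have xd : x < d by lra.
    have Dg := dg x (introT andP (conj x0 xd)).
    have x21 := sq _ xd x0.
    have Dp : is_derive x 1 (fun y : R => (1 - y ^+ 2) ^+ q)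
        (q%:R * (1 - x ^+ 2) ^+ q.-1 * (- (2 * x))).
      rewrite (_ : (fun y : R => _) = ((cst 1 - (@id R) ^+ 2) ^+ q : R -> R)).
        apply: is_derive_eq.
        by rewrite /GRing.scale/= !fctE/=; ring.
      by apply/funext => y; rewrite !fctE.
    have Dv := is_deriveV (f := fun y : R => (1 - y ^+ 2) ^+ q) (lt0r_neq0 (exprn_gt0 q x21)) Dp.
    rewrite (_ : F = g ^+ 2 * (fun y : R => ((1 - y ^+ 2) ^+ q)^-1)); last first.
      by apply/funext => y; rewrite !fctE.
    apply: is_derive_eq.
    rewrite /GRing.scale/= /lam !fctE.
    case: (q) => [|q']; first by rewrite !mul0r; ring.
    rewrite /= (exprS (1 - x ^+ 2) q').
    have v0 : (1 - x ^+ 2) ^+ q' != 0 by rewrite expf_neq0// lt0r_neq0.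
    set v := (1 - x ^+ 2) ^+ q' in v0 *; set k := q'.+1%:R.
    field.
    by rewrite v0 lt0r_neq0.
  apply: continuous_in_subspaceT => x; rewrite inE/= in_itv/= => /andP[x0 xb].
  apply: cvgM.
    apply: (@cvg_comp _ _ _ g (fun y => y ^+ 2) _ (nbhs (g x))).
      by apply: cg; lra.
    exact: exprn_continuous.
  apply: cvgV; first by apply: expf_neq0; apply: lt0r_neq0; nra.
  apply: (@cvg_comp _ _ _ (fun y => 1 - y ^+ 2) (fun y => y ^+ q) _ (nbhs (1 - x ^+ 2))).
    by apply: cvgB; [exact: cvg_cst|exact: exprn_continuous].
  exact: exprn_continuous.
have b21 := sq _ bd b0.
move: Fc; rewrite /F /g max_l ?(ltW b0)// max_l// expr0n subr0 expr1n invr1 mulr1 => Fc.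
have /andP[fb0 _] := f01 b (ltW b0); have /andP[f00 _] := f01 0 (lexx 0).
apply/eqP; rewrite -(@eqrXn2 _ 2)// ?mulr_ge0 ?exprn_ge0//.
rewrite exprMn -exprM mulnC exprM sqr_sqrtr ?ltW// -Fc divfK//.
by rewrite expf_neq0// lt0r_neq0.
Unshelve. all: by end_near. Qed.

End exponential_decay.

(** * Closed form of the truncated mean and bounds from the second and fourth moments *)

Section tail_formula.
Context {R : realType} {p : nat} (mu : probability (p.-tuple R) R).
Hypothesis mu_unif : uniform_on_sphere mu.
Hypothesis p_ge2 : (2 <= p)%N.
Variable i : 'I_p.
Implicit Types (y : p.-tuple R) (c : R).
Local Notation E := (savg mu).
Local Notation H := (tailE mu i).

Lemma tailE_formula c : 0 <= c < 1 ->
  H c = H 0 * Num.sqrt (1 - c ^+ 2) ^+ p.-1.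
Proof.
apply: decay_solution => [{}c c0|{}c c' c0 cc' c'1].
  by rewrite tailE_ge0//= tailE_le1.
have -> : p.-1%:R = p%:R - 1 :> R by rewrite -subn1 natrB// ltnW.
exact: tailE_diff.
Qed.

Let exj : exists j, i != j.
Proof.
have [->|] := eqVneq i (Ordinal (ltnW p_ge2)); last by exists (Ordinal (ltnW p_ge2)).
by exists (Ordinal p_ge2).
Qed.

Let m2 := E (fun y => tnth y i ^+ 2).
Let m4 := E (fun y => tnth y i ^+ 4).

Let swap j (phi : R -> R) : i != j -> good (fun y => phi (tnth y i)) ->
  E (fun y => phi (tnth y j)) = E (fun y => phi (tnth y i)).
Proof.
move=> ij gphi.
have ab : 0 ^+ 2 + 1 ^+ 2 = 1 :> R by ring.
rewrite -(savg_plane mu_unif (g := fun u _ => phi u) ij ab gphi).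
by apply: eq_savg => y _; rewrite mul0r mul1r add0r.
Qed.

Lemma savg_sqr : p%:R * m2 = 1.
Proof.
have g2 : good (fun y : p.-tuple R => tnth y i ^+ 2) by solve_good.
have hj j : i != j -> E (fun y => tnth y j ^+ 2 * 1) = m2.
  move=> ij; rewrite /m2 -(swap (phi := fun u => u ^+ 2) ij g2).
  by apply: eq_savg => y _; rewrite mulr1.
have := savg_others mu_unif (phi := fun=> 1) (good_cst 1) hj.
rewrite (@eq_savg _ _ _ _ (fun y => 1 - tnth y i ^+ 2)); last by move=> y _; ring.
  by rewrite savgB ?savg_cst// -/m2; [lra|solve_good..].
Qed.

(** Rotation by 45 degrees: the fourth powers of [(y_i + y_j) / sqrt 2] and [(y_i - y_j) / sqrt 2]
    each have mean [m4], while their sum expands to [y_i ^ 4 / 2 + 3 y_i ^ 2 y_j ^ 2 + y_j ^ 4 /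
    2]. *)
Let fourth_mixed j : i != j -> E (fun y => tnth y j ^+ 2 * tnth y i ^+ 2) = m4 / 3.
Proof.
move=> ij; pose a : R := (Num.sqrt 2)^-1.
have a2 : a ^+ 2 = 2^-1 by rewrite exprVn sqr_sqrtr.
have a4 : a ^+ 4 = 4^-1 by rewrite (exprM a 2 2) a2; field.
have g4 : good (fun y => tnth y i ^+ 4) by solve_good.
have g4j : good (fun y => tnth y j ^+ 4) by solve_good.
have g22 : good (fun y => tnth y j ^+ 2 * tnth y i ^+ 2) by solve_good.
have e1 : a ^+ 2 + a ^+ 2 = 1 by rewrite a2; field.
have e2 : a ^+ 2 + (- a) ^+ 2 = 1 by rewrite sqrrN.
have h1 := savg_plane mu_unif (g := fun u _ => u ^+ 4) ij e1 g4.
have h2 := savg_plane mu_unif (g := fun u _ => u ^+ 4) ij e2 g4.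
have : E (fun y => (a * tnth y i + a * tnth y j) ^+ 4) +
    E (fun y => (a * tnth y i + - a * tnth y j) ^+ 4) = 2 * m4.
  by rewrite h1 h2 /m4; ring.
rewrite -savgD; [|solve_good..].
rewrite (@eq_savg _ _ _ _ (fun y => 2^-1 * tnth y i ^+ 4 + 3 * (tnth y j ^+ 2 * tnth y i ^+ 2)
    + 2^-1 * tnth y j ^+ 4)).
  rewrite !savgD ?savgZ//; [|solve_good..].
  rewrite (swap (phi := fun u => u ^+ 4) ij g4) -/m4 => h.
  lra.
move=> y _; set u := tnth y i; set v := tnth y j.
transitivity (a ^+ 4 * (2 * u ^+ 4 + 12 * (v ^+ 2 * u ^+ 2) + 2 * v ^+ 4)); first ring.
by rewrite a4; field.
Qed.

Lemma savg_fourth : p%:R * (p%:R + 2) * m4 = 3.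
Proof.
have g2 : good (fun y : p.-tuple R => tnth y i ^+ 2) by solve_good.
have := savg_others mu_unif (phi := fun u => u ^+ 2) g2 fourth_mixed.
rewrite (@eq_savg _ _ _ _ (fun y => tnth y i ^+ 2 - tnth y i ^+ 4)); last by move=> y _; ring.
rewrite savgB; [|solve_good..].
rewrite -/m2 -/m4 => h; have := savg_sqr => h2.
have : p%:R * (m2 - m4) = p%:R * ((p%:R - 1) * (m4 / 3)) by rewrite h.
rewrite mulrBr h2 => h3.
lra.
Qed.

Let abs_tail : E (fun y => `|tnth y i|) = 2 * H 0.
Proof.
have [j ij] := exj.
have ab : (-1) ^+ 2 + 0 ^+ 2 = 1 :> R by ring.
have gi : good (fun y : p.-tuple R => tnth y i) by solve_good.
have E0 : E (fun y => tnth y i) = 0.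
  have := savg_plane mu_unif (g := fun u _ => u) ij ab gi.
  rewrite (@eq_savg _ _ _ _ (fun y => -1 * tnth y i)); last by move=> y _; ring.
  by rewrite savgZ//; lra.
transitivity (E (fun y => 2 * (tnth y i * (0 <= tnth y i)%R%:R) - tnth y i)).
  apply: eq_savg => y _.
  by case: (leP 0 (tnth y i)) => [u0|u0]; rewrite ?(ger0_norm u0) ?(ltr0_norm u0)/=; lra.
rewrite savgB; [|solve_good..].
by rewrite savgZ ?E0 ?subr0//; solve_good.
Qed.

Lemma tailE0_bounds : 2 / 9 / Num.sqrt p%:R <= H 0 <= (2 * Num.sqrt p%:R)^-1.
Proof.
have p0 : 0 < p%:R :> R by rewrite ltr0n ltnW.
set s := Num.sqrt p%:R; have s0 : 0 < s by rewrite sqrtr_gt0.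
have s2 : s ^+ 2 = p%:R by rewrite sqr_sqrtr// ltW.
have gn : good (fun y : p.-tuple R => `|tnth y i|) by solve_good.
have hm2 := savg_sqr; have hm4 := savg_fourth.
have up : s * E (fun y => `|tnth y i|) <= 1.
  rewrite -savgZ//; apply: (@le_trans _ _ (2^-1 + p%:R / 2 * m2)); last lra.
  rewrite -savgZ; last solve_good.
  rewrite -{1}(savg_cst mu_unif 2^-1) -savgD; [|solve_good..].
  apply: savg_le; [solve_good|solve_good|move=> y _].
  rewrite -s2 -(real_normK (num_real (tnth y i))).
  by have := sqr_ge0 (s * `|tnth y i| - 1); lra.
(* With [x = s |u|] one has [x - x ^ 2 / 2 + x ^ 4 / 54 = x (x - 3) ^ 2 (x + 6) / 54 >= 0]. Taking
   means, the two moments give the lower bound [1 / 2 - p / (18 (p + 2))], which is at least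
   [4 / 9]. *)
have lo : 4 / 9 <= s * E (fun y => `|tnth y i|).
  rewrite -savgZ//; apply: (@le_trans _ _ (p%:R / 2 * m2 - p%:R ^+ 2 / 54 * m4)).
    have m40 : 0 <= m4 by apply: savg_ge0 => [|y _]; [solve_good|rewrite exprn_even_ge0].
    have : 0 <= p%:R * m4 by rewrite mulr_ge0// ltW.
    lra.
  rewrite -!savgZ; [|solve_good..].
  rewrite -savgB; [|solve_good..].
  apply: savg_le; [solve_good|solve_good|move=> y _].
  rewrite -s2 -(real_normK (num_real (tnth y i))) (_ : tnth y i ^+ 4 = `|tnth y i| ^+ 4); last first.
    by rewrite (exprM _ 2 2) -(real_normK (num_real (tnth y i))) -exprM.
  have t0 : 0 <= s * `|tnth y i| by rewrite mulr_ge0// ltW.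
  have t6 : 0 <= s * `|tnth y i| + 6 by lra.
  by have := mulr_ge0 (mulr_ge0 t0 (sqr_ge0 (s * `|tnth y i| - 3))) t6; lra.
rewrite abs_tail in up lo.
apply/andP; split; first by rewrite ler_pdivrMr//; lra.
by rewrite -[leRHS]mulr1 ler_pdivlMl ?mulr_gt0//; lra.
Qed.

End tail_formula.

(** * Independence of generated sigma-algebras *)

Section pi_lambda.
Context {R : realType} {d} {T : measurableType d} (P : probability T R).
Implicit Types (E F : set T) (G : set (set T)).

Definition indep E F := P (E `&` F) = (P E * P F)%E.

Lemma indepC E F : indep E F -> indep F E.
Proof. by rewrite /indep setIC muleC. Qed.

(** The events independent of a fixed [F] form a lambda-system: proper differences and increasing
    unions pass through both sides of the product formula. *)
Lemma indep_g_sigma G F : setI_closed G -> G `<=` measurable -> measurable F ->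
  (forall E, G E -> indep E F) -> forall E, <<s G >> E -> indep E F.
Proof.
move=> GI Gm mF GF; pose L E := measurable E /\ indep E F.
suff : <<s G >> `<=` L by move=> h E /h[].
apply: lambda_system_subset => //; last by move=> E GE; split; [exact: Gm|exact: GF].
have fin E : measurable E -> P E \is a fin_num by move=> mE; exact: fin_num_measure.
split=> //.
- split; first exact: measurableT.
  by rewrite /indep setTI probability_setT mul1e.
- move=> A B BA [mA iA] [mB iB]; split; first exact: measurableD.
  have DE A' B' : measurable A' -> measurable B' -> B' `<=` A' ->
      P (A' `\` B') = (P A' - P B')%E.
    move=> mA' mB' BA'; rewrite measureD//; first by rewrite setIidr.
    by rewrite ltey_eq fin.
  rewrite /indep; have -> : (A `\` B) `&` F = (A `&` F) `\` (B `&` F).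
    apply/seteqP; split=> [x /= [[Ax nB] Fx]|x /= [[Ax Fx] nB]]; split=> //.
      by case.
    by split=> // Bx; apply: nB.
  rewrite !DE ?iA ?iB//; [|exact: measurableI|exact: measurableI|exact: setSI].
  by rewrite muleBl// ?fin//; rewrite fin_num_adde_defr// ?fin.
- move=> A ndA LA; have mA n : measurable (A n) by have [] := LA n.
  have mU : measurable (\bigcup_i A i) by exact: bigcupT_measurable.
  split => //; rewrite /indep setI_bigcupl.
  have c1 : P (A n) @[n --> \oo] --> P (\bigcup_i A i) by exact: nondecreasing_cvg_mu.
  have c2 : P (A n `&` F) @[n --> \oo] --> P (\bigcup_i (A i `&` F)).
    apply: nondecreasing_cvg_mu => //; first by move=> n; exact: measurableI.
      by apply: bigcupT_measurable => n; exact: measurableI.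
    by move=> m n mn; apply/subsetPset; apply: setSI; exact/subsetPset/ndA.
  have c3 : (P (A n) * P F)%E @[n --> \oo] --> (P (\bigcup_i A i) * P F)%E.
    by apply: cvgeZr => //; exact: fin.
  rewrite -(cvg_lim _ c2)//; apply/cvg_lim => //.
  rewrite (_ : (fun n => P (A n `&` F)) = (fun n => P (A n) * P F)%E)//.
  by apply/funext => n; have [_ ->] := LA n.
Qed.

Lemma indep_g_sigma2 G1 G2 : setI_closed G1 -> setI_closed G2 ->
  G1 `<=` measurable -> G2 `<=` measurable ->
  (forall E F, G1 E -> G2 F -> indep E F) ->
  forall E F, <<s G1 >> E -> <<s G2 >> F -> indep E F.
Proof.
move=> I1 I2 m1 m2 h E F sE sF; apply/indepC.
have mE : measurable E.
  by move: sE; apply: smallest_sub => //; exact: sigma_algebra_measurable.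
apply: (indep_g_sigma I2 m2 mE _ sF) => {sF}F GF; apply/indepC.
by apply: (indep_g_sigma I1 m1 (m2 _ GF) _ sE) => {sE mE}E GE; exact: h.
Qed.

End pi_lambda.

(** * Independence of disjoint blocks of random vectors *)

Section blocks.
Context {R : realType} {d d'} {T : measurableType d} {T' : measurableType d'}.
Context (P : probability T R) {I : finType} (X : I -> {RV P >-> T'}).
Hypothesis X_indep : mutually_independent X.
Implicit Types (J K : {set I}) (E F : set T).

(** The cylinders over the block [J]: a pi-system to which mutual independence applies directly, and
    which generates the information carried by the vectors of the block. *)
Definition rects J : set (set T) := [set C | exists2 B : I -> set T',
  (forall i, measurable (B i)) & C = \bigcap_(i in [set` J]) X i @^-1` B i].

Definition events J := <<s rects J >>.

Lemma rects_setI J : setI_closed (rects J).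
Proof.
move=> _ _ [B mB ->] [C mC ->]; exists (fun i => B i `&` C i).
  by move=> i; exact: measurableI.
by rewrite -bigcapI; apply: eq_bigcapr => i _; rewrite preimage_setI.
Qed.

Let mX i B : measurable B -> measurable (X i @^-1` B).
Proof. by move=> mB; exact: measurable_funPTI. Qed.

Lemma rects_measurable J : rects J `<=` measurable.
Proof.
move=> _ [B mB ->]; apply: fin_bigcap_measurable => // i _; exact: mX.
Qed.

Lemma events_indep J K E F : (forall i, i \in J -> i \notin K) -> events J E -> events K F ->
  indep P E F.
Proof.
move=> JK; apply: indep_g_sigma2; [exact: rects_setI|exact: rects_setI|
  exact: rects_measurable|exact: rects_measurable|].
move=> {E F}_ _ [B mB ->] [C mC ->].
(* Disjointness lets a single family serve both blocks, so the intersection is a cylinder over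
   [J :|: K] and mutual independence applies to all three index sets. *)
pose D i := if i \in J then B i else C i.
have mD i : measurable (D i) by rewrite /D; case: ifP.
have DJ i : i \in J -> D i = B i.
  by move=> iJ; rewrite /D iJ.
have DK i : i \in K -> D i = C i.
  by move=> iK; rewrite /D ifF//; apply: contraTF iK => /JK.
rewrite /indep; have -> : \bigcap_(i in [set` J]) X i @^-1` B i `&` \bigcap_(i in [set` K]) X i @^-1` C i
    = \bigcap_(i in [set` J :|: K]) X i @^-1` D i.
  apply/seteqP; split=> [w [hJ hK] i /=|w h].
    by rewrite inE => /orP[iJ|iK]; [rewrite (DJ i iJ)|rewrite (DK i iK)]; [exact: hJ|exact: hK].
  split=> i /= iJ.
    by rewrite /= -(DJ i iJ); apply: h; rewrite /= inE iJ.
  by rewrite /= -(DK i iJ); apply: h; rewrite /= inE iJ orbT.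
rewrite !X_indep//.
rewrite (eq_bigl [predU J & K]) => [|i]; last by rewrite !inE.
rewrite bigU/=; last first.
  by rewrite disjoint_subset; apply/fintype.subsetP => i /JK.
congr (_ * _)%E; apply: eq_bigr => i iJ.
  by rewrite (DJ i iJ).
by rewrite (DK i iJ).
Qed.

(** Equipping the sample space with the smaller sigma-algebra turns dependence on a block into
    ordinary measurability, so that general measurability results place functions of these vectors
    in [events J]. *)
Lemma measurable_fun_events J i : i \in J ->
  measurable_fun [set: g_sigma_algebraType (rects J)]
    (X i : g_sigma_algebraType (rects J) -> T').
Proof.
move=> iJ _ B mB; rewrite setTI; apply: sub_sigma_algebra.
exists (fun j => if j == i then B else setT) => [j|]; first by case: ifP.
apply/seteqP; split=> [w Bw j _ /=|w /(_ i iJ)]; last by rewrite /= eqxx.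
by case: ifPn => // /eqP ->.
Qed.

Lemma events_preimage J d1 (T1 : measurableType d1) (B : set T1)
    (f : g_sigma_algebraType (rects J) -> T1) :
  measurable_fun setT f -> measurable B -> events J (f @^-1` B).
Proof. by move=> mf mB; rewrite -[X in events J X]setTI; exact: mf. Qed.

Lemma eventsC J E : events J E -> events J (~` E).
Proof. exact: (@measurableC _ (g_sigma_algebraType (rects J))). Qed.

Lemma eventsI J E F : events J E -> events J F -> events J (E `&` F).
Proof. exact: (@measurableI _ (g_sigma_algebraType (rects J))). Qed.

Lemma eventsT J : events J setT.
Proof. exact: (@measurableT _ (g_sigma_algebraType (rects J))). Qed.

End blocks.

(** * Probabilities as real numbers *)

Section real_probability.
Context {R : realType} {d} {T : measurableType d} (P : probability T R).
Implicit Types (E F G : set T).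

Definition pr E : R := fine (P E).

Lemma prE E : measurable E -> P E = (pr E)%:E.
Proof. by move=> mE; rewrite fineK// fin_num_measure. Qed.

Lemma pr_ge0 E : 0 <= pr E. Proof. exact: fine_ge0. Qed.

Lemma pr_le E F : measurable E -> measurable F -> E `<=` F -> pr E <= pr F.
Proof. by move=> mE mF EF; rewrite -lee_fin -!prE// le_measure// inE. Qed.

Lemma pr_setT : pr setT = 1. Proof. by rewrite /pr probability_setT. Qed.

Lemma pr_le1 E : measurable E -> pr E <= 1.
Proof. by move=> mE; rewrite -pr_setT pr_le. Qed.

Lemma pr_split E F : measurable E -> measurable F ->
  pr E = pr (E `&` F) + pr (E `&` ~` F).
Proof.
move=> mE mF; have mEF := measurableI _ _ mE mF.
have mEC := measurableI _ _ mE (measurableC mF).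
by apply: EFin_inj; rewrite EFinD -!prE// addeC (measureDI P mE mF) setDE.
Qed.

Lemma pr_setC E : measurable E -> pr (~` E) = 1 - pr E.
Proof.
by move=> mE; rewrite -pr_setT (pr_split measurableT mE) !setTI; ring.
Qed.

Lemma pr_setU E F : measurable E -> measurable F -> pr (E `|` F) <= pr E + pr F.
Proof.
move=> mE mF; rewrite -lee_fin EFinD -!prE//; first exact: measureU2.
exact: measurableU.
Qed.

Lemma pr_full E G : measurable E -> measurable G -> pr G = 1 -> pr (E `&` G) = pr E.
Proof.
move=> mE mG G1; rewrite (pr_split mE mG).
suff -> : pr (E `&` ~` G) = 0 by rewrite addr0.
apply/eqP; rewrite eq_le pr_ge0 andbT.
have <- : pr (~` G) = 0 by rewrite pr_setC// G1 subrr.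
by apply: pr_le => //; [apply: measurableI => //|]; exact: measurableC.
Qed.

Lemma pr_indep E F : measurable E -> measurable F -> indep P E F ->
  pr (E `&` F) = pr E * pr F.
Proof.
move=> mE mF h; apply: EFin_inj; rewrite EFinM -!prE//; exact: measurableI.
Qed.

End real_probability.

(** * Probability that no event of a locally dependent family occurs *)

Section void_probability.
Context {R : realType} {d} {T : measurableType d} (P : probability T R).
Context {K : eqType} (ev : K -> set T).
Hypothesis mev : forall k, measurable (ev k).
Implicit Types (s : seq K) (E : set T).

Definition void s := foldr (fun k C => ~` ev k `&` C) setT s.

Lemma measurable_void s : measurable (void s).
Proof. by elim: s => //= k s ih; apply: measurableI => //; exact: measurableC. Qed.

Lemma voidP s w : void s w <-> (forall k, k \in s -> ~ ev k w).
Proof.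
elim: s => [|k s ih] /=; first by split.
split=> [[nk /ih h] j|h]; first by rewrite inE => /predU1P[->|/h].
split; first by apply: h; rewrite mem_head.
by apply/ih => j js; apply: h; rewrite inE js orbT.
Qed.

Lemma void_filter s (a : pred K) : void s `<=` void (seq.filter a s).
Proof.
move=> w /voidP h; apply/voidP => k; rewrite mem_filter => /andP[_]; exact: h.
Qed.

(** A union bound inside [E]. It serves with [E = setT], where a discarded event costs [q], and with
    [E = ev k], where it costs only [q ^+ 2]. *)
Lemma void_filter_le E s (a : pred K) : measurable E ->
  pr P (E `&` void (seq.filter a s)) <=
  pr P (E `&` void s) + \sum_(k <- s | ~~ a k) pr P (E `&` ev k).
Proof.
have mv := measurable_void.
elim: s E => [|k s ih] E mE; first by rewrite big_nil addr0.
rewrite big_cons /=; case: (boolP (a k)) => ak /=.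
  have mE' : measurable (E `&` ~` ev k) by apply: measurableI => //; exact: measurableC.
  rewrite !setIA; apply: le_trans (ih _ mE') _.
  rewrite lerD2l; apply: ler_sum => j _; apply: pr_le; [exact: measurableI..|].
  by apply: setSI; exact: subIsetl.
apply: le_trans (ih _ mE) _; rewrite addrA lerD2r.
rewrite (pr_split P (measurableI _ _ mE (mv s)) (mev k)) addrC.
have mC := measurableC (mev k).
have mEv := measurableI _ _ mE (mv s).
apply: lerD; apply: pr_le; try by do ?apply: measurableI.
  by move=> w /= [[Ew vw] ?].
by move=> w /= [[Ew vw] ?].
Qed.

Variables (share : rel K) (q : R) (C : nat).
Hypothesis q01 : 0 <= q <= 1.

(** The loss from [void s] to [void (k :: s)] is the probability of [ev k] and [void s] together.
    Dropping the at most [C] events that share with [k] leaves a void event independent of [ev k];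
    this costs [C q], hence [C q ^ 2] after multiplication by [q], on one side, and [C q ^ 2] inside
    [ev k] on the other. *)
Lemma void_step k s : (forall j, j \in k :: s -> pr P (ev j) = q) ->
  (forall j, j \in s -> share k j -> pr P (ev k `&` ev j) = q ^+ 2) ->
  indep P (ev k) (void [seq j <- s | ~~ share k j]) ->
  (count (share k) s <= C)%N ->
  `|pr P (void (k :: s)) - (1 - q) * pr P (void s)| <= 2 * q ^+ 2 * C%:R.
Proof.
move=> prev pair ind cnt; have mv := measurable_void.
pose sI := [seq j <- s | ~~ share k j].
have h1 : pr P (void s) = pr P (void s `&` ev k) + pr P (void (k :: s)).
  by rewrite (pr_split P (mv s) (mev k)) /= (setIC (~` _)).
have cE (v : R) : \sum_(j <- s | ~~ ~~ share k j) v = (count (share k) s)%:R * v.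
  under eq_bigl do rewrite negbK.
  by rewrite big_const_seq iter_addr_0 mulr_natl.
have h2 := void_filter_le s (fun j => ~~ share k j) (mev k).
have h3 := void_filter_le s (fun j => ~~ share k j) measurableT.
rewrite !setTI -/sI in h2 h3.
rewrite big_seq_cond (eq_bigr (fun=> q ^+ 2)) in h2; last first.
  by move=> j /andP[js]; rewrite negbK => skj; exact: pair.
rewrite -big_seq_cond cE in h2.
rewrite big_seq_cond (eq_bigr (fun=> q)) in h3; last first.
  by move=> j /andP[js _]; rewrite setTI prev// inE js orbT.
rewrite -big_seq_cond cE in h3.
rewrite (pr_indep (mev k) (mv sI) ind) prev ?mem_head// in h2.
have h4 : pr P (ev k `&` void s) <= q * pr P (void sI).
  rewrite -(prev k (mem_head _ _)) -(pr_indep (mev k) (mv sI) ind).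
  by apply: pr_le; [exact: measurableI|exact: measurableI|apply: setIS; exact: void_filter].
have h5 : pr P (void s) <= pr P (void sI).
  by apply: pr_le => //; exact: void_filter.
have cC : (count (share k) s)%:R <= C%:R :> R by rewrite ler_nat.
rewrite setIC in h1.
have /andP[q0 q1] := q01.
have h6 : (count (share k) s)%:R * q ^+ 2 <= C%:R * q ^+ 2 by rewrite ler_wpM2r ?sqr_ge0.
have h7 : q * pr P (void sI) <= q * pr P (void s) + C%:R * q ^+ 2.
  apply: (@le_trans _ _ (q * (pr P (void s) + (count (share k) s)%:R * q))).
    by rewrite ler_wpM2l.
  lra.
have h8 : q * pr P (void s) <= q * pr P (void sI) by rewrite ler_wpM2l.
have h9 : 0 <= C%:R * q ^+ 2 by rewrite mulr_ge0 ?sqr_ge0.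
by rewrite ler_norml; apply/andP; split; lra.
Qed.

(** Telescoping of [void_step]: each earlier error is multiplied by [1 - q], which lies in [[0, 1]],
    so the errors add up at most linearly. *)
Lemma void_bound s : uniq s -> (forall k, k \in s -> pr P (ev k) = q) ->
  (forall k j, k \in s -> j \in s -> k != j -> share k j ->
    pr P (ev k `&` ev j) = q ^+ 2) ->
  (forall k r, k \in s -> {subset r <= s} ->
    indep P (ev k) (void [seq j <- r | ~~ share k j])) ->
  (forall k, k \in s -> (count (share k) s <= C)%N) ->
  `|pr P (void s) - (1 - q) ^+ size s| <= 2 * q ^+ 2 * C%:R * (size s)%:R.
Proof.
have /andP[q0 q1] := q01.
elim: s => [|k s ih] /=; first by rewrite pr_setT subrr normr0 mulr0.
move=> /andP[ks us] prev pair ind cnt.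
have sub j : j \in s -> j \in k :: s by move=> js; rewrite inE js orbT.
have {}ih : `|pr P (void s) - (1 - q) ^+ size s| <= 2 * q ^+ 2 * C%:R * (size s)%:R.
  apply: ih => //.
  - by move=> l /sub; exact: prev.
  - by move=> l j /sub ls /sub js; exact: pair.
  - by move=> l r /sub ls rs; apply: ind => // j /rs /sub.
  - by move=> l /sub ls; apply: leq_trans (cnt _ ls); exact: leq_addl.
have st : `|pr P (void (k :: s)) - (1 - q) * pr P (void s)| <= 2 * q ^+ 2 * C%:R.
  apply: void_step => //.
  - move=> j js; apply: pair; rewrite ?mem_head//; first exact: sub.
    by apply: contraNneq ks => ->.
  - by apply: ind; rewrite ?mem_head.
  - by apply: leq_trans (cnt _ (mem_head _ _)); exact: leq_addl.
have -> : pr P (void (k :: s)) - (1 - q) ^+ (size s).+1 =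
  (pr P (void (k :: s)) - (1 - q) * pr P (void s)) +
  (1 - q) * (pr P (void s) - (1 - q) ^+ size s) by rewrite exprS; ring.
apply: le_trans (ler_normD _ _) _.
rewrite -(natr1 (size s)) [leRHS]mulrDr mulr1 [leRHS]addrC lerD//.
rewrite normrM -[leRHS]mul1r ler_pM//.
by rewrite ger0_norm; lra.
Qed.

End void_probability.

(** * Events defined by the dot products of pairs *)

Section angle_events.
Context {R : realType} {d} {T : measurableType d} (P : probability T R).
Context {n p : nat} (X : 'I_n -> {RV P >-> p.-tuple R}).
Hypothesis X_indep : mutually_independent X.
Hypothesis X_unif : forall i, uniform_on_sphere (distribution P (X i)).
Variables (k0 : 'I_p) (A : set R).
Hypothesis mA : measurable A.
Implicit Types (a b c i j : 'I_n).

Definition dot_event (k : 'I_n * 'I_n) : set T :=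
  [set w | A (dotp (X k.1 w) (X k.2 w))].

Let mX i : measurable_fun setT (X i). Proof. exact: measurable_funPT. Qed.

Let mdot : measurable_fun setT (fun z : p.-tuple R * p.-tuple R => dotp z.1 z.2).
Proof. by apply: measurable_dotp. Qed.

Lemma measurable_dot_event k : measurable (dot_event k).
Proof.
rewrite -[dot_event k]setTI; apply: measurable_dotp => //.
Qed.

Lemma dot_eventC a b : dot_event (a, b) = dot_event (b, a).
Proof. by apply/seteqP; split=> w; rewrite /dot_event /= dotpC. Qed.

Definition coord_event i : set T := X i @^-1` [set y | A (tnth y k0)].

Let mcoordA : measurable [set y : p.-tuple R | A (tnth y k0)].
Proof. by rewrite -[X in measurable X]setTI; exact: measurable_coord. Qed.

Let msph i : measurable (X i @^-1` sph).
Proof. by rewrite -[X in measurable X]setTI; apply: mX => //; exact: measurable_sph. Qed.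

Let Xsph i : pr P (X i @^-1` sph) = 1.
Proof. by have [h _] := X_unif i; rewrite /pr [X in fine X](h). Qed.

(* Fubini: conditionally on [V], the product [g V . X b] has the law of a
   coordinate of [X b]. *)
Lemma dot_fubini d1 (T1 : measurableType d1) (V : {mfun T >-> T1})
    (g : T1 -> p.-tuple R) (F : set T1) b :
  measurable_fun setT g -> measurable F -> (forall v, F v -> sph (g v)) ->
  (forall B C, measurable B -> measurable C -> indep P (V @^-1` B) (X b @^-1` C)) ->
  pr P (V @^-1` F `&` [set w | A (dotp (g (V w)) (X b w))]) =
  pr P (V @^-1` F) * pr P (coord_event b).
Proof.
move=> mg mF Fsph ind.
have mV : measurable_fun setT V by exact: measurable_funPT.
pose Y w := (V w, X b w).
have mY : measurable_fun setT Y by exact: measurable_fun_pair.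
pose m1 := distribution P V; pose m2 := distribution P (X b).
pose f (z : T1 * p.-tuple R) := dotp (g z.1) z.2.
have mf : measurable_fun setT f.
  by apply: measurable_dotp => //; exact: measurableT_comp.
pose Z := (F `*` setT) `&` (f @^-1` A).
have mZ : measurable Z.
  apply: measurableI; first exact: measurableX.
  by rewrite -[X in measurable X]setTI; exact: mf.
have E1 : (m1 \x m2)%E Z = pushforward P Y Z.
  apply: (@product_measure_unique _ _ _ _ _ m1 m2
    (distribution P (mfun_Sub (mem_set mY) : {mfun T >-> (T1 * p.-tuple R)%type}))) => //.
have -> : V @^-1` F `&` [set w | A (dotp (g (V w)) (X b w))] = Y @^-1` Z.
  by apply/seteqP; split=> w; rewrite /Z /f /=; tauto.
rewrite /pr -[P (Y @^-1` Z)]E1 /product_measure1.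
transitivity (fine (\int[m1]_(x in F) m2 [set y | A (tnth y k0)])%E).
  congr fine; rewrite [RHS]integral_mkcond; apply: eq_integral => x _ /=.
  rewrite patchE; case: ifPn => [/set_mem Fx|].
    rewrite -[RHS](unif_dotp (X_unif b) k0 (Fsph _ Fx) mA); congr (m2 _).
    by apply/seteqP; split=> y; rewrite /xsection /= inE /Z /f /=; tauto.
  rewrite notin_setE => nFx; have -> : xsection Z x = set0.
    by apply/seteqP; split=> y //; rewrite /xsection /= inE => -[[]].
  exact: (measure0 m2).
rewrite integral_cst// muleC [LHS]fineM//.
- exact: (fin_num_measure m1).
- exact: (fin_num_measure m2).
Qed.

Let blocks_indep (J K : {set 'I_n}) E F : (forall i, i \in J -> i \notin K) ->
  events X J E -> events X K F -> indep P E F.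
Proof. exact: events_indep. Qed.

Let mXev (J : {set 'I_n}) i : i \in J ->
  measurable_fun [set: g_sigma_algebraType (rects X J)]
    (X i : g_sigma_algebraType (rects X J) -> p.-tuple R).
Proof. exact: measurable_fun_events. Qed.

Lemma dot_event_events (J : {set 'I_n}) a b : a \in J -> b \in J ->
  events X J (dot_event (a, b)).
Proof.
move=> aJ bJ; apply: (@events_preimage _ _ _ _ _ _ _ X J _ _ A
  (fun w => dotp (X a w) (X b w))) => //.
by apply: measurable_dotp; exact: mXev.
Qed.

Lemma pr_dot_event a b : a != b -> pr P (dot_event (a, b)) = pr P (coord_event b).
Proof.
move=> ab; rewrite -[RHS]mul1r -(Xsph a) -(@dot_fubini _ _ (X a) id sph b)//.
- by rewrite setIC [RHS](pr_full (measurable_dot_event (a, b)) (msph a) (Xsph a)).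
- exact: measurable_sph.
move=> B C mB mC; apply: (@blocks_indep [set a] [set b]).
- by move=> i; rewrite !inE => /eqP ->.
- by apply: events_preimage => //; apply: mXev; rewrite inE.
- by apply: events_preimage => //; apply: mXev; rewrite inE.
Qed.

(** Conditioning on [(X a, X b)] decides the first event and leaves [X a . X c] with the law of a
    coordinate. The constraint that [X a] lies on the sphere enters through [F] and is removed again
    because it holds almost surely. *)
Lemma pr_dot_event2 a b c : a != b -> a != c -> b != c ->
  pr P (dot_event (a, b) `&` dot_event (a, c)) =
  pr P (coord_event b) * pr P (coord_event c).
Proof.
move=> ab ac bc; rewrite -(pr_dot_event ab).
pose V w := (X a w, X b w).
have mV : measurable_fun setT V by exact: measurable_fun_pair.
pose V' : {mfun T >-> (p.-tuple R * p.-tuple R)%type} := mfun_Sub (mem_set mV).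
pose F := (sph `*` setT) `&` ((fun z : p.-tuple R * p.-tuple R => dotp z.1 z.2) @^-1` A).
have mF : measurable F.
  apply: measurableI; first by apply: measurableX => //; exact: measurable_sph.
  by rewrite -[X in measurable X]setTI; exact: mdot.
have EF : V' @^-1` F = dot_event (a, b) `&` X a @^-1` sph.
  by apply/seteqP; split=> w; rewrite /F /dot_event /=; tauto.
have := @dot_fubini _ _ V' fst F c.
rewrite EF => /(_ measurable_fst mF).
have mab := measurable_dot_event (a, b); have mac := measurable_dot_event (a, c).
rewrite setIAC [LHS](pr_full (measurableI _ _ mab mac) (msph a) (Xsph a)).
rewrite (pr_full mab (msph a) (Xsph a)).
apply; first by move=> v [[]].
move=> B C mB mC; apply: (@blocks_indep [set a; b] [set c]).
- by move=> i; rewrite !inE => /orP[] /eqP ->.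
- apply: (@events_preimage _ _ _ _ _ _ _ X _ _ _ B V) => //.
  by apply: measurable_fun_pair; apply: mXev; rewrite !inE eqxx ?orbT.
- by apply: events_preimage => //; apply: mXev; rewrite inE.
Qed.

(* [dotp] is symmetric, so conditioning on either vector gives the same value. *)
Lemma coord_event_eq a b : pr P (coord_event a) = pr P (coord_event b).
Proof.
have [->//|ab] := eqVneq a b.
by rewrite -(pr_dot_event ab) dot_eventC pr_dot_event// eq_sym.
Qed.

Definition ltpairs : seq ('I_n * 'I_n) := [seq k : 'I_n * 'I_n <- index_enum {: 'I_n * 'I_n} | (k.1 < k.2)%N].

Definition share (k j : 'I_n * 'I_n) := (j.1 \in [:: k.1; k.2]) || (j.2 \in [:: k.1; k.2]).

(** The common index is [k.1] or [k.2] and occupies one of two slots, the other slot being free: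
    four lists of length [n]. *)
Lemma count_share s k : uniq s -> (count (share k) s <= 4 * n)%N.
Proof.
move=> us; rewrite -size_filter.
pose r := [seq (k.1, x) | x <- ord_enum n] ++ [seq (k.2, x) | x <- ord_enum n] ++
  [seq (x, k.1) | x <- ord_enum n] ++ [seq (x, k.2) | x <- ord_enum n].
have -> : (4 * n = size r)%N by rewrite /r !size_cat !size_map -(size_map val) val_ord_enum size_iota; lia.
apply: uniq_leq_size; first exact: filter_uniq.
move=> [x y]; rewrite mem_filter /share /= => /andP[+ _]; rewrite !inE !mem_cat.
by move=> /orP[/orP[]|/orP[]] /eqP ->; rewrite map_f ?mem_ord_enum ?orbT.
Qed.

Lemma void_events (J : {set 'I_n}) s :
  (forall k, k \in s -> (k.1 \in J) && (k.2 \in J)) -> events X J (void dot_event s).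
Proof.
elim: s => [|k s ih] h; first exact: eventsT.
apply: eventsI; last by apply: ih => j js; apply: h; rewrite inE js orbT.
apply: eventsC; case: k h => a b h.
by have /andP[aJ bJ] := h (a, b) (mem_head _ _); exact: dot_event_events.
Qed.

Lemma void_dot_bound (i : 'I_n) (q := pr P (coord_event i)) :
  `|pr P (void dot_event ltpairs) - (1 - q) ^+ size ltpairs| <=
  2 * q ^+ 2 * (4 * n)%:R * (size ltpairs)%:R.
Proof.
have lt k : k \in ltpairs -> (k.1 < k.2)%N by rewrite mem_filter => /andP[].
have us : uniq ltpairs by rewrite filter_uniq// index_enum_uniq.
have mcoord : measurable (coord_event i).
  by rewrite -[X in measurable X]setTI; exact: mX.
have q01 : 0 <= q <= 1 by rewrite pr_ge0 pr_le1.
have qE a : pr P (coord_event a) = q by exact: coord_event_eq.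
apply: (@void_bound _ _ _ P _ dot_event measurable_dot_event share) => //.
- move=> [a b] /lt /= ab; rewrite pr_dot_event//.
  by rewrite neq_ltn ab.
(* The common index may sit in either slot of either pair; [dot_eventC] moves it to the first slot,
   and the ordering inside the pairs keeps the three indices distinct. *)
- have two a b c : a != b -> a != c -> b != c ->
      pr P (dot_event (a, b) `&` dot_event (a, c)) = q ^+ 2.
    by move=> ab ac bc; rewrite pr_dot_event2// !qE.
  move=> [a b] [c e] /lt /= ab /lt /= ce; rewrite xpair_eqE negb_and /share /= !inE.
  have nab : a != b by rewrite neq_ltn ab.
  have nce : c != e by rewrite neq_ltn ce.
  have [ac|nac] := eqVneq c a.
    by rewrite ac /= => be _; apply: two => //; rewrite -ac.
  have [bc|nbc] := eqVneq c b.
    move=> _ _; rewrite bc in nce ce *; rewrite (dot_eventC a); apply: two => //.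
      by rewrite eq_sym.
    by rewrite neq_ltn (ltn_trans ab).
  move=> /= _; rewrite (dot_eventC c).
  have [ea|nea] := eqVneq e a.
    by move=> _; rewrite ea; apply: two => //; rewrite ?[a == c]eq_sym// [b == c]eq_sym.
  move=> /= /eqP eb; rewrite (dot_eventC a) eb.
  by apply: two; rewrite ?[_ == a]eq_sym ?[_ == c]eq_sym// -?eb.
- move=> [a b] r kp rs.
  apply: (@blocks_indep [set a; b] (~: [set a; b])).
  + by move=> j; rewrite !inE negbK.
  + by apply: dot_event_events; rewrite !inE eqxx ?orbT.
  apply: void_events => -[c e]; rewrite mem_filter /share /= !inE negb_or.
  by move=> /andP[].
- by move=> k _; exact: count_share.
Qed.

Lemma voidE w : void dot_event ltpairs w <->
  (forall k : 'I_n * 'I_n, (k.1 < k.2)%N -> ~ A (dotp (X k.1 w) (X k.2 w))).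
Proof.
split=> [/voidP h k kk|h]; first by apply: h; rewrite mem_filter kk mem_index_enum.
by apply/voidP => k; rewrite mem_filter => /andP[kk _]; exact: h.
Qed.

End angle_events.

Lemma size_ltpairs n : size (@ltpairs n) = 'C(n, 2).
Proof.
rewrite size_filter -sum1_count /=.
rewrite (eq_bigl (fun k : 'I_n * 'I_n => true && (k.1 < k.2)%N))//.
rewrite -(pair_big_dep xpredT (fun i j : 'I_n => (i < j)%N) (fun=> fun=> 1%N))/=.
rewrite (exchange_big_dep xpredT) //= -bin2_sum big_mkord; apply: eq_bigr => j _.
by rewrite -(big_ord_widen _ (fun=> 1%N) (ltnW (ltn_ord j))) sum1_card card_ord.
Qed.

(** * Effect of a small shift of the angle on the sine *)

Section trigonometry.
Context {R : realType}.
Implicit Types (x y t m : R).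

Lemma sin_norm_le x : `|sin x| <= `|x|.
Proof.
wlog x0 : x / 0 <= x.
  move=> wl; have [/wl//|/ltW x0] := leP 0 x.
  by rewrite -normrN -sinN -(normrN x); apply: wl; rewrite oppr_ge0.
have [|c _] := @MVT_segment R sin cos 0 x x0 (fun z _ => is_derive_sin z).
  by apply: continuous_subspaceT; exact: continuous_sin.
rewrite sin0 !subr0 => ->.
by rewrite normrM ler_piMl// ler_norml cos_geN1 cos_le1.
Qed.

Lemma cos_ge_quadratic x : 1 - x ^+ 2 / 2 <= cos x.
Proof.
have -> : x = x / 2 + x / 2 by field.
rewrite cosD -!expr2; have := cos2Dsin2 (x / 2); have := sin_norm_le (x / 2).
rewrite -ler_sqr ?nnegrE// !real_normK ?num_real// => h1 h2.
by lra.
Qed.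

Lemma sin_sub_le x : `|x| <= 1 -> `|sin x - x| <= x ^+ 2.
Proof.
wlog x0 : x / 0 <= x.
  move=> wl; have [/wl//|/ltW x0 x1] := leP 0 x.
  have := wl (- x); rewrite oppr_ge0 normrN sqrrN sinN => /(_ x0 x1).
  by rewrite -normrN opprD !opprK.
move=> x1.
have D z : z \in `]0, x[ -> is_derive z 1 (fun z => sin z - z) (cos z - 1).
  by move=> _; apply: is_deriveB.
have [|c cx] := @MVT_segment R _ _ 0 x x0 D.
  apply: continuous_subspaceT => z.
  by apply: cvgB; [exact: continuous_sin|exact: cvg_id].
rewrite sin0 !subr0 => ->; move: cx; rewrite in_itv/= => /andP[c0 cx].
have := cos_ge_quadratic c; have := cos_le1 c; rewrite ger0_norm// in x1.
move=> h1 h2.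
rewrite normrM (ger0_norm x0) expr2 ler_wpM2r//.
rewrite ler0_norm ?subr_le0//.
have : c ^+ 2 <= c by rewrite expr2 ler_piMl//; exact: le_trans cx x1.
lra.
Qed.

Lemma ln_ge_quadratic x : 2^-1 <= x -> x - 1 - 2 * (x - 1) ^+ 2 <= ln x.
Proof.
move=> x2; have x0 : 0 < x by lra.
have : ln x^-1 <= x^-1 - 1.
  have := @le_ln1Dx _ (x^-1 - 1); rewrite subrKC; apply.
  by move: x0; rewrite -invr_gt0; lra.
rewrite lnV ?posrE// => h.
have : 1 - x^-1 = x - 1 - (x - 1) ^+ 2 * x^-1 by field; rewrite lt0r_neq0.
have : (x - 1) ^+ 2 * x^-1 <= (x - 1) ^+ 2 * 2.
  rewrite ler_wpM2l ?sqr_ge0//.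
  by rewrite -[leRHS]invrK lef_pV2 ?posrE ?invr_gt0.
lra.
Qed.

(* [theta = asin t], [phi = theta + delta] and
   [cot phi * sin delta <= ln (sin phi / sin theta) <= cot theta * sin delta]. *)
Lemma angle_shift t m y (r := m * (1 - t ^+ 2)) (e := `|y| / Num.sqrt r)
    (dl := t / (2 * m * Num.sqrt (1 - t ^+ 2)) * y) :
  0 < t < 1 -> 1 <= r -> e <= 4^-1 ->
  [/\ `|dl| <= e, 0 < asin t + dl < pi, 0 < sin (asin t + dl),
     `|cos (asin t + dl) / Num.sqrt (1 - t ^+ 2) - 1| <= e &
     `|m * ln (sin (asin t + dl) / t) - y / 2| <= 2 * e ^+ 2].
Proof.
move=> /andP[t0 t1] r1 e4.
pose c := Num.sqrt (1 - t ^+ 2).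
have t21 : 0 < 1 - t ^+ 2 by nra.
have t2p := sqr_ge0 t.
have c0 : 0 < c by rewrite sqrtr_gt0.
have c2 : c ^+ 2 = 1 - t ^+ 2 by rewrite sqr_sqrtr// ltW.
have m1 : 1 <= m.
  have : r <= m.
    rewrite /r; have : 0 <= m.
      rewrite leNgt; apply/negP => m0.
      have : m * (1 - t ^+ 2) < 0 by rewrite nmulr_rlt0.
      rewrite -/r; lra.
    by move=> m0; rewrite ler_piMr//; lra.
  lra.
have m0 : 0 < m by lra.
have r0 : 0 < r by lra.
pose s := Num.sqrt r; have s1 : 1 <= s by rewrite -sqrtr1 ler_sqrt//; lra.
have s0 : 0 < s by lra.
have [s0' m0' c0' r0'] : [/\ 0 <= s, 0 <= m, 0 <= c & 0 <= r] by split; exact: ltW.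
have t0' := ltW t0; have t1' := ltW t1.
have s2 : s ^+ 2 = r by rewrite sqr_sqrtr//.
have e0 : 0 <= e by rewrite divr_ge0// sqrtr_ge0.
have ye : `|y| = e * s by rewrite /e -/s divfK// lt0r_neq0.
have t_asin : sin (asin t) = t by rewrite asinK// in_itv/=; apply/andP; split; lra.
have c_asin : cos (asin t) = c by rewrite cos_asin//; apply/andP; split; lra.
have dle : 2 * m * c * dl = t * y.
  by rewrite /dl -/c; field; rewrite !lt0r_neq0.
clearbody dl; clearbody e.
have sm : s <= m * c.
  rewrite -ler_sqr ?nnegrE ?mulr_ge0// s2 exprMn c2 /r.
  by apply: ler_wpM2r; [exact: ltW|nra].
have ad : 2 * (m * c) * `|dl| = t * `|y|.
  have -> : t * `|y| = `|t * y| by rewrite normrM (gtr0_norm t0).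
  rewrite -dle normrM (gtr0_norm (_ : 0 < 2 * m * c)); first by ring.
  by rewrite !mulr_gt0//; lra.
have mc0 : 0 < m * c by rewrite mulr_gt0.
have mc0' := ltW mc0.
have dl0 := normr_ge0 dl.
have h1 : `|dl| <= e / 2.
  rewrite -(ler_pM2l mc0).
  have : t * `|y| <= e * s by rewrite ye ler_piMl ?mulr_ge0//.
  have : e * s <= e * (m * c) by rewrite ler_wpM2l.
  lra.
have dl1 : `|dl| <= 1 by lra.
have dl2 : dl ^+ 2 = `|dl| ^+ 2 by rewrite real_normK ?num_real.
have cd := cos_ge_quadratic dl; have cd1 := cos_le1 dl.
have sd := sin_norm_le dl; have sdd := sin_sub_le dl1.
have cy : m * (c / t) * dl = y / 2.
  have -> : m * (c / t) * dl = (2 * m * c * dl) / (2 * t) by field; rewrite lt0r_neq0.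
  by rewrite dle; field; rewrite lt0r_neq0.
have ct0 : 0 < c / t by rewrite divr_gt0.
have ctd : m * (c / t * `|dl|) = `|y| / 2.
  have -> : m * (c / t * `|dl|) = (2 * (m * c) * `|dl|) / (2 * t).
    by field; rewrite lt0r_neq0.
  by rewrite ad; field; rewrite lt0r_neq0.
have c1 : c <= 1 by rewrite -ler_sqr ?nnegrE//; lra.
have sm' : s <= m.
  by apply: le_trans sm _; rewrite ler_piMr//.
have ctd1 : c / t * `|dl| <= e / 2.
  rewrite -(ler_pM2l m0) ctd ye.
  have : e * s <= e * m by rewrite ler_wpM2l.
  lra.
have ctd0 : 0 <= c / t * `|dl| by apply: mulr_ge0 => //; exact: ltW.
(* The scale of [dl] is such that [m * (c / t) * dl = y / 2]. In [m * (rho - 1)] this is the main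
   term; the defects of [cos dl] and [sin dl], and the quadratic error in [ln rho], are all bounded
   by multiples of [e ^+ 2]. *)
pose rho := sin (asin t + dl) / t.
have rhoE : rho = cos dl + c / t * sin dl.
  by rewrite /rho sinD t_asin c_asin; field; rewrite lt0r_neq0.
have cts : `|c / t * sin dl| <= c / t * `|dl|.
  by rewrite normrM (gtr0_norm ct0) ler_pM2l.
have dd : dl ^+ 2 <= e / 2 * (e / 2) by rewrite dl2 expr2 ler_pM.
have rho2 : 2^-1 <= rho.
  rewrite rhoE; move: cts; rewrite ler_norml => /andP[cts _].
  have : e / 2 * (e / 2) <= 8^-1 * 8^-1 by apply: ler_pM; clear -e0 e4; lra.
  by clear -cts cd dd ctd1 e4; lra.
have sphi : 0 < sin (asin t + dl).
  have : 0 < rho * t by rewrite mulr_gt0//; clear -rho2; lra.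
  by rewrite /rho divfK// lt0r_neq0.
have t11 : -1 <= t <= 1 by apply/andP; split; clear -t0 t1; lra.
have := pi_ge2 R => pi2.
have as1 := asin_lepi2 t11; have as2 := asin_geNpi2 t11.
move: (h1); rewrite ler_norml => /andP[dlN dlP].
split => //.
- by clear -h1 e0; lra.
- apply/andP; split; last by clear -as1 pi2 dlP e4; lra.
  rewrite ltNge; apply/negP => ph0.
  have : 0 <= sin (- (asin t + dl)).
    by apply: sin_ge0_pi; apply/andP; split; clear -ph0 as2 pi2 dlN e4; lra.
  by rewrite sinN; clear -sphi; lra.
- rewrite -/c cosD t_asin c_asin.
  have -> : (c * cos dl - t * sin dl) / c - 1 = - ((1 - cos dl) + t / c * sin dl).
    by field; rewrite lt0r_neq0.
  rewrite normrN; apply: le_trans (ler_normD _ _) _.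
  have q1 : `|1 - cos dl| <= e / 2.
    rewrite ger0_norm; last by clear -cd1; lra.
    have : e / 2 * (e / 2) <= e / 2 * 1 by rewrite ler_wpM2l//; clear -e0 e4; lra.
    by clear -cd dd e0; lra.
  have q2 : `|t / c * sin dl| <= e / 2.
    have tc0 : 0 < t / c by rewrite divr_gt0.
    rewrite normrM (gtr0_norm tc0).
    apply: (@le_trans _ _ (t / c * `|dl|)); first by rewrite ler_pM2l.
    have -> : t / c * `|dl| = t * (2 * (m * c) * `|dl|) / (2 * (m * c ^+ 2)).
      by field; rewrite !lt0r_neq0.
    rewrite ad c2 -/r ye -s2.
    have -> : t * (t * (e * s)) / (2 * s ^+ 2) = (t ^+ 2 * s^-1) * (e / 2).
      by field; rewrite lt0r_neq0.
    rewrite ler_piMl//; first by clear -e0; lra.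
    by rewrite mulr_ile1 ?invr_ge0 ?sqr_ge0// ?invf_le1//; clear -t0 t1; nra.
  by clear -q1 q2; lra.
have yd : `|y| * `|dl| <= e ^+ 2 / 2.
  rewrite -(ler_pM2l mc0).
  have -> : m * c * (`|y| * `|dl|) = t * `|y| * `|y| / 2.
    by rewrite -ad; field.
  rewrite ye.
  have : s * s <= m * c by rewrite -expr2 s2 /r -c2 expr2 mulrA ler_piMr//.
  move=> smc.
  have : e ^+ 2 * (s * s) <= e ^+ 2 * (m * c) by rewrite ler_wpM2l// sqr_ge0.
  have : t * (e ^+ 2 * (s * s)) <= e ^+ 2 * (s * s).
    by rewrite ler_piMl ?mulr_ge0 ?sqr_ge0//.
  by move=> u1 u2; clear -u1 u2; lra.
have up : `|m * (c / t * sin dl) - y / 2| <= e ^+ 2 / 4.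
  have -> : m * (c / t * sin dl) - y / 2 = m * (c / t * (sin dl - dl)).
    by rewrite -cy; ring.
  rewrite 2!normrM (gtr0_norm m0) (gtr0_norm ct0).
  apply: (@le_trans _ _ (m * (c / t * `|dl|) * `|dl|)).
    have -> : m * (c / t * `|dl|) * `|dl| = m * (c / t * dl ^+ 2) by rewrite dl2; ring.
    by rewrite ler_pM2l// ler_pM2l.
  by rewrite ctd; clear -yd; lra.
have mdl : m * dl ^+ 2 <= e ^+ 2 / 4.
  have r4 : 0 < 4 * r by clear -r0; lra.
  rewrite dl2 -(ler_pM2l r4).
  have -> : 4 * r * (m * `|dl| ^+ 2) = (2 * (m * c) * `|dl|) ^+ 2.
    by rewrite /r -c2; ring.
  rewrite ad exprMn ye exprMn s2.
  have : t ^+ 2 * (e ^+ 2 * r) <= e ^+ 2 * r.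
    by rewrite ler_piMl ?mulr_ge0 ?sqr_ge0 //; clear -t0 t1; nra.
  by move=> u; clear -u; lra.
have mct : m * (c / t * `|dl|) ^+ 2 <= e ^+ 2 / 4.
  rewrite -(ler_pM2l m0).
  have -> : m * (m * (c / t * `|dl|) ^+ 2) = (m * (c / t * `|dl|)) ^+ 2 by ring.
  rewrite ctd ye.
  have : s * s <= m.
    by rewrite -expr2 s2 /r ler_piMr//; clear -t2p; lra.
  move=> smc.
  have : e ^+ 2 * (s * s) <= e ^+ 2 * m by rewrite ler_wpM2l// sqr_ge0.
  by move=> u; clear -u; lra.
have lnu : ln rho <= rho - 1.
  by have := @le_ln1Dx _ (rho - 1); rewrite subrKC; apply; clear -rho2; lra.
have lnl := ln_ge_quadratic rho2.
have sq : (rho - 1) ^+ 2 <= 2 * (dl ^+ 2 / 2) ^+ 2 + 2 * (c / t * `|dl|) ^+ 2.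
  have -> : rho - 1 = - (1 - cos dl) + c / t * sin dl by rewrite rhoE; ring.
  have a1 : (1 - cos dl) ^+ 2 <= (dl ^+ 2 / 2) ^+ 2.
    by apply: lerXn2r; rewrite ?nnegrE; [|exact: mulr_ge0 (sqr_ge0 _) _|]; clear -cd cd1; lra.
  have a2 : (c / t * sin dl) ^+ 2 <= (c / t * `|dl|) ^+ 2.
    by rewrite -(real_normK (num_real (c / t * sin dl))); apply: lerXn2r.
  by have := sqr_ge0 (1 - cos dl + c / t * sin dl); clear -a1 a2; lra.
have msq : m * (rho - 1) ^+ 2 <= m * (2 * (dl ^+ 2 / 2) ^+ 2 + 2 * (c / t * `|dl|) ^+ 2).
  by rewrite ler_pM2l.
have md4 : m * dl ^+ 2 * dl ^+ 2 <= e ^+ 2 / 4 * 1.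
  have : e / 2 * (e / 2) <= 1 * 1 by apply: ler_pM; clear -e0 e4; lra.
  move=> e1; apply: ler_pM => //; [|exact: sqr_ge0|by clear -dd e1; lra].
  by apply: mulr_ge0 => //; exact: sqr_ge0.
have m1' : m * ln rho <= m * (rho - 1) by rewrite ler_pM2l.
have m2' : m * (rho - 1 - 2 * (rho - 1) ^+ 2) <= m * ln rho by rewrite ler_pM2l.
have m3 : m * (rho - 1) = m * (cos dl - 1) + m * (c / t * sin dl) by rewrite rhoE; ring.
have m4 : m * (cos dl - 1) <= 0 by rewrite pmulr_rle0//; clear -cd1; lra.
have m5 : - (m * dl ^+ 2) / 2 <= m * (cos dl - 1).
  have : m * (- (dl ^+ 2 / 2)) <= m * (cos dl - 1) by rewrite ler_pM2l//; clear -cd; lra.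
  by move=> u; clear -u; lra.
have e20 : 0 <= e ^+ 2 by exact: sqr_ge0.
move: up; rewrite ler_norml => /andP[up1 up2].
rewrite -/rho ler_norml; clear -m1' m2' m3 m4 m5 msq md4 mct mdl up1 up2 e20.
by apply/andP; split; lra.
Qed.

End trigonometry.

(** * Poisson limit for the number of pairs *)

Section poisson_limit.
Context {R : realType}.

Lemma natr_cvgy : n%:R @[n --> \oo] --> (+oo : set_system R).
Proof. exact: cvgr_idn. Qed.

Lemma bin2R n : 2 * ('C(n, 2))%:R = n%:R * (n%:R - 1) :> R.
Proof.
case: n => [|n]; first by rewrite bin0n mulr0 mul0r.
have -> : n.+1%:R - 1 = n%:R :> R by rewrite -(natr1 n) addrK.
rewrite -!natrM; congr (_%:R).
by have := bin_ffact n.+1 2; rewrite ffactnS ffactn1 /= => <-; rewrite mulnC.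
Qed.

Lemma cvg_bin2V : (('C(n, 2))%:R : R)^-1 @[n --> \oo] --> 0.
Proof.
have N0 : \forall n \near \oo, (0 : R) < ('C(n, 2))%:R.
  by near=> n; rewrite ltr0n bin_gt0; near: n; exact: nbhs_infty_ge.
apply: (proj2 (gtr0_cvgV0 N0)).
apply: (ger_cvgy _ natr_cvgy); near=> n.
rewrite -(ler_pM2l (ltr0Sn R 1)) bin2R.
have n3 : (3 <= n%:R :> R) by rewrite ler_nat; near: n; exact: nbhs_infty_ge.
nra.
Unshelve. all: by end_near. Qed.

(** Both sides are [1 + x <= expR x]: at [x = - q] for the upper bound, and at [x = q / (1 - q)],
    where [1 + x = (1 - q)^-1], for the lower one. *)
Lemma one_sub_pow_bounds (q : R) N : 0 <= q -> q < 1 ->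
  expR (- (N%:R * q / (1 - q))) <= (1 - q) ^+ N <= expR (- (N%:R * q)).
Proof.
move=> q0 q1; have q1' : 0 < 1 - q by rewrite subr_gt0.
have q1'' := ltW q1'.
apply/andP; split.
  rewrite -mulrA -mulrN expRM_natl; apply: lerXn2r; rewrite ?nnegrE ?expR_ge0//.
  rewrite expRN invf_ple ?posrE ?expR_gt0//.
  apply: le_trans (expR_ge1Dx _).
  by rewrite le_eqVlt; apply/orP; left; apply/eqP; field; rewrite lt0r_neq0.
rewrite -mulrN expRM_natl; apply: lerXn2r; rewrite ?nnegrE ?expR_ge0//.
exact: expR_ge1Dx.
Qed.

(** With [u = C(n, 2) q], which converges, the allowed error is [8 u ^ 2 n / C(n, 2)], of order
    [1 / n]: the dependence between overlapping pairs disappears. *)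
Lemma poisson_limit (q v : nat -> R) (lam : R) :
  (\forall n \near \oo, 0 <= q n <= 1) ->
  ('C(n, 2))%:R * q n @[n --> \oo] --> lam ->
  (\forall n \near \oo, `|v n - (1 - q n) ^+ 'C(n, 2)| <=
    2 * q n ^+ 2 * (4 * n)%:R * ('C(n, 2))%:R) ->
  v n @[n --> \oo] --> expR (- lam).
Proof.
move=> q01 ulam vq; pose N n : R := ('C(n, 2))%:R; pose u n := N n * q n.
have q0 : q n @[n --> \oo] --> 0.
  rewrite -(mulr0 lam); apply: cvg_trans (cvgM ulam cvg_bin2V).
  apply: near_eq_cvg; near=> n; rewrite /= mulrAC mulfV ?mul1r//.
  by rewrite pnatr_eq0 -lt0n bin_gt0; near: n; exact: nbhs_infty_ge.
have qlt : \forall n \near \oo, q n < 1 by exact: (cvgr_lt 0 q0 1 ltr01).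
have pw : (1 - q n) ^+ 'C(n, 2) @[n --> \oo] --> expR (- lam).
  apply: (@squeeze_cvgr _ _ _ _ (fun n => expR (- (u n / (1 - q n)))) (fun n => expR (- u n))).
  - near=> n; apply: one_sub_pow_bounds; last by near: n.
    by have /andP[] : 0 <= q n <= 1 by near: n.
  - apply: continuous_cvg; first exact: continuous_expR.
    apply: cvgN; rewrite -[X in _ --> X]mulr1; apply: cvgM => //.
    rewrite -[X in _ --> X]invr1; apply: cvgV => //.
    by rewrite -[X in _ --> X]subr0; apply: cvgB => //; exact: cvg_cst.
  - by apply: continuous_cvg; [exact: continuous_expR|exact: cvgN].
have nN : n%:R / N n @[n --> \oo] --> 0.
  have : 2 * (n%:R : R)^-1 @[n --> \oo] --> 0.
    rewrite -[X in _ --> X](mulr0 2); apply: cvgM; first exact: cvg_cst.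
    apply: (proj2 (gtr0_cvgV0 _) natr_cvgy).
    by near=> n; rewrite ltr0n; near: n; exact: nbhs_infty_ge.
  (* After the index shift, [(n + 1) / C(n + 1, 2)] is exactly [2 / n]. *)
  rewrite -(cvg_shiftS (fun n => n%:R / N n)) => h.
  apply: cvg_trans h; apply: near_eq_cvg; near=> n.
  have n0 : n%:R != 0 :> R by rewrite pnatr_eq0 -lt0n; near: n; exact: nbhs_infty_ge.
  rewrite /=; have -> : N n.+1 = n.+1%:R * n%:R / 2.
    have e1 : n.+1%:R - 1 = n%:R :> R by rewrite -(natr1 n) addrK.
    by have := bin2R n.+1; rewrite -/(N _) e1 => <-; field.
  have n1 : n.+1%:R != 0 :> R by rewrite pnatr_eq0.
  by move: (n.+1%:R) n1 => k k0; field; rewrite k0 n0.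
have er : 8 * u n ^+ 2 * (n%:R / N n) @[n --> \oo] --> 0.
  rewrite -[X in _ --> X](mulr0 (8 * lam ^+ 2)); apply: cvgM => //.
  apply: cvgM; first exact: cvg_cst.
  by apply: (@cvg_comp _ _ _ u (fun z => z ^+ 2) _ (nbhs lam)) => //; exact: exprn_continuous.
have d0 : v n - (1 - q n) ^+ 'C(n, 2) @[n --> \oo] --> 0.
  apply/norm_cvg0P; apply: (squeeze_cvgr _ (cvg_cst 0) er); near=> n.
  rewrite normr_ge0 /=.
  have h : `|v n - (1 - q n) ^+ 'C(n, 2)| <= 2 * q n ^+ 2 * (4 * n)%:R * N n by near: n.
  apply: le_trans h _; rewrite le_eqVlt; apply/orP; left; apply/eqP.
  have N0 : N n != 0 by rewrite pnatr_eq0 -lt0n bin_gt0; near: n; exact: nbhs_infty_ge.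
  by rewrite /u natrM; field.
rewrite -[X in _ --> X]add0r; apply: cvg_trans (cvgD d0 pw).
by apply: near_eq_cvg; apply: nearW => n /=; rewrite subrK.
Unshelve. all: by end_near. Qed.

End poisson_limit.

(** * Asymptotics of the cap probability at the critical angle *)

Section tail_asymptotics.
Context {R : realType} (p : nat -> nat).
Hypothesis p_ge2 : forall n, (2 <= n)%N -> (2 <= p n)%N.
Hypothesis p_infty : p @ \oo --> \oo.
Variables (h : nat -> R) (Q : nat -> R -> R) (K : R).
Hypothesis K_gt0 : 0 < K.
Hypothesis h_bounds : forall n, (2 <= n)%N ->
  2 / 9 / Num.sqrt (p n)%:R <= h n <= (2 * Num.sqrt (p n)%:R)^-1.
Hypothesis Q_bounds : forall n c, (2 <= n)%N -> 0 < c < 1 ->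
  let H := h n * Num.sqrt (1 - c ^+ 2) ^+ (p n).-1 in
  c * Q n c <= H /\ c * H * ((p n)%:R + 1) <= ((p n)%:R * c ^+ 2 + 1) * Q n c.

Local Notation t := (tn R p).
Local Notation alpha := (alphan R p).
Let m n : R := (p n)%:R - 1.
Let r n : R := m n * (1 - t n ^+ 2).
Let cth n : R := Num.sqrt (1 - t n ^+ 2).

(* The factor [K * cth n / h n] compensates [h n / cos phi] in the tail
   [h n * sin phi ^+ (p n).-1 / cos phi]. *)
Definition kappa n : R := K * cth n / h n.

(** The angle at which the expected number of closer pairs tends to [K / 2 * expR (x / 2)]; being
    affine in [x] with slope [alpha n], it turns the rescaled extremes into thresholds on angles. *)
Definition level n x : R := asin (t n) + alpha n * (x + 2 * ln (kappa n)).

(** The parameter [e] of [angle_shift] for this level; the shift of the angle and the errors in its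
    sine and cosine are controlled by it. *)
Let gap x n : R := `|x + 2 * ln (kappa n)| / Num.sqrt (r n).

Let m_ge1 n : (2 <= n)%N -> 1 <= m n.
Proof.
move=> n2; have : 2%:R <= (p n)%:R :> R by rewrite ler_nat p_ge2.
by rewrite /m; lra.
Qed.

Let t01 n : (2 <= n)%N -> 0 < t n < 1.
Proof.
move=> n2; rewrite /tn expR_gt0/= expR_lt1 oppr_lt0.
rewrite divr_gt0 ?mulr_gt0 ?ln_gt0 ?ltr1n//.
by have := m_ge1 n2; rewrite /m; lra.
Qed.

Let m_infty : m n @[n --> \oo] --> +oo.
Proof.
apply/cvgryPge => A.
have h1 : \forall k \near \oo, A + 1 <= k%:R :> R by exact: nbhs_infty_ger.
have {}h1 := p_infty h1; near=> n.
by have : A + 1 <= (p n)%:R by [near: n]; rewrite /m; lra.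
Unshelve. all: by end_near. Qed.

Let L_infty : ln (n%:R : R) @[n --> \oo] --> +oo.
Proof.
apply/cvgryPge => A; near=> n.
rewrite -(expRK A) ler_ln ?posrE ?expR_gt0//; first last.
  by rewrite ltr0n; near: n; exact: nbhs_infty_ge.
by near: n; exact: nbhs_infty_ger.
Unshelve. all: by end_near. Qed.

(** With [L = ln n], [t ^ 2 = exp (- 4 L / m)], and [1 - exp (- s) >= s / (1 + s)] gives
    [r >= 4 L m / (m + 4 L)]. This is at least half the smaller of [m] and [4 L], and both tend to
    infinity, at whatever relative speed. *)
Let r_infty : r n @[n --> \oo] --> +oo.
Proof.
apply/cvgryPge => A; near=> n.
have n2 : (2 <= n)%N by near: n; exact: nbhs_infty_ge.
have m1 := m_ge1 n2.
have LA : `|A| <= ln n%:R by near: n; move/cvgryPge : L_infty; apply.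
have mA : 2 * `|A| <= m n by near: n; move/cvgryPge : m_infty; apply.
set L : R := ln n%:R in LA; have L0 : 0 < L by rewrite ln_gt0// ltr1n.
pose s := 4 * L / m n; have s0 : 0 < s by rewrite divr_gt0 ?mulr_gt0//; lra.
have ts : t n ^+ 2 = expR (- s).
  by rewrite /tn -expRM_natl -/(m n) -/L /s; congr expR; field; rewrite lt0r_neq0//; lra.
have e1 : expR (- s) <= (1 + s)^-1.
  by rewrite expRN lef_pV2 ?posrE ?expR_gt0 ?expR_ge1Dx//; lra.
have s1 : 1 + s != 0 by rewrite lt0r_neq0//; lra.
have m0 : m n != 0 by rewrite lt0r_neq0//; lra.
have e2 : m n * (1 - (1 + s)^-1) <= r n.
  by rewrite /r ts ler_wpM2l; lra.
apply: le_trans e2; have D0 : 0 < m n + 4 * L by lra.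
have -> : m n * (1 - (1 + s)^-1) = 4 * L * m n / (m n + 4 * L).
  by rewrite /s; field; rewrite m0 (lt0r_neq0 D0).
rewrite ler_pdivlMr//; have := ler_norm A; have := normr_ge0 A => A0 A1.
have a1 : A * (m n + 4 * L) <= `|A| * (m n + 4 * L) by rewrite ler_wpM2r//; lra.
have a2 : `|A| * m n <= L * m n by rewrite ler_wpM2r//; lra.
have a3 : 2 * `|A| * L <= m n * L by rewrite ler_wpM2r//; lra.
have a4 : 0 <= L * m n by rewrite mulr_ge0//; lra.
lra.
Unshelve. all: by end_near. Qed.

Let h_gt0 n : (2 <= n)%N -> 0 < h n.
Proof.
move=> n2; have /andP[+ _] := h_bounds n2; apply: lt_le_trans.
by rewrite !divr_gt0// sqrtr_gt0 ltr0n (leq_trans _ (p_ge2 n2)).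
Qed.

(** Since [m <= p <= 4 m], the product [h * sqrt m] lies between [1 / 9] and [1 / 2]; dividing
    [K * cth] by [h] therefore gives the order of [sqrt m * cth = sqrt r]. *)
Let kappa_bounds n : (2 <= n)%N ->
  2 * K * Num.sqrt (r n) <= kappa n <= 9 * K * Num.sqrt (r n).
Proof.
move=> n2; have m1 := m_ge1 n2; have /andP[t0 t1] := t01 n2.
have h0 := h_gt0 n2; have /andP[h1 h2] := h_bounds n2.
have p0 : 0 < (p n)%:R :> R by rewrite /m in m1; lra.
have m0 : 0 <= m n by lra.
have rE : Num.sqrt (r n) = Num.sqrt (m n) * cth n by rewrite /r sqrtrM.
have c0 : 0 <= K * cth n by rewrite mulr_ge0 ?sqrtr_ge0// ltW.
set s := Num.sqrt (p n)%:R in h1 h2; have s0 : 0 < s by rewrite sqrtr_gt0.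
have s2 : s ^+ 2 = (p n)%:R by rewrite sqr_sqrtr// ltW.
have q2 : Num.sqrt (m n) ^+ 2 = m n by rewrite sqr_sqrtr.
have q0 : 0 <= Num.sqrt (m n) by exact: sqrtr_ge0.
have ms : Num.sqrt (m n) <= s by rewrite ler_sqrt ?ltW// /m; lra.
have sm : s <= 2 * Num.sqrt (m n).
  have s0' := ltW s0; rewrite -ler_sqr ?nnegrE ?mulr_ge0// s2 exprMn q2.
  by rewrite /m in m1 *; lra.
rewrite rE /kappa; apply/andP; split.
  rewrite ler_pdivlMr//.
  have h3 : h n * Num.sqrt (m n) <= 2^-1.
    apply: (@le_trans _ _ ((2 * s)^-1 * s)); first by apply: ler_pM => //; exact: ltW.
    by rewrite le_eqVlt; apply/orP; left; apply/eqP; field; rewrite lt0r_neq0.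
  have : (K * cth n) * (h n * Num.sqrt (m n)) <= (K * cth n) * 2^-1 by rewrite ler_wpM2l.
  lra.
rewrite ler_pdivrMr//.
have h3 : 9^-1 <= h n * Num.sqrt (m n).
  apply: (@le_trans _ _ (2 / 9 / s * Num.sqrt (m n))); last by rewrite ler_wpM2r.
  by rewrite mulrAC ler_pdivlMr//; lra.
have : (K * cth n) * 9^-1 <= (K * cth n) * (h n * Num.sqrt (m n)) by rewrite ler_wpM2l.
lra.
Qed.

(** The numerator grows at most like [ln r] against [sqrt r]. Concretely, [ln s <= 2 sqrt s] for
    [s = sqrt r] bounds the quotient by [D / r ^ (1 / 4)], which explains the fourth power below. *)
Let gap_cvg0 x : gap x n @[n --> \oo] --> 0.
Proof.
pose D := `|x| + 2 * (`|ln (2 * K)| + `|ln (9 * K)|) + 4.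
apply/cvgr0Pnorm_le => e e0; near=> n.
have n2 : (2 <= n)%N by near: n; exact: nbhs_infty_ge.
have r1 : 1 <= r n by near: n; move/cvgryPge : r_infty; apply.
have re : (D / e) ^+ 4 <= r n by near: n; move/cvgryPge : r_infty; apply.
have r0 : 0 < r n by lra.
pose s := Num.sqrt (r n); have s0 : 0 < s by rewrite sqrtr_gt0.
pose z := Num.sqrt s; have z0 : 0 < z by rewrite sqrtr_gt0.
have s2 : s ^+ 2 = r n by rewrite sqr_sqrtr// ltW.
have z2 : z ^+ 2 = s by rewrite sqr_sqrtr// ltW.
have s1 : 1 <= s by rewrite -sqrtr1 ler_sqrt// ltW.
have z1 : 1 <= z by rewrite -sqrtr1 ler_sqrt// ltW.
have D0 : 0 < D by rewrite /D; have := normr_ge0 x; have := normr_ge0 (ln (2 * K));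
  have := normr_ge0 (ln (9 * K)); lra.
have zD : D / e <= z.
  have [z0' D0' e0'] : [/\ 0 <= z, 0 <= D & 0 <= e] by split; exact: ltW.
  rewrite -(@ler_pXn2r _ 4)// ?nnegrE ?divr_ge0//.
  by rewrite (exprM z 2 2) z2 s2.
have lz : ln s <= 2 * z.
  by rewrite -z2 lnXn// -[ln z *+ 2]mulr_natl ler_pM2l//; exact/ltW/ln_sublinear.
have lz0 : 0 <= ln s by exact: ln_ge0.
have /andP[k1 k2] := kappa_bounds n2.
have K2 : 0 < 2 * K by rewrite mulr_gt0.
have K9 : 0 < 9 * K by rewrite mulr_gt0.
have k0 : 0 < kappa n by apply: lt_le_trans k1; rewrite mulr_gt0.
have l1 : ln (2 * K) + ln s <= ln (kappa n).
  by rewrite -lnM ?posrE// ler_ln ?posrE// mulr_gt0.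
have l2 : ln (kappa n) <= ln (9 * K) + ln s.
  by rewrite -lnM ?posrE// ler_ln ?posrE// mulr_gt0.
have lk : `|x + 2 * ln (kappa n)| <= D * z.
  apply: (@le_trans _ _ ((D - 4) * 1 + 4 * z)); last first.
    have : (D - 4) * 1 <= (D - 4) * z by rewrite ler_wpM2l// /D; have := normr_ge0 x;
      have := normr_ge0 (ln (2 * K)); have := normr_ge0 (ln (9 * K)); lra.
    lra.
  have := ler_norm x; have := ler_norm (- x); have := ler_norm (ln (9 * K)).
  have := ler_norm (- ln (2 * K)); have := normr_ge0 (ln (2 * K)).
  have := normr_ge0 (ln (9 * K)); rewrite !normrN => *.
  by rewrite ler_norml /D; apply/andP; split; lra.
rewrite ger0_norm ?divr_ge0 ?sqrtr_ge0// /gap -/s.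
rewrite ler_pdivrMr// -z2 expr2 mulrA; apply: le_trans lk _.
by rewrite ler_pM2r// mulrC -ler_pdivrMr.
Unshelve. all: by end_near. Qed.

Let level_facts x : \forall n \near \oo,
  [/\ (2 <= n)%N, 1 <= r n & gap x n <= 4^-1] /\
  [/\ `|level n x - asin (t n)| <= gap x n, 0 < level n x < pi, 0 < sin (level n x),
     `|cos (level n x) / cth n - 1| <= gap x n &
     `|m n * ln (sin (level n x) / t n) - (x + 2 * ln (kappa n)) / 2| <= 2 * gap x n ^+ 2].
Proof.
near=> n.
have n2 : (2 <= n)%N by near: n; exact: nbhs_infty_ge.
have r1 : 1 <= r n by near: n; move/cvgryPge : r_infty; apply.
have g4 : gap x n <= 4^-1 by near: n; apply: (cvgr_le 0 (gap_cvg0 x)).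
split => //.
have [a1 a2 a3 a4 a5] := angle_shift (t01 n2) r1 g4.
split; [|exact: a2|exact: a3|exact: a4|exact: a5].
by rewrite /level addrC addKr; exact: a1.
Unshelve. all: by end_near. Qed.

Lemma level_cvg x : level n x - asin (t n) @[n --> \oo] --> 0.
Proof.
apply/norm_cvg0P; apply: (squeeze_cvgr _ (cvg_cst 0) (gap_cvg0 x)).
by apply: filterS (level_facts x) => n [_ [h1 _ _ _ _]]; rewrite normr_ge0.
Qed.

Lemma alphan_gt0 : \forall n \near \oo, 0 < alpha n.
Proof.
near=> n; have n2 : (2 <= n)%N by near: n; exact: nbhs_infty_ge.
have m1 := m_ge1 n2; have /andP[t0 t1] := t01 n2.
rewrite /alphan -/(m n) divr_gt0// mulr_gt0//; first lra.
by rewrite sqrtr_gt0; nra.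
Unshelve. all: by end_near. Qed.

Lemma level_range x : \forall n \near \oo,
  0 < level n x < pi /\ 0 < cos (level n x) < 1.
Proof.
apply: filterS (level_facts x) => n [[n2 r1 g4] [h1 h2 h3 h4 h5]].
split=> //; have /andP[t0 t1] := t01 n2.
have c0 : 0 < cth n by rewrite sqrtr_gt0; nra.
have : 0 < cos (level n x) / cth n by move: h4; rewrite ler_norml => /andP[]; lra.
rewrite pmulr_lgt0 ?invr_gt0// => ->/=.
by have := cos2Dsin2 (level n x); nra.
Qed.

Let nu n : R := ('C(n, 2))%:R / n%:R ^+ 2.

Let nu_cvg : nu n @[n --> \oo] --> (2^-1 : R).
Proof.
have : (1 - n%:R^-1) / 2 @[n --> \oo] --> ((1 - 0) / 2 : R).
  apply: cvgM; last exact: cvg_cst.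
  apply: cvgB; first exact: cvg_cst.
  apply: (proj2 (gtr0_cvgV0 _) natr_cvgy).
  by near=> n; rewrite ltr0n; near: n; exact: nbhs_infty_ge.
rewrite subr0 mul1r => c; apply: cvg_trans c; apply: near_eq_cvg; near=> n.
have n0 : n%:R != 0 :> R by rewrite pnatr_eq0 -lt0n; near: n; exact: nbhs_infty_ge.
rewrite /= /nu; have -> : ('C(n, 2))%:R = n%:R * (n%:R - 1) / 2 :> R.
  by rewrite -bin2R; field.
by field.
Unshelve. all: by end_near. Qed.

(** The definition of [tn] makes [t ^ (p - 1)] exactly [n ^ -2], which compensates the number of
    pairs up to [nu]. The remaining power [(sin phi / t) ^ (p - 1)] is [kappa * expR (x / 2)] up to
    [expR eta], and [kappa] cancels [h]. *)
Let tail_main n x : (2 <= n)%N -> 0 < sin (level n x) ->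
  `|m n * ln (sin (level n x) / t n) - (x + 2 * ln (kappa n)) / 2| <= 2 * gap x n ^+ 2 ->
  exists eta, `|eta| <= 2 * gap x n ^+ 2 /\
  ('C(n, 2))%:R * (h n * sin (level n x) ^+ (p n).-1) = nu n * (K * cth n) * expR (x / 2) * expR eta.
Proof.
move=> n2 s0 he; have m1 := m_ge1 n2; have /andP[t0 t1] := t01 n2.
have h0 := h_gt0 n2; have n0 : 0 < n%:R :> R by rewrite ltr0n ltnW.
have km : (p n).-1%:R = m n.
  by rewrite /m -subn1 natrB// (leq_trans _ (p_ge2 n2)).
have mn0 : m n != 0 by rewrite lt0r_neq0//; lra.
have tk : t n ^+ (p n).-1 = (n%:R ^+ 2)^-1.
  rewrite /tn -expRM_natl km -/(m n).
  rewrite (_ : m n * - (2 * ln n%:R / m n) = - (2%:R * ln n%:R)); last by field.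
  by rewrite expRN expRM_natl lnK ?posrE.
set rho := sin (level n x) / t n.
have rho0 : 0 < rho by rewrite divr_gt0.
have sE : sin (level n x) = t n * rho by rewrite /rho mulrC divfK// lt0r_neq0.
have k0 : 0 < kappa n.
  by rewrite divr_gt0 ?mulr_gt0// sqrtr_gt0; nra.
pose eta := m n * ln rho - (x + 2 * ln (kappa n)) / 2; exists eta; split=> //.
have lnr : m n * ln rho = x / 2 + ln (kappa n) + eta by rewrite /eta; field.
clearbody eta.
rewrite sE exprMn tk -{1}(lnK (rho0 : rho \in Num.pos)) -expRM_natl km.
rewrite lnr 2!expRD lnK ?posrE// /kappa /nu.
by field; rewrite !lt0r_neq0.
Qed.

Lemma tail_cvg x : ('C(n, 2))%:R * Q n (cos (level n x)) @[n --> \oo] -->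
  K / 2 * expR (x / 2).
Proof.
pose g := gap x; pose A n := nu n * K * expR (x / 2).
have cA : A n @[n --> \oo] --> K / 2 * expR (x / 2).
  have -> : K / 2 * expR (x / 2) = 2^-1 * K * expR (x / 2) by ring.
  by apply: cvgM; [apply: cvgM => //; exact: cvg_cst|exact: cvg_cst].
have g0 : g n @[n --> \oo] --> 0 by exact: gap_cvg0.
have cg2 (a : R) : expR (a * g n ^+ 2) @[n --> \oo] --> (1 : R).
  rewrite -expR0 -[X in expR X](mulr0 a); apply: continuous_cvg; first exact: continuous_expR.
  apply: cvgM; first exact: cvg_cst.
  rewrite -[X in _ --> X](expr0n R 2).
  by apply: (@cvg_comp _ _ _ g (fun z => z ^+ 2) _ (nbhs 0)) => //; exact: exprn_continuous.
have cr : 1 - 4 * (r n)^-1 @[n --> \oo] --> (1 : R).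
  rewrite -[X in _ --> X]subr0 -[X in _ - X](mulr0 4).
  apply: cvgB; first exact: cvg_cst.
  apply: cvgM; first exact: cvg_cst.
  apply: (proj2 (gtr0_cvgV0 _) r_infty).
  by move/cvgryPgt : r_infty; apply.
apply: (@squeeze_cvgr _ _ _ _
  (fun n => A n * expR (- 2 * g n ^+ 2) / (1 + g n) * (1 - 4 * (r n)^-1))
  (fun n => A n * expR (2 * g n ^+ 2) / (1 - g n))).
- near=> n.
  have [[n2 r1 g4] [_ _ s0 hc he0]] : [/\ (2 <= n)%N, 1 <= r n & gap x n <= 4^-1] /\
    [/\ `|level n x - asin (t n)| <= gap x n, 0 < level n x < pi, 0 < sin (level n x),
     `|cos (level n x) / cth n - 1| <= gap x n &
     `|m n * ln (sin (level n x) / t n) - (x + 2 * ln (kappa n)) / 2| <= 2 * gap x n ^+ 2].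
    by near: n; exact: level_facts.
  have [_ c01] : 0 < level n x < pi /\ 0 < cos (level n x) < 1.
    by near: n; exact: level_range.
  have r4 : 4 <= r n by near: n; move/cvgryPge : r_infty; apply.
  have [eta [he NH]] := tail_main n2 s0 he0.
  have := Q_bounds n2 c01; have /andP[c0 c1] := c01.
  have -> : Num.sqrt (1 - cos (level n x) ^+ 2) = sin (level n x).
    by rewrite -sin2cos2 sqrtr_sqr gtr0_norm.
  rewrite -/(g n) in he hc g4; move: NH he hc.
  set H := h n * _; set N : R := ('C(n, 2))%:R; set c := cos (level n x) in c0 c1 c01 *.
  set q := Q n c => NH he hc [q1 q2].
  have /andP[t0 t1] := t01 n2.
  have ct0 : 0 < cth n by rewrite sqrtr_gt0; nra.
  have ct2 : cth n ^+ 2 = 1 - t n ^+ 2 by rewrite sqr_sqrtr//; nra.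
  have N0 : 0 <= N by rewrite /N.
  have gn0 : 0 <= g n by rewrite divr_ge0 ?sqrtr_ge0.
  have A0 : 0 <= A n.
    by rewrite /A !mulr_ge0 ?expR_ge0 ?(ltW K_gt0)// /nu divr_ge0 ?sqr_ge0.
  pose w := c / cth n; have w0 : 0 < w by rewrite divr_gt0.
  have [w1 w2] : 1 - g n <= w /\ w <= 1 + g n.
    by move: hc; rewrite -/w ler_norml => /andP[]; split; lra.
  have NHc : N * H / c = A n * expR eta / w.
    by rewrite NH /A /w; field; rewrite !lt0r_neq0.
  move: he; rewrite ler_norml => /andP[he1 he2].
  have Eu : expR eta <= expR (2 * g n ^+ 2) by rewrite ler_expR.
  have El : expR (- 2 * g n ^+ 2) <= expR eta by rewrite ler_expR; lra.
  have up : N * q <= N * H / c.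
    by rewrite ler_pdivlMr// -mulrA ler_wpM2l// mulrC.
  (* The lower bound loses the factor [c ^ 2 (p + 1) / (p c ^ 2 + 1) = 1 - (1 - c ^ 2) / (p c ^ 2 +
     1)]; as [c] is close to [cth], [p c ^ 2 >= r / 4], so the loss is at most [4 / r]. *)
  have lo : N * H / c * (1 - 4 * (r n)^-1) <= N * q.
    have pr : r n / 4 <= (p n)%:R * c ^+ 2.
      have cw : c = w * cth n by rewrite /w divfK// lt0r_neq0.
      rewrite cw exprMn ct2 mulrCA; apply: (@le_trans _ _ (w ^+ 2 * r n)).
        have : 4^-1 <= w ^+ 2 by nra.
        move=> w4; have : 4^-1 * r n <= w ^+ 2 * r n by rewrite ler_wpM2r//; lra.
        lra.
      apply: ler_wpM2l; first exact: sqr_ge0.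
      by rewrite /r; apply: ler_wpM2r; [nra|rewrite /m; lra].
    have D0 : 0 < (p n)%:R * c ^+ 2 + 1 by lra.
    have q3 : c * H * ((p n)%:R + 1) / ((p n)%:R * c ^+ 2 + 1) <= q by rewrite ler_pdivrMr// [leRHS]mulrC.
    have H0 : 0 <= H by rewrite mulr_ge0 ?exprn_ge0//; apply: ltW => //; exact: h_gt0.
    apply: (@le_trans _ _ (N * (c * H * ((p n)%:R + 1) / ((p n)%:R * c ^+ 2 + 1)))); last first.
      by rewrite ler_wpM2l.
    have -> : N * (c * H * ((p n)%:R + 1) / ((p n)%:R * c ^+ 2 + 1)) =
       N * H / c * (c ^+ 2 * ((p n)%:R + 1) / ((p n)%:R * c ^+ 2 + 1)).
      by field; rewrite !lt0r_neq0.
    apply: ler_wpM2l; first by apply: divr_ge0; [exact: mulr_ge0|exact: ltW].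
    rewrite ler_pdivlMr//.
    have r0 : 0 < r n by lra.
    have : 1 <= 4 * (r n)^-1 * ((p n)%:R * c ^+ 2 + 1).
      have : 4 * (r n)^-1 * (r n / 4) <= 4 * (r n)^-1 * ((p n)%:R * c ^+ 2 + 1).
        by rewrite ler_wpM2l ?mulr_ge0 ?invr_ge0//; lra.
      by rewrite (_ : 4 * (r n)^-1 * (r n / 4) = 1)//; field; rewrite lt0r_neq0.
    by have := sqr_ge0 c; lra.
  apply/andP; split.
    apply: le_trans lo; rewrite NHc ler_wpM2r//.
      by rewrite subr_ge0 ler_pdivrMr//; lra.
    apply: ler_pM; [exact: mulr_ge0 A0 (expR_ge0 _)|rewrite invr_ge0; lra| |].
      by rewrite ler_wpM2l.
    by rewrite lef_pV2 ?posrE//; lra.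
  apply: le_trans up _; rewrite NHc.
  apply: ler_pM; [exact: mulr_ge0 A0 (expR_ge0 _)|rewrite invr_ge0; lra| |].
    by rewrite ler_wpM2l.
  by rewrite lef_pV2 ?posrE//; lra.
- rewrite -[X in _ --> X]mulr1; apply: cvgM => //.
  rewrite -[X in _ --> X]mulr1; apply: cvgM.
    by rewrite -[X in _ --> X]mulr1; apply: cvgM.
  rewrite -[X in _ --> X]invr1; apply: cvgV => //.
  by rewrite -[X in _ --> X]addr0; apply: cvgD => //; exact: cvg_cst.
- rewrite -[X in _ --> X]mulr1; apply: cvgM.
    by rewrite -[X in _ --> X]mulr1; apply: cvgM.
  rewrite -[X in _ --> X]invr1; apply: cvgV => //.
  by rewrite -[X in _ --> X]subr0; apply: cvgB => //; exact: cvg_cst.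
Unshelve. all: by end_near. Qed.

End tail_asymptotics.

(** * Measurability and order properties of the arccosine *)

Section arccos.
Context {R : realType}.
Implicit Types (u phi : R).

Lemma measurable_acos : measurable_fun setT (@acos R).
Proof.
have -> : setT = `[-1, 1] `|` ~` `[-1, 1] :> set R by rewrite setUv.
apply/measurable_funU; [exact: measurable_itv|by apply: measurableC; exact: measurable_itv|].
split.
  apply: (@measurable_fun_itv_cc _ _ _ false true).
  apply: open_continuous_measurable_fun; first exact: interval_open.
  by move=> x; rewrite inE/= in_itv/= => xI; exact: continuous_acos.
(* Outside [[-1, 1]] no angle has the prescribed cosine, and [acos] takes its default value there, a
   constant. *)
apply: (@eq_measurable_fun _ _ _ _ _ (fun=> point)); last exact: measurable_cst.
move=> x; rewrite inE /= in_itv/= => xI; rewrite unlock.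
case: xgetP => // y _ [_ yx]; case: xI.
by rewrite -yx cos_geN1 cos_le1.
Qed.

Lemma lt_acos phi u : 0 < phi < pi -> -1 <= u <= 1 -> (phi < acos u) = (u < cos phi).
Proof.
move=> /andP[p0 ppi] u1; have [/andP[a0 a1] e] := acos_def u1.
by rewrite -{2}e ltr_cos// in_itv/=; apply/andP; split => //; exact: ltW.
Qed.

Lemma acos_lt_sub phi u : 0 < phi < pi -> -1 <= u <= 1 ->
  (acos u < pi - phi) = (- cos phi < u).
Proof.
move=> /andP[p0 ppi] u1; have [/andP[a0 a1] e] := acos_def u1.
have -> : - cos phi = cos (pi - phi).
  by rewrite cosB cospi sinpi; ring.
by rewrite -{2}e ltr_cos// in_itv/=; apply/andP; split => //; lra.
Qed.

End arccos.

(** * Extremal angles as void events *)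

Section extremal_angles.
Context {R : realType} {d} {T : measurableType d} (P : probability T R).
Context {n p : nat} (X : 'I_n -> {RV P >-> p.-tuple R}).
Hypothesis X_indep : mutually_independent X.
Hypothesis X_unif : forall i, uniform_on_sphere (distribution P (X i)).
Implicit Types (phi : R) (A : set R).

Let mX i : measurable_fun setT (X i). Proof. exact: measurable_funPT. Qed.

Let mangle (k : 'I_n * 'I_n) : measurable_fun setT (fun w => angle (X k.1 w) (X k.2 w)).
Proof.
apply: (measurableT_comp measurable_acos).
exact: measurable_dotp.
Qed.

Lemma measurable_angle_min : measurable_fun setT (fun w => angle_min (fun i => X i w)).
Proof.
rewrite /angle_min; elim: (index_enum _) => [|k r ih].
  by under eq_fun do rewrite big_nil; exact: measurable_cst.
under eq_fun do rewrite big_cons.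
by case: (k.1 < k.2)%N => //; exact: measurable_minr.
Qed.

Lemma measurable_angle_max : measurable_fun setT (fun w => angle_max (fun i => X i w)).
Proof.
rewrite /angle_max; elim: (index_enum _) => [|k r ih].
  by under eq_fun do rewrite big_nil; exact: measurable_cst.
under eq_fun do rewrite big_cons.
by case: (k.1 < k.2)%N => //; exact: measurable_maxr.
Qed.

(** On this almost sure event every dot product lies in [[-1, 1]], where [acos] inverts [cos] and
    bounds on angles become bounds on dot products. *)
Definition on_sphere : set T := \bigcap_(i in [set: 'I_n]) X i @^-1` sph.

Let msph i : measurable (X i @^-1` sph).
Proof. by rewrite -[X in measurable X]setTI; apply: mX => //; exact: measurable_sph. Qed.

Lemma measurable_on_sphere : measurable on_sphere.
Proof. by apply: fin_bigcap_measurable. Qed.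

Lemma pr_on_sphere : pr P on_sphere = 1.
Proof.
rewrite /pr /on_sphere; have -> : [set: 'I_n] = [set` [set: 'I_n]%SET].
  by apply/seteqP; split=> i //=; rewrite inE.
rewrite X_indep; last by move=> _; exact: measurable_sph.
rewrite big1// => i _; have [h _] := X_unif i; exact: h.
Qed.

(* Almost surely, the event on the left forbids exactly the dot products of [A]. *)
Lemma pr_void_dot A E : measurable A -> measurable E ->
  (forall w, on_sphere w ->
    E w <-> (forall k : 'I_n * 'I_n, (k.1 < k.2)%N -> ~ A (dotp (X k.1 w) (X k.2 w)))) ->
  pr P E = pr P (void (dot_event X A) (@ltpairs n)).
Proof.
move=> mA mE h.
have mv := measurable_void (measurable_dot_event X mA) (@ltpairs n).
have mS := measurable_on_sphere.
rewrite -(pr_full mE mS pr_on_sphere) -(pr_full mv mS pr_on_sphere).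
congr (pr P _); apply/seteqP; split=> w [Ew Sw]; split => //.
  exact: (proj2 (@voidE _ _ _ P _ _ X A w) (proj1 (h w Sw) Ew)).
exact: (proj2 (h w Sw) (proj1 (@voidE _ _ _ P _ _ X A w) Ew)).
Qed.

Lemma angle_min_gt w phi : on_sphere w -> 0 < phi < pi ->
  phi < angle_min (fun i => X i w) <->
  (forall k : 'I_n * 'I_n, (k.1 < k.2)%N -> ~ `[cos phi, +oo[%classic (dotp (X k.1 w) (X k.2 w))).
Proof.
move=> Sw phi0; have Sk i : sph (X i w) by exact: Sw.
have D k : (phi < angle (X k.1 w) (X k.2 w)) <->
    ~ `[cos phi, +oo[%classic (dotp (X k.1 w) (X k.2 w)).
  rewrite /angle lt_acos ?dotp_sph_le1//= in_itv/= andbT.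
  by rewrite ltNge; split=> /negP.
split=> [/bigmin_gtP[_ h] k /h /D//|h]; apply/bigmin_gtP; split.
  by case/andP: phi0.
by move=> k kk; apply/D; exact: h.
Qed.

Lemma angle_max_lt w phi : on_sphere w -> 0 < phi < pi ->
  angle_max (fun i => X i w) < pi - phi <->
  (forall k : 'I_n * 'I_n, (k.1 < k.2)%N -> ~ `]-oo, (- cos phi)]%classic (dotp (X k.1 w) (X k.2 w))).
Proof.
move=> Sw phi0; have Sk i : sph (X i w) by exact: Sw.
have D k : (angle (X k.1 w) (X k.2 w) < pi - phi) <->
    ~ `]-oo, (- cos phi)]%classic (dotp (X k.1 w) (X k.2 w)).
  rewrite /angle acos_lt_sub ?dotp_sph_le1//= in_itv/=.
  by rewrite ltNge; split=> /negP.
split=> [/bigmax_ltP[_ h] k /h /D//|h]; apply/bigmax_ltP; split.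
  by rewrite subr_gt0; case/andP: phi0.
by move=> k kk; apply/D; exact: h.
Qed.

End extremal_angles.

(** * Probability of a spherical cap *)

Section cap_probability.
Context {R : realType} {d} {T : measurableType d} (P : probability T R).
Context {n p : nat} (X : 'I_n -> {RV P >-> p.-tuple R}).
Hypothesis X_unif : forall i, uniform_on_sphere (distribution P (X i)).
Hypothesis p_ge2 : (2 <= p)%N.
Variables (k0 : 'I_p) (i0 : 'I_n).
Let mu := distribution P (X i0).

Definition cap (c : R) := pr P (coord_event X k0 `[c, +oo[ i0).

Let mcoord A : measurable A -> measurable (coord_event X k0 A i0).
Proof.
move=> mA; rewrite -[X in measurable X]setTI; apply: measurable_funPT => //.
by rewrite -[X in measurable X]setTI; exact: measurable_coord.
Qed.

(** The vector [- e_k0] also lies on the sphere, so [unif_dotp] yields the symmetry of the law of a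
    coordinate. *)
Lemma cap_opp c : pr P (coord_event X k0 `]-oo, (- c)] i0) = cap c.
Proof.
pose x : p.-tuple R := [tuple - (k == k0)%:R | k < p].
have dx y : dotp x y = - tnth y k0.
  rewrite /dotp (bigD1 k0)//= tnth_mktuple eqxx mulN1r big1 ?addr0// => k /negbTE kk.
  by rewrite tnth_mktuple kk oppr0 mul0r.
have Sx : sph x by apply/sphP; rewrite dx tnth_mktuple eqxx opprK.
have mI : measurable `]-oo, (- c)]%classic by exact: measurable_itv.
have := unif_dotp (X_unif i0) k0 Sx mI.
rewrite /cap /pr => h; rewrite -[P (coord_event X k0 `]-oo, (- c)] i0)]h.
congr (fine (P _)); apply/seteqP; split => w; rewrite /coord_event /= dx !in_itv/= andbT;
 by rewrite lerN2.
Qed.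

Lemma cap_union c c' : 0 < c -> 0 < c' ->
  pr P (coord_event X k0 (`[c, +oo[ `|` `]-oo, (- c')]) i0) = cap c + cap c'.
Proof.
move=> c0 c'0; rewrite -(cap_opp c').
have mI : measurable `[c, +oo[%classic by exact: measurable_itv.
have mJ : measurable `]-oo, (- c')]%classic by exact: measurable_itv.
rewrite (pr_split P (mcoord (measurableU _ _ mI mJ)) (mcoord mI)); congr (pr P _ + pr P _).
  by apply/seteqP; split=> [w []|w h]; rewrite /coord_event //=; split => //; left.
apply/seteqP; split=> w; rewrite /coord_event /= !in_itv/= !andbT.
  by move=> [[]].
by move=> h; split; [right|apply/negP; rewrite -ltNge; lra].
Qed.

Lemma cap_savg c : cap c = savg mu (fun y => (c <= tnth y k0)%R%:R).
Proof.
rewrite /savg /Rintegral /cap /pr.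
have mS : measurable (@sph R p) := measurable_sph.
have mI : measurable [set y : p.-tuple R | c <= tnth y k0].
  rewrite -[X in measurable X]setTI; apply: measurable_fun_ler => //.
  exact: measurable_coord.
rewrite (eq_integral (EFin \o \1_[set y : p.-tuple R | c <= tnth y k0])); last first.
  by move=> y _; rewrite /= indicE mem_setE.
rewrite integral_indic// -[LHS](pr_full (E := coord_event X k0 `[c, +oo[ i0) (G := X i0 @^-1` sph) (P := P)).
- rewrite /pr; congr (fine (P _)); apply/seteqP; split=> w; rewrite /coord_event /= in_itv/= andbT;
    by move=> [].
- by apply: mcoord; exact: measurable_itv.
- by rewrite -[X in measurable X]setTI; exact: measurable_funPT.
- by have [h _] := X_unif i0; rewrite /pr [X in fine X](h).
Qed.

Lemma cap_bounds c : 0 < c < 1 ->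
  let H := tailE mu k0 0 * Num.sqrt (1 - c ^+ 2) ^+ p.-1 in
  c * cap c <= H /\ c * H * (p%:R + 1) <= (p%:R * c ^+ 2 + 1) * cap c.
Proof.
move=> /andP[c0 c1] H.
have <- : tailE mu k0 c = H.
  by apply: tailE_formula; [exact: X_unif|exact: p_ge2|rewrite ltW].
by rewrite cap_savg; apply: tail_prob_bounds => //; exact: X_unif.
Qed.

End cap_probability.

(** * Staircase approximation of a half plane *)

Section grid.
Context {R : realType}.

(** The probability of the staircase with steps [b + k dl < N <= b + (k + 1) dl],
    [M <= z + b + (k + 1) dl], by inclusion-exclusion. As a finite combination of survival functions
    it passes to the limit. *)
Definition gridsum (sN : R -> R) (sJ : R -> R -> R) (z b dl : R) (J : nat) : R :=
  \sum_(k < J) (sN (b + k%:R * dl) - sN (b + k.+1%:R * dl)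
    - (sJ (z + (b + k.+1%:R * dl)) (b + k%:R * dl)
       - sJ (z + (b + k.+1%:R * dl)) (b + k.+1%:R * dl))).

Lemma cvg_gridsum (sN : nat -> R -> R) (sJ : nat -> R -> R -> R) sN' sJ' z b dl J :
  (forall y, sN n y @[n --> \oo] --> sN' y) ->
  (forall x y, sJ n x y @[n --> \oo] --> sJ' x y) ->
  gridsum (sN n) (sJ n) z b dl J @[n --> \oo] --> gridsum sN' sJ' z b dl J.
Proof.
move=> hN hJ; rewrite /gridsum; elim: J => [|J ih].
  by rewrite big_ord0; under eq_fun do rewrite big_ord0; exact: cvg_cst.
rewrite big_ord_recr/=; under eq_fun do rewrite big_ord_recr/=.
by apply: cvgD => //; apply: cvgB; apply: cvgB.
Qed.

Context {d} {T : measurableType d} (P : probability T R) (M N : T -> R).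
Hypotheses (mM : measurable_fun setT M) (mN : measurable_fun setT N).

Definition survN y := pr P [set w | y < N w].
Definition survJ x y := pr P [set w | x < M w /\ y < N w].
Definition cdf_sub z := pr P [set w | M w - N w <= z].

Let mgtM x : measurable [set w | x < M w].
Proof. by rewrite -[X in measurable X]setTI; exact: measurable_fun_ltr. Qed.

Let mgtN y : measurable [set w | y < N w].
Proof. by rewrite -[X in measurable X]setTI; exact: measurable_fun_ltr. Qed.

Let mle z : measurable [set w | M w - N w <= z].
Proof.
rewrite -[X in measurable X]setTI; apply: measurable_fun_ler => //.
exact: measurable_funB.
Qed.

Let mIoc y y' : measurable [set w | y < N w /\ N w <= y'].
Proof.
have -> : [set w | y < N w /\ N w <= y'] = [set w | y < N w] `&` ~` [set w | y' < N w].
  apply/seteqP; split=> w /= [h1 h2]; split => //; first by apply/negP; rewrite -leNgt.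
  by move/negP : h2; rewrite -leNgt.
by apply: measurableI => //; exact: measurableC.
Qed.

Let rect x y y' := [set w | M w <= x /\ y < N w /\ N w <= y'].

Let rectE x y y' : rect x y y' = [set w | y < N w /\ N w <= y'] `&` ~` [set w | x < M w].
Proof.
apply/seteqP; split=> w /= => [[h1 h2]|[h1 h2]]; split => //.
  by apply/negP; rewrite -leNgt.
by move/negP : h2; rewrite -leNgt.
Qed.

Let mrect x y y' : measurable (rect x y y').
Proof. by rewrite rectE; apply: measurableI => //; exact: measurableC. Qed.

Let pr_rect x y y' : y <= y' ->
  pr P (rect x y y') = survN y - survN y' - (survJ x y - survJ x y').
Proof.
move=> yy'; rewrite rectE.
have e1 : survN y = survN y' + pr P [set w | y < N w /\ N w <= y'].
  rewrite /survN (pr_split P (mgtN y) (mgtN y')); congr (pr P _ + pr P _).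
    apply/seteqP; split=> w /= => [[]//|h]; split => //; exact: le_lt_trans h.
  apply/seteqP; split=> w /= [h1 h2]; split => //; last by apply/negP; rewrite -leNgt.
  by move/negP : h2; rewrite -leNgt.
have mJ : measurable [set w | x < M w /\ y < N w].
  exact: (measurableI _ _ (mgtM x) (mgtN y)).
have e2 : survJ x y = survJ x y' + pr P ([set w | y < N w /\ N w <= y'] `&` [set w | x < M w]).
  rewrite /survJ (pr_split P mJ (mgtN y')); congr (pr P _ + pr P _).
    apply/seteqP; split=> w /= => [[[]]//|[h1 h2]]; split => //; split => //.
    exact: le_lt_trans h2.
  apply/seteqP; split=> w /= => [[[h1 h2] h3]|[[h1 h2] h3]].
    by move/negP : h3; rewrite -leNgt.
  by split => //; apply/negP; rewrite -leNgt.
have e3 := pr_split P (mIoc y y') (mgtM x).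
lra.
Qed.

Let band z y y' := [set w | M w - N w <= z] `&` [set w | y < N w /\ N w <= y'].

Let mband z y y' : measurable (band z y y').
Proof. exact: measurableI. Qed.

(** On the step with right end [y'], [M - N <= z] forces [M <= z + y'], and this forces
    [M - N <= z + dl] because [N > y' - dl]. *)
Lemma gridsum_bounds z b dl J : 0 <= dl ->
  pr P (band z b (b + J%:R * dl)) <= gridsum survN survJ z b dl J <=
  pr P (band (z + dl) b (b + J%:R * dl)).
Proof.
move=> dl0; rewrite /gridsum; elim: J => [|J /andP[ih1 ih2]].
  rewrite big_ord0 mul0r addr0.
  have B0 u : band u b b = set0.
    by apply/seteqP; split=> w //= -[_ /= [h1 h2]]; have := lt_le_trans h1 h2; rewrite ltxx.
  by rewrite !B0 /pr measure0 lexx.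
rewrite big_ord_recr/=; set y := b + J%:R * dl in ih1 ih2 *; set y' := b + J.+1%:R * dl.
have yE : y' = y + dl by rewrite /y' /y -(natr1 J); ring.
have yy' : y <= y' by rewrite yE lerDl.
have by_ : b <= y by rewrite /y lerDl mulr_ge0.
rewrite -(pr_rect (z + y') yy').
apply/andP; split.
  rewrite (pr_split P (mband z b y') (mgtN y)) [leLHS]addrC.
  apply: lerD; [apply: le_trans ih1; apply: pr_le => //|apply: pr_le => //].
  - by apply: measurableI => //; exact: measurableC.
  - move=> w /= [[h1 [h2 h3]] h4]; split=> //; split => //.
    by move/negP : h4; rewrite -leNgt.
  - exact: measurableI.
  - move=> w /= [[/= h1 [h2 h3]] h4]; split => //.
    by rewrite -lerBlDr; apply: le_trans h1; lra.
rewrite (pr_split P (mband (z + dl) b y') (mgtN y)) [leRHS]addrC.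
apply: lerD; [apply: le_trans ih2 _; apply: pr_le => //|apply: pr_le => //].
- by apply: measurableI => //; exact: measurableC.
- move=> w /= [h1 [h2 h3]]; split; first by split => //; split => //; exact: le_trans yy'.
  by apply/negP; rewrite -leNgt.
- exact: measurableI.
- move=> w /= [h1 [h2 h3]]; split => //; split; last first.
    by split => //; exact: le_lt_trans h2.
  by rewrite /= yE in h1 *; lra.
Qed.

Lemma gridsum_le z b dl J : 0 <= dl ->
  gridsum survN survJ z b dl J <= cdf_sub (z + dl).
Proof.
move=> dl0; have /andP[_ h] := gridsum_bounds z b J dl0; apply: le_trans h _.
by apply: pr_le => //; exact: subIsetl.
Qed.

Lemma cdf_sub_le z b dl J : 0 <= dl ->
  cdf_sub z <= gridsum survN survJ z b dl J + (1 - survN b) + survN (b + J%:R * dl).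
Proof.
move=> dl0; have /andP[h _] := gridsum_bounds z b J dl0.
set y := b + J%:R * dl in h *.
apply: (@le_trans _ _ (pr P (band z b y) + (1 - survN b) + survN y)); last by lra.
have mC := measurableC (mgtN b).
have mU1 := measurableU _ _ (mband z b y) mC.
apply: (@le_trans _ _ (pr P ((band z b y `|` ~` [set w | b < N w]) `|` [set w | y < N w]))).
  apply: pr_le => //; first exact: measurableU.
  move=> w /= h1; have [h2|h2] := pselect (b < N w); last by left; right.
  have [h3|h3] := pselect (y < N w); [by right|left; left].
  by split => //; split => //; rewrite leNgt; exact/negP.
apply: le_trans (pr_setU P mU1 (mgtN y)) _; rewrite lerD2r.
by apply: le_trans (pr_setU P (mband z b y) mC) _; rewrite pr_setC.
Qed.

End grid.

(** * Convergence of the distribution of a difference *)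

Section difference.
Context {R : realType} {d : nat -> measure_display} {T : forall n, measurableType (d n)}.
Context (P : forall n, probability (T n) R) (M N : forall n, T n -> R).
Hypothesis mM : forall n, measurable_fun setT (@M n).
Hypothesis mN : forall n, measurable_fun setT (@N n).
Context {d'} {T' : measurableType d'} (Q : probability T' R) (M' N' : T' -> R).
Hypotheses (mM' : measurable_fun setT M') (mN' : measurable_fun setT N').

(* Rectangles approximate the half plane [M - N <= z] from both sides. *)
Lemma cvg_cdf_sub z :
  (forall y, survN (P n) (@N n) y @[n --> \oo] --> survN Q N' y) ->
  (forall x y, survJ (P n) (@M n) (@N n) x y @[n --> \oo] --> survJ Q M' N' x y) ->
  (forall e, 0 < e -> exists2 B, 0 <= B & 1 - survN Q N' (- B) + survN Q N' B <= e) ->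
  (forall e, 0 < e -> exists2 dl, 0 < dl & cdf_sub Q M' N' (z + dl) <= cdf_sub Q M' N' z + e /\
      cdf_sub Q M' N' z - e <= cdf_sub Q M' N' (z - dl)) ->
  cdf_sub (P n) (@M n) (@N n) z @[n --> \oo] --> cdf_sub Q M' N' z.
Proof.
move=> hN hJ tight cont; apply/cvgrPdist_le => e e0.
have e4 : 0 < e / 4 by lra.
have [B B0 tB] := tight _ e4; have [dl0 dl00 [cp cm]] := cont _ e4.
(* Equal steps that end exactly at [B], with [J] so large that the mesh [dl] is at most [dl0]. *)
pose J := (Num.truncn (2 * B / dl0)).+1; pose dl := 2 * B / J%:R.
have J0 : 0 < J%:R :> R by rewrite ltr0n.
have dlp : 0 <= dl by rewrite divr_ge0// mulr_ge0.
have dle : dl <= dl0.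
  rewrite ler_pdivrMr// [leRHS]mulrC -ler_pdivrMr//; apply: ltW.
  by rewrite /J truncnS_gt.
have yJ : - B + J%:R * dl = B by rewrite /dl mulrC divfK ?lt0r_neq0//; ring.
have F_mono u v : u <= v -> cdf_sub Q M' N' u <= cdf_sub Q M' N' v.
  move=> uv; apply: pr_le.
  - by rewrite -[X in measurable X]setTI; apply: measurable_fun_ler => //; exact: measurable_funB.
  - by rewrite -[X in measurable X]setTI; apply: measurable_fun_ler => //; exact: measurable_funB.
  - by move=> w /= h; exact: le_trans uv.
have G u := cvg_gridsum (z := u) (b := - B) (dl := dl) (J := J) hN hJ.
have G' u : \forall n \near \oo, `|gridsum (survN Q N') (survJ Q M' N') u (- B) dl J -
    gridsum (survN (P n) (@N n)) (survJ (P n) (@M n) (@N n)) u (- B) dl J| <= e / 4.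
  by move/cvgrPdist_le : (G u) => /(_ _ e4).
have e8 : 0 < e / 8 by lra.
have H' u : \forall n \near \oo, `|survN Q N' u - survN (P n) (@N n) u| <= e / 8.
  by move/cvgrPdist_le : (hN u) => /(_ _ e8).
near=> n.
have g1 : `|gridsum (survN Q N') (survJ Q M' N') z (- B) dl J -
  gridsum (survN (P n) (@N n)) (survJ (P n) (@M n) (@N n)) z (- B) dl J| <= e / 4.
  by near: n; exact: G'.
have g2 : `|gridsum (survN Q N') (survJ Q M' N') (z - dl) (- B) dl J -
  gridsum (survN (P n) (@N n)) (survJ (P n) (@M n) (@N n)) (z - dl) (- B) dl J| <= e / 4.
  by near: n; exact: G'.
have g3 : `|survN Q N' (- B) - survN (P n) (@N n) (- B)| <= e / 8.
  by near: n; exact: H'.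
have g4 : `|survN Q N' B - survN (P n) (@N n) B| <= e / 8.
  by near: n; exact: H'.
have u1 := cdf_sub_le (P n) (@mM n) (@mN n) z (- B) J dlp.
(* The lower bound uses the staircase at [z - dl], so that the overshoot [dl] brings it back to
   [z]. *)
have l1 := gridsum_le (P n) (@mM n) (@mN n) (z - dl) (- B) J dlp.
have u2 := gridsum_le Q mM' mN' z (- B) J dlp.
have l2 := cdf_sub_le Q mM' mN' (z - dl) (- B) J dlp.
rewrite yJ in u1 l2; rewrite subrK in l1.
have c1 := F_mono (z + dl) (z + dl0); have c2 := F_mono (z - dl0) (z - dl).
have {}c1 : cdf_sub Q M' N' (z + dl) <= cdf_sub Q M' N' (z + dl0) by apply: c1; lra.
have {}c2 : cdf_sub Q M' N' (z - dl0) <= cdf_sub Q M' N' (z - dl) by apply: c2; lra.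
move: g1 g2 g3 g4; rewrite !ler_norml => /andP[? ?] /andP[? ?] /andP[? ?] /andP[? ?].
by apply/andP; split; lra.
Unshelve. all: by end_near. Qed.

End difference.

(** * The limiting survival function *)

Section gumbel_tail.
Context {R : realType}.
Implicit Types (x y L : R).

(** With [L] equal to [limit_const] this is [1 - D]. *)
Definition gtail L x : R := expR (- (L * expR (x / 2))).

Lemma gtail_tight L e : 0 < L -> 0 < e ->
  exists2 B, 0 <= B & 1 - gtail L (- B) + gtail L B <= e.
Proof.
move=> L0 e0; pose B := 2 * ((2 * L + 2 / L) / e).
have LL : 0 < 2 * L + 2 / L by apply: addr_gt0; [exact: mulr_gt0|exact: divr_gt0].
have BB : 0 < (2 * L + 2 / L) / e by exact: divr_gt0.
have B20 : B / 2 = (2 * L + 2 / L) / e by rewrite /B; field; rewrite !lt0r_neq0.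
exists B; first by rewrite /B; lra.
have Be : e * (B / 2) = 2 * L + 2 / L by rewrite B20 mulrC divfK// lt0r_neq0.
have LV : L * L^-1 = 1 by rewrite mulfV// lt0r_neq0.
have LI : 0 < L^-1 by rewrite invr_gt0.
have h1 : 1 - gtail L (- B) <= e / 2.
  have : 1 + - (L * expR (- B / 2)) <= gtail L (- B) by exact: expR_ge1Dx.
  have : expR (- B / 2) <= (1 + B / 2)^-1.
    by rewrite mulNr expRN lef_pV2 ?posrE ?expR_gt0 ?expR_ge1Dx//; lra.
  have : (1 + B / 2)^-1 <= e / 2 / L.
    rewrite -[leRHS]invrK lef_pV2 ?posrE ?invr_gt0 ?divr_gt0//; last by lra.
    rewrite (_ : (e / 2 / L)^-1 = 2 * L / e); last by field; rewrite !lt0r_neq0.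
    rewrite ler_pdivrMr//; nra.
  move=> a1 a2 a3.
  have : L * expR (- B / 2) <= L * (e / 2 * L^-1) by rewrite ler_pM2l//; exact: le_trans a1.
  have -> : L * (e / 2 * L^-1) = e / 2 * (L * L^-1) by ring.
  by rewrite LV; lra.
have h2 : gtail L B <= e / 2.
  rewrite /gtail expRN -[leRHS]invrK lef_pV2 ?posrE ?expR_gt0 ?invr_gt0 ?divr_gt0//.
  apply: le_trans (expR_ge1Dx _).
  have : L * (1 + B / 2) <= L * expR (B / 2) by rewrite ler_pM2l// expR_ge1Dx.
  rewrite (_ : (e / 2)^-1 = 2 / e); last by field; rewrite lt0r_neq0.
  have : 2 / e <= L * (B / 2).
    rewrite ler_pdivrMr// (_ : L * (B / 2) * e = L * (e * (B / 2))); last by ring.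
    have -> : L * (e * (B / 2)) = L * (2 * L) + 2.
      by rewrite Be; field; rewrite lt0r_neq0.
    have : 0 < L * (2 * L) by rewrite !mulr_gt0.
    lra.
  lra.
lra.
Qed.

End gumbel_tail.

(** * Limit laws of the extremal angles *)

Section extreme_angles_limit.
Context {R : realType} (p : nat -> nat)
  (d : nat -> measure_display) (T : forall n, measurableType (d n))
  (P : forall n, probability (T n) R)
  (X : forall n, 'I_n -> {RV (P n) >-> (p n).-tuple R}).
Hypothesis p_ge2 : forall n, (2 <= n)%N -> (2 <= p n)%N.
Hypothesis X_indep : forall n, (2 <= n)%N -> mutually_independent (@X n).
Hypothesis X_unif : forall n, (2 <= n)%N -> forall i : 'I_n,
    uniform_on_sphere (distribution (P n) (@X n i)).
Hypothesis p_infty : p @ \oo --> \oo.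

Definition first_coord n (n2 : (2 <= n)%N) : 'I_(p n) := Ordinal (ltnW (p_ge2 n2)).

(* The values at [n < 2] are irrelevant. *)
Definition cap_const n : R :=
  if n is n'.+2 then
    tailE (distribution (P n'.+2) (@X n'.+2 ord0)) (first_coord (isT : (2 <= n'.+2)%N)) 0
  else 0.

Definition cap_seq n (c : R) : R :=
  if n is n'.+2 then cap (@X n'.+2) (first_coord (isT : (2 <= n'.+2)%N)) ord0 c
  else 0.

Definition coord_prob (A : nat -> set R) n : R :=
  if n is n'.+2 then
    pr (P n'.+2) (coord_event (@X n'.+2) (first_coord (isT : (2 <= n'.+2)%N)) (A n'.+2) ord0)
  else 0.

Definition limit_const : R := (2 * Num.sqrt (2 * pi))^-1.
Local Notation L := limit_const.

Lemma limit_const_gt0 : 0 < L.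
Proof. by rewrite invr_gt0 mulr_gt0// sqrtr_gt0 mulr_gt0// pi_gt0. Qed.

(** The choice [K = 2 L] undoes the factor [1 / 2] that comes from counting unordered pairs, so that
    the limit of the expected count is [L * expR (x / 2)]. *)
Definition lev n (x : R) := level p cap_const (2 * L) n x.

Let cap_const_bounds n : (2 <= n)%N ->
  2 / 9 / Num.sqrt (p n)%:R <= cap_const n <= (2 * Num.sqrt (p n)%:R)^-1.
Proof.
case: n => [|[|n]]// n2; apply: tailE0_bounds; [exact: X_unif|exact: p_ge2].
Qed.

Let cap_seq_bounds n c : (2 <= n)%N -> 0 < c < 1 ->
  let H := cap_const n * Num.sqrt (1 - c ^+ 2) ^+ (p n).-1 in
  c * cap_seq n c <= H /\
  c * H * ((p n)%:R + 1) <= ((p n)%:R * c ^+ 2 + 1) * cap_seq n c.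
Proof.
case: n => [|[|n]]// n2 c01; apply: cap_bounds => //; [exact: X_unif|exact: p_ge2].
Qed.

Let K0 : 0 < 2 * L. Proof. by rewrite mulr_gt0// limit_const_gt0. Qed.

Lemma cap_seq_cvg x : ('C(n, 2))%:R * cap_seq n (cos (lev n x)) @[n --> \oo] -->
  L * expR (x / 2).
Proof.
have -> : L * expR (x / 2) = 2 * L / 2 * expR (x / 2) by field.
exact: (tail_cvg p_ge2 p_infty K0 cap_const_bounds cap_seq_bounds).
Qed.

Lemma lev_cvg x : lev n x - asin (tn R p n) @[n --> \oo] --> 0.
Proof. exact: (level_cvg p_ge2 p_infty K0 cap_const_bounds). Qed.

Lemma lev_range x : \forall n \near \oo,
  0 < lev n x < pi /\ 0 < cos (lev n x) < 1.
Proof. exact: (level_range p_ge2 p_infty K0 cap_const_bounds). Qed.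

(** Common source of the limits for the minimum, the maximum and the pair, which differ only in the
    set [A n] of forbidden dot products. *)
Lemma void_limit (A : nat -> set R) (E : forall n, set (T n)) (lam : R) :
  (forall n, measurable (A n)) -> (forall n, measurable (E n)) ->
  (\forall n \near \oo, forall w, on_sphere (@X n) w ->
    E n w <-> (forall k : 'I_n * 'I_n, (k.1 < k.2)%N -> ~ A n (dotp (@X n k.1 w) (@X n k.2 w)))) ->
  ('C(n, 2))%:R * coord_prob A n @[n --> \oo] --> lam ->
  pr (P n) (E n) @[n --> \oo] --> expR (- lam).
Proof.
move=> mA mE EA cl; apply: (poisson_limit _ cl).
  apply: nearW => -[|[|n]]; rewrite /coord_prob ?lexx ?ler01//.
  rewrite pr_ge0 pr_le1// -[X in measurable X]setTI.
  apply: measurable_funPT => //.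
  by rewrite -[X in measurable X]setTI; exact: measurable_coord.
apply: filterS2 (nbhs_infty_ge 2) EA => -[|[|n]]// n2 EA.
rewrite (pr_void_dot (X_indep n2) (X_unif n2) (mA _) (mE _) EA) -size_ltpairs.
exact: (void_dot_bound (X_indep n2) (X_unif n2) (first_coord (isT : (2 <= n.+2)%N)) (mA n.+2) ord0).
Qed.

Local Notation Tmin n := (fun w => angle_min (fun i => @X n i w)).
Local Notation Tmax n := (fun w => angle_max (fun i => @X n i w)).

Let mTmin n : measurable_fun setT (Tmin n). Proof. exact: measurable_angle_min. Qed.
Let mTmax n : measurable_fun setT (Tmax n). Proof. exact: measurable_angle_max. Qed.

Let mEmin n x : measurable [set w | lev n x < Tmin n w].
Proof. by rewrite -[X in measurable X]setTI; exact: measurable_fun_ltr. Qed.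

Let mEmax n y : measurable [set w | Tmax n w < pi - lev n y].
Proof. by rewrite -[X in measurable X]setTI; exact: measurable_fun_ltr. Qed.

Let mIge c : measurable (`[c, +oo[%classic : set R). Proof. exact: measurable_itv. Qed.
Let mIle c : measurable (`]-oo, c]%classic : set R). Proof. exact: measurable_itv. Qed.

Lemma angle_min_cvg x :
  pr (P n) [set w | lev n x < Tmin n w] @[n --> \oo] --> gtail L x.
Proof.
apply: (void_limit (A := fun n => `[cos (lev n x), +oo[%classic)).
- by move=> n; exact: mIge.
- by move=> n; exact: mEmin.
- by apply: filterS (lev_range x) => n [h _] w Sw; exact: angle_min_gt.
apply: cvg_trans; last exact: cap_seq_cvg.
by apply: near_eq_cvg; apply: nearW => -[|[|n]].
Qed.

Lemma angle_max_cvg y :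
  pr (P n) [set w | Tmax n w < pi - lev n y] @[n --> \oo] --> gtail L y.
Proof.
apply: (void_limit (A := fun n => `]-oo, (- cos (lev n y))]%classic)).
- by move=> n; exact: mIle.
- by move=> n; exact: mEmax.
- by apply: filterS (lev_range y) => n [h _] w Sw; exact: angle_max_lt.
apply: cvg_trans; last exact: cap_seq_cvg.
apply: near_eq_cvg; apply: nearW => -[|[|n]]//=; congr (_ * _).
by apply/esym; apply: cap_opp; exact: X_unif.
Qed.

(** Independence in the limit: both cosines are eventually positive, so the two caps are disjoint,
    their probabilities add, and the exponential turns the sum into a product. *)
Lemma angle_min_max_cvg x y :
  pr (P n) [set w | lev n x < Tmin n w /\ Tmax n w < pi - lev n y] @[n --> \oo] -->
  gtail L x * gtail L y.
Proof.
rewrite /gtail -expRD -opprD.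
apply: (void_limit (A := fun n =>
  `[cos (lev n x), +oo[%classic `|` `]-oo, (- cos (lev n y))]%classic)).
- by move=> n; apply: measurableU; [exact: mIge|exact: mIle].
- by move=> n; exact: (measurableI _ _ (mEmin n x) (mEmax n y)).
- apply: filterS2 (lev_range x) (lev_range y) => n [hx _] [hy _] w Sw.
  have h1 := angle_min_gt Sw hx; have h2 := angle_max_lt Sw hy.
  split=> [[/h1 a1 /h2 a2] k kk [|]|h]; [exact: a1|exact: a2|split].
    by apply/h1 => k kk Ak; apply: (h k kk); left.
  by apply/h2 => k kk Ak; apply: (h k kk); right.
- have c : ('C(n, 2))%:R * cap_seq n (cos (lev n x)) +
      ('C(n, 2))%:R * cap_seq n (cos (lev n y)) @[n --> \oo] -->
      L * expR (x / 2) + L * expR (y / 2).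
    by apply: cvgD; exact: cap_seq_cvg.
  apply: cvg_trans; last exact: c.
  apply: near_eq_cvg.
  apply: filterS2 (lev_range x) (lev_range y) => -[|[|n]] [_ /andP[cx _]] [_ /andP[cy _]] /=;
    rewrite ?bin0n ?mul0r ?addr0// -mulrDr; congr (_ * _).
  by apply/esym; apply: cap_union => //; exact: X_unif.
Qed.

(** The window between [lev n (- B)] and [lev n B] carries nearly all the mass for large [B], and
    for fixed [B] it shrinks to [asin (tn R p n)]. *)
Let near_prob_small (Y : forall n, T n -> R) (e : R)
    (F1 : R -> forall n, set (T n)) :
  (forall n, measurable_fun setT (@Y n)) -> 0 < e ->
  (forall x n, measurable (F1 x n)) ->
  (forall x, pr (P n) (F1 x n) @[n --> \oo] --> gtail L x) ->
  (forall x n, F1 x n = [set w | lev n x < @Y n w + asin (tn R p n)]) ->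
  P n [set w | e < `|@Y n w - 0| ] @[n --> \oo] --> 0%E.
Proof.
move=> mY e0 mF1 cF1 F1E.
have mS n : measurable [set w | e < `|@Y n w - 0|].
  rewrite -[X in measurable X]setTI; apply: measurable_fun_ltr => //.
  by apply: measurableT_comp => //; exact: measurable_funB.
apply: cvg_EFin; first by apply: nearW => n; exact: fin_num_measure.
apply/cvgr0Pnorm_le => k k0.
have k2 : 0 < k / 2 by rewrite divr_gt0.
have [B B0 tB] := gtail_tight limit_const_gt0 k2.
have k4 : 0 < k / 4 by rewrite divr_gt0.
have e2 : 0 < e / 2 by rewrite divr_gt0.
have hl u : \forall n \near \oo, `|lev n u - asin (tn R p n)| <= e / 2.
  by move/cvgr0Pnorm_le : (lev_cvg u) => /(_ _ e2).
have hF u : \forall n \near \oo, `|gtail L u - pr (P n) (F1 u n)| <= k / 4.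
  by move/cvgrPdist_le : (cF1 u) => /(_ _ k4).
near=> n.
have b1 : `|lev n (- B) - asin (tn R p n)| <= e / 2.
  by near: n; exact: hl.
have b2 : `|lev n B - asin (tn R p n)| <= e / 2.
  by near: n; exact: hl.
have c1 : `|gtail L (- B) - pr (P n) (F1 (- B) n)| <= k / 4.
  by near: n; exact: hF.
have c2 : `|gtail L B - pr (P n) (F1 B n)| <= k / 4.
  by near: n; exact: hF.
rewrite ger0_norm; last exact: pr_ge0.
have mC := measurableC (mF1 (- B) n).
apply: (@le_trans _ _ (pr (P n) (~` F1 (- B) n `|` F1 B n))).
  apply: pr_le; [exact: mS|exact: measurableU|].
  move=> w; rewrite /= subr0 !F1E => h.
  have [h1|h1] := pselect (lev n (- B) < @Y n w + asin (tn R p n)); last by left.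
  right; rewrite /= ltNge; apply/negP => h2; move: h; apply/negP; rewrite -leNgt.
  move: b1 b2; rewrite !ler_norml => /andP[? ?] /andP[? ?].
  by apply/andP; split; lra.
apply: le_trans (pr_setU (P n) mC (mF1 B n)) _; rewrite pr_setC//.
by move: c1 c2; rewrite !ler_norml => /andP[? ?] /andP[? ?]; lra.
Unshelve. all: by end_near. Qed.

Lemma angle_min_cvg_prob :
  cvg_in_probability P (fun n w => Tmin n w - asin (tn R p n)) 0.
Proof.
have mY n : measurable_fun setT (fun w => Tmin n w - asin (tn R p n)).
  by apply: measurable_funB => //; exact: mTmin.
split=> // e e0.
apply: (near_prob_small mY e0 (fun x n => mEmin n x) angle_min_cvg).
by move=> x n; apply/seteqP; split=> w /=; rewrite subrK.
Qed.

Lemma angle_max_cvg_prob :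
  cvg_in_probability P (fun n w => pi - Tmax n w - asin (tn R p n)) 0.
Proof.
have mY n : measurable_fun setT (fun w => pi - Tmax n w - asin (tn R p n)).
  by do 2 (apply: measurable_funB => //); exact: mTmax.
split=> // e e0.
apply: (near_prob_small mY e0 (fun x n => mEmax n x) angle_max_cvg).
by move=> x n; apply/seteqP; split=> w /=; rewrite subrK; lra.
Qed.

Lemma angle_sum_cvg_distribution (d' : measure_display) (T' : measurableType d')
    (Q : probability T' R) (Z1 Z2 : {RV Q >-> R}) :
  independent2 Z1 Z2 ->
  (forall x : R, cdf Z1 x = (limit_cdf x)%:E) ->
  (forall x : R, cdf Z2 x = (limit_cdf x)%:E) ->
  cvg_in_distribution P
    (fun n w => (alphan R p n)^-1 * (Tmax n w + Tmin n w - pi)) (Z2 - Z1 : {RV Q >-> R}).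
Proof.
move=> ind c1 c2.
(* [M], built from the minimum, has limit law [Z2], and [N], built from the maximum, has limit law
   [Z1]; this fixes the sign of the difference. *)
pose M n w := (alphan R p n)^-1 * (Tmin n w - lev n 0).
pose N n w := (alphan R p n)^-1 * (pi - Tmax n w - lev n 0).
have mM n : measurable_fun setT (M n).
  apply: measurable_funM => //; apply: measurable_funB => //; exact: mTmin.
have mN n : measurable_fun setT (N n).
  by apply: measurable_funM => //; do 2 (apply: measurable_funB => //); exact: mTmax.
have MN n w : M n w - N n w = (alphan R p n)^-1 * (Tmax n w + Tmin n w - pi).
  by rewrite /M /N; ring.
have mZ1 : measurable_fun setT Z1 by exact: measurable_funPT.
have mZ2 : measurable_fun setT Z2 by exact: measurable_funPT.
have sZ (Z : {RV Q >-> R}) x : (forall x : R, cdf Z x = (limit_cdf x)%:E) ->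
    pr Q [set w | x < Z w] = gtail L x.
  move=> c.
  have mZ : measurable [set w | Z w <= x].
    by rewrite -[X in measurable X]setTI; apply: measurable_fun_ler => //; exact: measurable_funPT.
  have -> : [set w | x < Z w] = ~` [set w | Z w <= x].
    by apply/seteqP; split=> w /= h; [apply/negP|move/negP : h]; rewrite -ltNge.
  rewrite pr_setC//.
  have : pr Q [set w | Z w <= x] = limit_cdf x.
    have := c x; rewrite /cdf /distribution /pushforward => h.
    have -> : [set w | Z w <= x] = Z @^-1` `]-oo, x].
      by apply/seteqP; split=> w /=; rewrite in_itv.
    by rewrite /pr [X in fine X]h.
  by move=> ->; rewrite /limit_cdf /gtail /limit_const; ring.
split.
  move=> n; have := measurable_funB (mM n) (mN n).
  by congr measurable_fun; apply/funext => w /=; rewrite MN.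
move=> z cz.
have mF n : measurable [set w | M n w - N n w <= z].
  by rewrite -[X in measurable X]setTI; apply: measurable_fun_ler => //; exact: measurable_funB.
have FE u : cdf (Z2 - Z1 : {RV Q >-> R}) u = (cdf_sub Q Z2 Z1 u)%:E.
  rewrite /cdf_sub -prE.
    rewrite (_ : [set w | Z2 w - Z1 w <= u] = (Z2 - Z1 : {RV Q >-> R}) @^-1` `]-oo, u])//.
  rewrite -[X in measurable X]setTI; apply: measurable_fun_ler => //.
  exact: measurable_funB.
rewrite FE; apply: cvg_EFin.
  apply: nearW => n; under eq_set do rewrite -MN.
  exact: fin_num_measure.
have alpha0 := alphan_gt0 (R := R) p_ge2.
have levE n x : lev n x = lev n 0 + alphan R p n * x by rewrite /lev /level add0r mulrDr; ring.
suff : cdf_sub (P n) (M n) (N n) z @[n --> \oo] --> cdf_sub Q Z2 Z1 z.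
  apply: cvg_trans; apply: near_eq_cvg; apply: nearW => n; rewrite /cdf_sub /pr /=.
  by congr (fine (P n _)); apply/seteqP; split=> w /=; rewrite MN.
have xM n x w : 0 < alphan R p n -> (x < M n w) = (lev n x < Tmin n w).
  by move=> a0; rewrite /M ltr_pdivlMl// (levE _ x) ltrBrDl.
have yN n y w : 0 < alphan R p n -> (y < N n w) = (Tmax n w < pi - lev n y).
  by move=> a0; rewrite /N ltr_pdivlMl// (levE _ y); apply/idP/idP; lra.
apply: cvg_cdf_sub => //.
- move=> y; rewrite [survN Q Z1 y](sZ _ _ c1).
  apply: cvg_trans; last exact: angle_max_cvg.
  apply: near_eq_cvg.
  apply: filterS alpha0 => n a0; rewrite /survN; congr (pr _ _).
  by apply/seteqP; split=> w /=; rewrite yN.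
- move=> x y.
  have -> : survJ Q Z2 Z1 x y = gtail L x * gtail L y.
    rewrite -(sZ _ x c2) -(sZ _ y c1) /survJ mulrC -pr_indep.
    + by congr (pr Q _); apply/seteqP; split=> w /= [].
    + by rewrite -[X in measurable X]setTI; apply: measurable_fun_ltr.
    + by rewrite -[X in measurable X]setTI; apply: measurable_fun_ltr.
    + have := ind `]y, +oo[%classic `]x, +oo[%classic (measurable_itv _) (measurable_itv _).
      rewrite /indep; have E (Z : T' -> R) u : Z @^-1` `]u, +oo[ = [set w | u < Z w].
        by apply/seteqP; split=> w /=; rewrite in_itv/= andbT.
      by rewrite !E.
  apply: cvg_trans; last exact: angle_min_max_cvg.
  apply: near_eq_cvg.
  apply: filterS alpha0 => n a0; rewrite /survJ; congr (pr _ _).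
  by apply/seteqP; split=> w /=; rewrite xM// yN.
- move=> e e0; have [B B0 h] := gtail_tight limit_const_gt0 e0.
  by exists B => //; rewrite /survN !(sZ _ _ c1).
- move=> e e0.
  (* Only continuity points [z] of the limit are tested, and [cz] supplies the modulus that absorbs
     the mesh of the staircase. *)
  have cF : cdf_sub Q Z2 Z1 u @[u --> z] --> cdf_sub Q Z2 Z1 z.
    apply: (@fine_cvg _ _ _ _ (cdf (Z2 - Z1 : {RV Q >-> R}))).
    by rewrite -FE; exact: cz.
  move/cvgrPdist_le : cF => /(_ _ e0) /nbhs_ballP[r /= r0 hr].
  exists (r / 2); first by rewrite divr_gt0.
  have h1 : `|cdf_sub Q Z2 Z1 z - cdf_sub Q Z2 Z1 (z + r / 2)| <= e.
    apply: hr; rewrite /ball /= opprD addNKr normrN gtr0_norm ?divr_gt0//; lra.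
  have h2 : `|cdf_sub Q Z2 Z1 z - cdf_sub Q Z2 Z1 (z - r / 2)| <= e.
    apply: hr; rewrite /ball /= opprB addrC subrK gtr0_norm ?divr_gt0//; lra.
  by move: h1 h2; rewrite !ler_norml => /andP[? ?] /andP[? ?]; split; lra.
Qed.

End extreme_angles_limit.

Unset Implicit Arguments.

Theorem corollary2p1 (R : realType) (p : nat -> nat)
  (d : nat -> measure_display) (T : forall n, measurableType (d n))
  (P : forall n, probability (T n) R)
  (X : forall n, 'I_n -> {RV (P n) >-> (p n).-tuple R})
  (p_ge2 : forall n, (2 <= n)%N -> (2 <= p n)%N)
  (X_indep : forall n, (2 <= n)%N -> mutually_independent (X n))
  (X_unif : forall n, (2 <= n)%N -> forall i : 'I_n,
    uniform_on_sphere (distribution (P n) (X n i)))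
  (p_infty : p @ \oo --> \oo) :
  let Theta_min n (w : T n) := angle_min (fun i => X n i w) in
  let Theta_max n (w : T n) := angle_max (fun i => X n i w) in
  (forall (d' : measure_display) (T' : measurableType d')
      (Q : probability T' R) (Z1 Z2 : {RV Q >-> R}),
    independent2 Z1 Z2 ->
    (forall x : R, cdf Z1 x = (limit_cdf x)%:E) ->
    (forall x : R, cdf Z2 x = (limit_cdf x)%:E) ->
    cvg_in_distribution P
      (fun n w => (alphan R p n)^-1 * (Theta_max n w + Theta_min n w - pi))
      (Z2 - Z1 : {RV Q >-> R}))
  /\
  (cvg_in_probability P (fun n w => Theta_min n w - asin (tn R p n)) 0 /\
   cvg_in_probability P (fun n w => pi - Theta_max n w - asin (tn R p n)) 0).
Proof.
split; last first.
  split; first exact: (angle_min_cvg_prob p_ge2 X_indep X_unif p_infty).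
  exact: (angle_max_cvg_prob p_ge2 X_indep X_unif p_infty).
by move=> d' T' Q Z1 Z2;
  exact: (angle_sum_cvg_distribution p_ge2 X_indep X_unif p_infty).
Qed.
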